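(* Let $H$ be a real Hilbert space and let $A$ be a self-adjoint nonnegative linear operator on $H$ with dense domain $D(A)$. Let $m:[0,+\infty)\to(0,+\infty)$ be a function of class $C^{1}$ with $\inf_{\sigma\geq 0}m(\sigma)>0$, and let $(u_{0},u_{1})\in D(A^{3/2})\times D(A^{1/2})$. For $\varepsilon>0$ let $u_{\varepsilon}$ be the global solution (which exists and is unique for $\varepsilon$ small enough) of $$\varepsilon u_{\varepsilon}''(t)+\frac{1}{1+t}\,u_{\varepsilon}'(t)+m\bigl(|A^{1/2}u_{\varepsilon}(t)|^{2}\bigr)Au_{\varepsilon}(t)=0\quad\forall t\geq 0,\qquad u_{\varepsilon}(0)=u_{0},\quad u_{\varepsilon}'(0)=u_{1},$$ let $u$ be the unique global solution of $$\frac{1}{1+t}\,u'(t)+m\bigl(|A^{1/2}u(t)|^{2}\bigr)Au(t)=0\quad\forall t\geq 0,\qquad u(0)=u_{0},$$ and let $\theta_{\varepsilon}$ be the solution of $$\varepsilon\theta_{\varepsilon}''(t)+\frac{1}{1+t}\,\theta_{\varepsilon}'(t)=0\quad\forall t\geq 0,\qquad\theta_{\varepsilon}(0)=0,\quad\theta_{\varepsilon}'(0)=u_{1}+m\bigl(|A^{1/2}u_{0}|^{2}\bigr)Au_{0}.$$ Define $\rho_{\varepsilon}(t):=u_{\varepsilon}(t)-u(t)$ and $r_{\varepsilon}(t):=u_{\varepsilon}(t)-u(t)-\theta_{\varepsilon}(t)$ for $t\geq 0$. Then there exist $\varepsilon_{0}>0$ and $C>0$ such that for every $\varepsilon\in(0,\varepsilon_{0})$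 we have $$|\rho_{\varepsilon}(t)|\leq C\varepsilon\quad\forall t\geq 0;$$ $$|A^{1/2}\rho_{\varepsilon}(t)|\leq C\frac{\varepsilon}{1+t}\quad\forall t\geq 0;$$ $$|r_{\varepsilon}'(t)|\leq C\frac{\sqrt{\varepsilon}}{1+t}\quad\forall t\geq 0;$$ $$\int_{0}^{+\infty}(1+s)\left|A^{1/2}\rho_{\varepsilon}(s)\right|^{2}ds\leq C\varepsilon^{2};$$ $$\int_{0}^{+\infty}(1+s)|r_{\varepsilon}'(s)|^{2}\,ds\leq C\varepsilon^{2}.$$
   Context: $|x|$ and $\langle x,y\rangle$ denote the norm and the scalar product in $H$. The operator $A$ is nonnegative in the sense that $\langle Ax,x\rangle\geq 0$ for all $x\in D(A)$; it is not assumed to be coercive. For $\alpha\geq 0$ the power $A^{\alpha}$, with domain $D(A^{\alpha})$, is defined by the spectral theorem, and $D(A^{\alpha})$ carries the graph norm. Solutions $u_{\varepsilon}$ of the second order nonlinear problem are understood in the class $C^{2}([0,+\infty);H)\cap C^{1}([0,+\infty);D(A^{1/2}))\cap C^{0}([0,+\infty);D(A))$. The solution $u$ of the first order problem is understood in the class $C^{1}([0,+\infty);H)\cap C^{0}([0,+\infty);D(A))$. The constants $\varepsilon_0$ and $C$ do not depend on $\varepsilon$ or $t$. *)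

(* Defs.v *)
From HB Require Import structures.
From mathcomp Require Import all_boot all_order all_algebra.
From mathcomp Require Import all_classical all_reals all_analysis.

Set Implicit Arguments.
Unset Strict Implicit.
Unset Printing Implicit Defensive.

Import Order.TTheory GRing.Theory Num.Theory.
Import numFieldNormedType.Exports.

Local Open Scope classical_set_scope.
Local Open Scope ring_scope.

(* A real Hilbert space is a complete normed module [H] with an inner product *)
(* [dot : {dot H for idfun}] inducing its norm.                               *)
Definition induces_norm (R : realType) (H : completeNormedModType R)
    (dot : {dot H for (@idfun R)}) : Prop :=
  forall x : H, `|x| ^+ 2 = dot x x.

Section UnboundedOperators.
Variables (R : realType) (H : completeNormedModType R).

(* The values of an operator outside its domain are irrelevant. *)
Record operator := Operator { dom : set H; opfun :> H -> H }.

Definition linear_operator (A : operator) : Prop :=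
  dom A 0 /\
  forall (a : R) (x y : H), dom A x -> dom A y ->
    dom A (a *: x + y) /\ A (a *: x + y) = a *: A x + A y.

Definition graph_norm (A : operator) (x : H) : R :=
  Num.sqrt (`|x| ^+ 2 + `|A x| ^+ 2).

Variable dot : {dot H for (@idfun R)}.

(* The last conjunct says that the graph of [A] is the graph of its adjoint. *)
Definition self_adjoint (A : operator) : Prop :=
  [/\ linear_operator A, closure (dom A) = [set: H] &
      forall y z : H, (forall x, dom A x -> dot (A x) y = dot x z) <->
                      (dom A y /\ A y = z)].

Definition nonnegative_operator (A : operator) : Prop :=
  forall x, dom A x -> 0 <= dot (A x) x.

(* Projection-valued measures on the Borel sets of R, carried by [0, +oo). *)
Definition resolution_of_identity (E : set R -> H -> H) : Prop :=
  [/\ (forall B, measurable B -> linear (E B)),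
      (forall B, measurable B -> forall x y, dot (E B x) y = dot x (E B y)),
      (forall B1 B2, measurable B1 -> measurable B2 ->
         forall x, E (B1 `&` B2) x = E B1 (E B2 x)),
      (forall x : H, E `[0, +oo[%classic x = x) &
      (forall F : nat -> set R, (forall n, measurable (F n)) ->
         trivIset setT F ->
         forall x, \sum_(0 <= i < n) E (F i) x @[n --> \oo] -->
                   E (\bigcup_i F i) x)].

Definition spectral_mass (E : set R -> H -> H) (x : H) (B : set R) : \bar R :=
  (dot (E B x) x)%:E.

Definition spectral_integral (E : set R -> H -> H) (f : R -> R) (x : H) :
    \bar R :=
  (\int[spectral_mass E x]_(l in `[0%R, +oo[) (f l)%:E)%E.

Definition spectral_dom (E : set R -> H -> H) (f : R -> R) : set H :=
  [set x | (spectral_integral E (fun l => f l ^+ 2)%R x < +oo)%E].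

(* For [x] in [spectral_dom E f], [spectral_value E f x y] means               *)
(*   y = \int f(l) dE_l x,                                                     *)
(* in the weak sense <y, z> = \int f(l) d<E_l x, z>. The signed measure        *)
(* <E x, z> is expressed by polarization; [z] ranges over the dense subspace   *)
(* [spectral_dom E f] so that both integrals are finite.                       *)
Definition spectral_value (E : set R -> H -> H) (f : R -> R) (x y : H) : Prop :=
  forall z, spectral_dom E f z ->
    dot y z =
    4^-1 * (fine (spectral_integral E f (x + z))
            - fine (spectral_integral E f (x - z))).

Definition spectral_operator (E : set R -> H -> H) (f : R -> R) : operator :=
  Operator (spectral_dom E f) (fun x => xget 0 [set y | spectral_value E f x y]).

Definition spectral_resolution (A : operator) (E : set R -> H -> H) : Prop :=
  [/\ resolution_of_identity E, dom A = spectral_dom E id &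
      forall x, dom A x -> spectral_value E id x (A x)].

(* [A ^ alpha] is [\int l ^ alpha dE_l], where [E] is the spectral resolution  *)
(* of [A], which the spectral theorem provides for every nonnegative           *)
(* self-adjoint [A]. For any other [A] the power is nowhere defined.           *)
Definition operator_power (A : operator) (alpha : R) : operator :=
  match pselect (exists E, spectral_resolution A E) with
  | left h => spectral_operator (projT1 (cid h)) (fun l => l `^ alpha)
  | right _ => Operator set0 (fun=> 0)
  end.

End UnboundedOperators.

Section HalfLineCalculus.
Variables (R : realType) (V : normedModType R).

(* Derivative of [f] relative to [0, +oo): one-sided at 0, and independent of  *)
(* the values of [f] on negative reals at every [t >= 0].                      *)
Definition hderiv (f : R -> V) (t : R) : V :=
  lim ((s - t)^-1 *: (f s - f t) @[s --> within `[0, +oo[ t^']).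

(* [half_line_C D N k f]: [f] restricted to [0, +oo) is of class C^k with      *)
(* values in the subspace [D] normed by [N]. [N] is meant to dominate the norm *)
(* of [V], so that the derivative in [(D, N)] can only be [hderiv f].          *)
Variables (D : set V) (N : V -> R).

Definition half_line_continuous (f : R -> V) : Prop :=
  forall t, 0 <= t ->
    D (f t) /\ N (f s - f t) @[s --> within `[0, +oo[ (nbhs t)] --> (0 : R).

Definition half_line_differentiable (f : R -> V) : Prop :=
  forall t, 0 <= t ->
    [/\ D (f t), D (hderiv f t) &
        N ((s - t)^-1 *: (f s - f t) - hderiv f t)
          @[s --> within `[0, +oo[ t^'] --> (0 : R)].

Fixpoint half_line_C (k : nat) (f : R -> V) : Prop :=
  match k with
  | 0 => half_line_continuous f
  | j.+1 => half_line_differentiable f /\ half_line_C j (hderiv f)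
  end.

End HalfLineCalculus.

Section Problems.
Variables (R : realType) (H : completeNormedModType R).
Variables (dot : {dot H for (@idfun R)}) (A : operator H) (m : R -> R).

Definition C_H (k : nat) (f : R -> H) : Prop :=
  half_line_C [set: H] (fun x => `|x|) k f.

Definition C_dom (B : operator H) (k : nat) (f : R -> H) : Prop :=
  half_line_C (dom B) (graph_norm B) k f.

Definition half_power : operator H := operator_power dot A 2^-1.

Definition hyperbolic_solution (eps : R) (u0 u1 : H) (u : R -> H) : Prop :=
  [/\ [/\ C_H 2 u, C_dom half_power 1 u & C_dom A 0 u],
      (forall t, 0 <= t ->
         eps *: hderiv (hderiv u) t + (1 + t)^-1 *: hderiv u t
         + m (`|half_power (u t)| ^+ 2) *: A (u t) = 0),
      u 0 = u0 & hderiv u 0 = u1].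

Definition parabolic_solution (u0 : H) (u : R -> H) : Prop :=
  [/\ C_H 1 u /\ C_dom A 0 u,
      (forall t, 0 <= t ->
         (1 + t)^-1 *: hderiv u t
         + m (`|half_power (u t)| ^+ 2) *: A (u t) = 0) &
      u 0 = u0].

Definition corrector (eps : R) (u0 u1 : H) (theta : R -> H) : Prop :=
  [/\ C_H 2 theta,
      (forall t, 0 <= t ->
         eps *: hderiv (hderiv theta) t + (1 + t)^-1 *: hderiv theta t = 0),
      theta 0 = 0 &
      hderiv theta 0 = u1 + m (`|half_power u0| ^+ 2) *: A u0].

End Problems.

(* Main.v *)
Require Import Defs.
From HB Require Import structures.
From mathcomp Require Import all_boot all_order all_algebra.
From mathcomp Require Import finmap.
From mathcomp Require Import all_classical all_reals all_analysis.
From mathcomp Require Import measurable_realfun.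
From mathcomp Require Import ring lra.

Set Implicit Arguments.
Unset Strict Implicit.
Unset Printing Implicit Defensive.

Import Order.TTheory GRing.Theory Num.Theory.
Import numFieldNormedType.Exports.

Local Open Scope classical_set_scope.
Local Open Scope ring_scope.

(** Let [E] be the resolution of the identity of [A], [P n = E [0, n]] and
[B n = A P n], a bounded symmetric nonnegative operator. Since the coefficients
[c = m(<A u_eps, u_eps>)] and [c0 = m(<A u, u>)] are scalar functions of time,
[P n u_eps] and [P n u] solve linear equations governed by [B n]. All estimates
are proved for these, uniformly in [n], and passed to the limit.

Put [tau = 1 + t], [v = P n u_eps]. As long as [eps tau |c'| <= mu := inf m],
the energies [eps <B^i v', v'> / c + <B^(i+1) v, v>] (i = 0, 1) do not increase, and with the
multiplier [tau^2] and a correction [Lam (eps tau <v', v> + (1 - eps) |v|^2 / 2)]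
they give [tau^2 <A u_eps, u_eps> <= C], hence [eps tau |c'| = O(sqrt eps)]: for
small [eps] the assumption is self-improving, so it holds for all times. For [u],
a combination of the [tau^(2k) <B^k u, u>], k <= 3, is dissipated.

Let [psi = tau^(-1/eps)], so that [theta' = psi w0]. The errors [rho] and [r']
satisfy [rho' = r' + psi w0] and
[eps r'' + r' / tau + c B rho = - (c - c0) B u - eps u'']. The weighted energy of
[(rho, r')] is controlled by: a term [psi / eps] times itself, absorbed by the
integrating factor [exp (8 tau psi)]; terms of order [eps^2], absorbed by the
energy of [u] and by [eps^2 tau^3 psi]; and a term coming from [c - c0], bounded
by [<A rho, rho> / tau^3]. The last one involves the untruncated error, so it is
handled by Gronwall's inequality after [n] has gone to infinity. *)

(** * Calculus on the half-line *)

(** The solution [u_eps] has u'' only in H and u' only in D(A^(1/2)), so <A u', u''> has no meaning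
    and the energy containing <A u', u'> cannot be differentiated. For the truncations every form is
    differentiable, and only bounds uniform in n are worth anything. The data enter these through <A
    u1, u1> and <A^3 u0, u0>, whence the assumption D(A^(3/2)) x D(A^(1/2)).

    At t = 0 the derivative rho' equals w0, so an energy of (rho, rho') would start at order eps.
    Subtracting psi w0 makes (rho, r') start from zero, but then rho' = r' + psi w0 creates the
    product 2 tau^2 psi <B rho, w0>. Young's inequality with weight eps splits it into psi / eps
    times the energy and eps tau^2 psi <B w0, w0>. Since psi has an integral of order eps, the first
    coefficient has a bounded integral and the second term contributes O(eps^2).

    The weight tau^2 produces 2 tau <B rho, rho> with the wrong sign. The correction supplies - Lam
    c tau <B rho, rho>, and Lam = 6 / mu pays for this term and for the sources. *)

Lemma linear_map0 (R : nzRingType) (V W : lmodType R) (T : V -> W) :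
  linear T -> T 0 = 0.
Proof.
by move=> h; have := scalable_linear h 0 0; rewrite !scale0r => ->; exact: scale0r.
Qed.

Section HalfLine.
Variables (R : realType).
Implicit Types (V W : normedModType R).

Definition half_nbhs (t : R) : set_system R := within `[0, +oo[ (nbhs t).

Lemma half_nbhs_filter (t : R) : 0 <= t -> ProperFilter (half_nbhs t).
Proof.
move=> t0; apply: within_nbhs_proper.
by apply: subset_closure; rewrite /= in_itv/= andbT.
Qed.

(* Caratheodory's characterization of the derivative on [0, +oo) *)
Definition hder V (f : R -> V) (t : R) (l : V) :=
  exists q : R -> V, [/\ q t = l, q s @[s --> half_nbhs t] --> l &
    forall s, 0 <= s -> f s - f t = (s - t) *: q s].

Definition hcont V (f : R -> V) (t : R) := f s @[s --> half_nbhs t] --> f t.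

Lemma cvg_id_half (t : R) : (fun s : R => s) s @[s --> half_nbhs t] --> t.
Proof. by apply: cvg_within_filter; exact: cvg_id. Qed.

Lemma half_nbhs_ge0 (t : R) : \forall s \near half_nbhs t, 0 <= s.
Proof. by apply: filterS (withinT _ _) => s /=; rewrite in_itv/= andbT. Qed.

Lemma hder_cont V (f : R -> V) t l : 0 <= t -> hder f t l -> hcont f t.
Proof.
move=> t0 [q [_ ql fq]]; rewrite /hcont.
have FF := half_nbhs_filter t0.
have : (fun s => f t + (s - t) *: q s) s @[s --> half_nbhs t] --> f t.
  rewrite -[X in _ --> X]addr0 -(scale0r l).
  apply: cvgD; first exact: cvg_cst.
  apply: cvgZ => //; rewrite -(subrr t).
  by apply: cvgB; [exact: cvg_id_half|exact: cvg_cst].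
apply: cvg_trans; apply: near_eq_cvg; near=> s.
rewrite -fq; first by rewrite addrC subrK.
by near: s; exact: half_nbhs_ge0.
Unshelve. all: by end_near. Qed.

Lemma hder_cst V (a : V) t : hder (fun=> a) t 0.
Proof.
exists (fun=> 0); split=> //; first exact: cvg_cst.
by move=> s _; rewrite subrr scaler0.
Qed.

Lemma hder_id t : hder (V := R^o) (fun s => s) t 1.
Proof.
exists (fun=> 1); split=> //; first exact: cvg_cst.
by move=> s _; rewrite /GRing.scale/= mulr1.
Qed.

Lemma hderD V (f g : R -> V) t l k : 0 <= t -> hder f t l -> hder g t k ->
  hder (fun s => f s + g s) t (l + k).
Proof.
move=> t0 [p [pt pl fp]] [q [qt ql gq]]; exists (fun s => p s + q s); split.
- by rewrite pt qt.
- by have FF := half_nbhs_filter t0; exact: cvgD.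
- by move=> s s0; rewrite scalerDr -fp// -gq// opprD addrACA.
Qed.

Lemma hderN V (f : R -> V) t l : 0 <= t -> hder f t l ->
  hder (fun s => - f s) t (- l).
Proof.
move=> t0 [p [pt pl fp]]; exists (fun s => - p s); split.
- by rewrite pt.
- by have FF := half_nbhs_filter t0; exact: cvgN.
- by move=> s s0; rewrite scalerN -fp// opprD.
Qed.

Lemma hderB V (f g : R -> V) t l k : 0 <= t -> hder f t l -> hder g t k ->
  hder (fun s => f s - g s) t (l - k).
Proof. by move=> t0 hf hg; apply: hderD => //; exact: hderN. Qed.

Lemma hderZ V (a : R -> R^o) (f : R -> V) t l k : 0 <= t ->
  hder a t k -> hder f t l ->
  hder (fun s => a s *: f s) t (k *: f t + a t *: l).
Proof.
move=> t0 [p [pt pl fp]] hf; move: (hf) => [q [qt ql gq]].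
exists (fun s => p s *: f s + a t *: q s); split.
- by rewrite pt qt.
- have FF := half_nbhs_filter t0; apply: cvgD.
    by apply: cvgZ => //; exact: hder_cont hf.
  exact: cvgZr.
- move=> s s0; rewrite scalerDr scalerA -[(s - t) * p s]/((s - t) *: p s).
  rewrite -fp// scalerA mulrC -scalerA -gq// scalerBl scalerBr.
  by rewrite addrA subrK.
Qed.

Lemma hderM (a b : R -> R^o) t l k : 0 <= t ->
  hder a t k -> hder b t l ->
  hder (V := R^o) (fun s => a s * b s) t (k * b t + a t * l).
Proof. exact: hderZ. Qed.

Lemma half_cvg_comp (T : Type) (G : set_system T) (FG : Filter G) V
    (q : R -> V) (h : T -> R) (x : R) (l : V) :
  (\forall s \near G, 0 <= h s) -> h s @[s --> G] --> x ->
  q y @[y --> half_nbhs x] --> l -> q (h s) @[s --> G] --> l.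
Proof.
move=> h0 hx ql; apply: cvg_comp ql => A /hx hA.
have {}hA : \forall s \near G, `[0, +oo[%classic (h s) -> A (h s) by exact: hA.
apply: filterS2 h0 hA => s hs; apply.
by rewrite /= in_itv/= andbT.
Qed.

Lemma hder_comp V (f : R -> V) (h : R -> R^o) t l k : 0 <= t ->
  (forall s, 0 <= s -> 0 <= h s) ->
  hder h t k -> hder f (h t) l -> hder (fun s => f (h s)) t (k *: l).
Proof.
move=> t0 h0 hh [q [qt ql fq]]; move: (hh) => [p [pt pl hp]].
exists (fun s => p s *: q (h s)); split.
- by rewrite pt qt.
- have FF := half_nbhs_filter t0; apply: cvgZ => //.
  apply: half_cvg_comp ql; last exact: hder_cont hh.
  near=> s; apply: h0; near: s; exact: half_nbhs_ge0.
- move=> s s0; rewrite fq ?h0// hp//.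
  by rewrite -[X in X *: _]/((s - t) * p s) scalerA.
Unshelve. all: by end_near. Qed.

Lemma bounded_cvg (T : Type) (G : set_system T) (FG : Filter G) V W
    (L : V -> W) (K : R) (f : T -> V) (l : V) :
  linear L -> (forall x, `|L x| <= K * `|x|) ->
  f s @[s --> G] --> l -> L (f s) @[s --> G] --> L l.
Proof.
move=> Llin LK fl; apply/cvgrPdist_lt => e e0.
(* [K] is not assumed nonnegative, whence the absolute value; the 1 guards against [K = 0]. *)
have K1 : 0 < `|K| + 1 by rewrite ltr_wpDl.
have := @cvgr_dist_lt _ _ _ _ _ _ _ fl (e / (`|K| + 1)).
rewrite divr_gt0// => /(_ _ isT); apply: filterS => s.
rewrite ltr_pdivlMr// -(zmod_morphism_linear Llin) => h.
apply: le_lt_trans h; apply: le_trans (LK _) _.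
rewrite mulrC ler_wpM2l//; apply: le_trans (ler_norm K) _.
by rewrite lerDl.
Qed.

Lemma hder_lin V W (L : V -> W) (K : R) (f : R -> V) t l : 0 <= t ->
  linear L -> (forall x, `|L x| <= K * `|x|) ->
  hder f t l -> hder (fun s => L (f s)) t (L l).
Proof.
move=> t0 Llin LK [q [qt ql fq]]; exists (fun s => L (q s)); split.
- by rewrite qt.
- by have FF := half_nbhs_filter t0; exact: bounded_cvg LK _.
- by move=> s s0; rewrite -(scalable_linear Llin) -fq// (zmod_morphism_linear Llin).
Qed.

Lemma hder_is_derive V (f : R -> V) (t : R) (l : V) : 0 < t -> hder f t l ->
  is_derive t 1 f l.
Proof.
move=> t0 [q [qt ql fq]].
have near0 : \forall h \near (0:R)^', 0 <= h + t.
  apply: cvg_within; apply: filterS (nbhs0_lt t0) => h ht.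
  rewrite -lerBlDr sub0r; apply: ltW; rewrite ltrNl.
  by apply: le_lt_trans (ler_norm _) _; rewrite normrN.
suff H : h^-1 *: (f (h *: 1 + t) - f t) @[h --> 0^'] --> l.
  by apply: DeriveDef; [apply/cvg_ex; exists l|exact/cvg_lim].
have : q (h + t) @[h --> 0^'] --> l.
  apply: half_cvg_comp ql => //.
  rewrite -[X in _ --> X]add0r; apply: cvgD; last exact: cvg_cst.
  exact: cvg_within.
apply: cvg_trans; apply: near_eq_cvg.
near=> h; rewrite -[h *: 1]/(h * 1) mulr1 fq.
  rewrite addrK scalerA mulVf ?scale1r//.
  near: h; exact: nbhs_dnbhs_neq.
near: h; exact: near0.
Unshelve. all: by end_near. Qed.

(** Passage from the punctured difference quotients of [hderiv] to the Caratheodory form: the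
    quotient is completed at [t] by its limit. *)
Lemma hder_of_quotient V (f : R -> V) (t : R) (l : V) : 0 <= t ->
  (s - t)^-1 *: (f s - f t) @[s --> within `[0, +oo[ t^'] --> l ->
  hder f t l.
Proof.
move=> t0 hq; exists (fun s => if s == t then l else (s - t)^-1 *: (f s - f t)).
split; first by rewrite eqxx.
- move=> A Al; have lA := nbhs_singleton Al; move: Al => /hq Al.
  have {}Al : \forall s \near t, s != t -> s \in `[0, +oo[ ->
      A ((s - t)^-1 *: (f s - f t)) by exact: Al.
  suff : \forall s \near t, s \in `[0, +oo[ ->
      A (if s == t then l else (s - t)^-1 *: (f s - f t)) by [].
  apply: filterS Al => s hs s0.
  case: eqVneq => [_|st]; first exact: lA.
  exact: (hs st s0).
- move=> s s0; case: eqVneq => [->|st]; first by rewrite !subrr scale0r.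
  by rewrite scalerA divff ?scale1r// subr_eq0.
Qed.

Lemma hder_quotient V (f : R -> V) (t : R) (l : V) : 0 <= t ->
  hder f t l ->
  (s - t)^-1 *: (f s - f t) @[s --> within `[0, +oo[ t^'] --> l.
Proof.
move=> t0 [q [qt ql fq]].
have : q s @[s --> within `[0, +oo[ t^'] --> l.
  move=> A /ql Al.
  have {}Al : \forall s \near t, s \in `[0, +oo[ -> A (q s) by exact: Al.
  suff : \forall s \near t, s != t -> s \in `[0, +oo[ -> A (q s) by [].
  by apply: filterS Al => s hs _.
apply: cvg_trans; apply: near_eq_cvg.
suff : \forall s \near t, s != t -> s \in `[0, +oo[ ->
  q s = (s - t)^-1 *: (f s - f t) by [].
near=> s => st; rewrite in_itv/= andbT => s0.
by rewrite fq// scalerA mulVf ?scale1r// subr_eq0.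
Unshelve. all: by end_near. Qed.

Lemma within_dnbhs_proper (t : R) : 0 <= t ->
  ProperFilter (within `[0, +oo[ t^').
Proof.
move=> t0; split; last exact: within_filter.
move=> h.
have {}h : \forall s \near t, s != t -> s \in `[0, +oo[ -> False by exact: h.
have : \forall s \near t^'+, False.
  suff : \forall s \near t, t < s -> False by [].
  apply: filterS h => s hs ts; apply: hs; first by rewrite gt_eqF.
  by rewrite in_itv/= andbT (le_trans t0)// ltW.
exact: filter_not_empty.
Qed.

Lemma hder_hderiv V (f : R -> V) (t : R) (l : V) : 0 <= t ->
  hder f t l -> hderiv f t = l.
Proof.
move=> t0 /(hder_quotient t0) h; have FF := within_dnbhs_proper t0.
exact/cvg_lim.
Qed.

Lemma half_differentiable_hder V (f : R -> V) (D : set V) (t : R) : 0 <= t ->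
  half_line_differentiable D (fun x => `|x|) f -> hder f t (hderiv f t).
Proof.
move=> t0 /(_ t t0)[_ _ h]; apply: hder_of_quotient => //.
apply/cvgrPdist_lt => e e0; move/cvgrPdist_lt : h => /(_ e e0).
apply: filterS => s; rewrite sub0r normrN normr_id.
by rewrite distrC.
Qed.

Lemma half_continuous_hcont V (f : R -> V) (D : set V) (N : V -> R) (t : R) :
  (forall x, `|x| <= N x) -> 0 <= t ->
  half_line_continuous D N f -> hcont f t.
Proof.
move=> Nge t0 /(_ t t0)[_ h]; apply/cvgrPdist_lt => e e0.
move/cvgrPdist_lt : h => /(_ e e0); rewrite /half_nbhs.
apply: filterS => s; rewrite sub0r normrN distrC => h.
by apply: le_lt_trans (le_trans (Nge _) (ler_norm _)) h.
Qed.

Lemma is_derive_hder V (f : R -> V) (t : R) (l : V) : 0 <= t ->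
  is_derive t 1 f l -> hder f t l.
Proof.
move=> t0 [df fl]; apply: hder_of_quotient => //.
have {fl df} : h^-1 *: ((f \o shift t) (h *: 1) - f t) @[h --> 0^'] --> l.
  by rewrite -fl; exact: df.
move=> h; apply/cvgrPdist_lt => e e0; move/cvgrPdist_lt : h => /(_ e e0).
move=> h.
have {}h : \forall s \near (0 : R), s != 0 ->
    `|l - s^-1 *: (f (s *: 1 + t) - f t)| < e by exact: h.
suff : \forall s \near t, s != t -> s \in `[0, +oo[ ->
    `|l - (s - t)^-1 *: (f s - f t)| < e by [].
rewrite (near_shift 0); apply: filterS h => s hs /= st _.
have := hs _; rewrite -[s *: 1]/(s * 1) mulr1 subr0 addrK; apply.
by apply: contra_neq st => ->; rewrite add0r subr0.
Qed.

End HalfLine.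

(** * Differential inequalities and integrals on the half-line *)

Section HalfLineReal.
Variables (R : realType).
Implicit Types f g df : R -> R.
Local Notation shder := (@hder R R^o).
Local Notation shcont := (@hcont R R^o).

Lemma hcont_within f (A : set R) : A `<=` `[0, +oo[%classic ->
  (forall t, A t -> shcont f t) -> {within A, continuous f}.
Proof.
move=> sA fc; apply/subspace_continuousP => t At.
apply: cvg_trans (fc t At); apply: cvg_app; exact: within_subset.
Qed.

Lemma hcont_eps (V : normedModType R) (f : R -> V) (t e : R) :
  hcont f t -> 0 < e ->
  exists2 d, 0 < d & forall s, 0 <= s -> `|s - t| < d -> `|f s - f t| < e.
Proof.
move=> /cvgrPdist_lt h e0.
have {}h : \forall s \near t, s \in `[0, +oo[ -> `|f t - f s| < e by exact: h.
have [d /= d0 hd] := (nbhs_ballP _ _).1 h.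
exists d => // s s0 st; rewrite distrC; apply: hd.
  by rewrite /ball/= distrC.
by rewrite in_itv/= andbT.
Qed.

(** The mean value theorem takes the place of integration, because [df] is not assumed
    continuous. *)
Lemma hder_nonincreasing f df (T : R) : 0 <= T ->
  (forall t, 0 <= t <= T -> shder f t (df t)) ->
  (forall t, 0 <= t <= T -> df t <= 0) -> f T <= f 0.
Proof.
move=> T0 fd df0.
have fd' (x : R) : x \in `]0, T[ -> is_derive x 1 f (df x).
  rewrite in_itv/= => /andP[x0 xT]; apply: hder_is_derive => //.
  by apply: fd; rewrite !ltW.
have fc : {within `[0, T], continuous f}.
  apply: hcont_within => t /=; rewrite in_itv/= => /andP[t0 tT].
    by rewrite in_itv/= t0.
  by apply: hder_cont (fd _ _) => //; rewrite t0.
have [c] := MVT_segment T0 fd' fc.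
rewrite in_itv/= subr0 => cT h; rewrite -subr_le0 h.
by rewrite mulr_le0_ge0// df0.
Qed.

(** The continuity method. The infimum [z] of the times at which [f] is at least [M] satisfies
    [f z = M] and [f <= M] on [0, z], which the improvement hypothesis contradicts. *)
Lemma continuity_bootstrap f (M : R) : (forall t, 0 <= t -> shcont f t) ->
  f 0 < M ->
  (forall T, 0 <= T -> (forall t, 0 <= t <= T -> f t <= M) -> f T < M) ->
  forall t, 0 <= t -> f t < M.
Proof.
move=> fc f0 H t1 t10; rewrite ltNge; apply/negP => Mt1.
pose Z := [set s | 0 <= s /\ M <= f s].
have Z0 : Z !=set0 by exists t1.
have Zl : has_lbound Z by exists 0 => s [].
pose z := inf Z.
have z0 : 0 <= z by apply: lb_le_inf => // s [].
have below s : 0 <= s -> s < z -> f s < M.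
  move=> s0 sz; rewrite ltNge; apply/negP => Ms.
  by have := ge_inf Zl (conj s0 Ms); rewrite leNgt sz.
have Mz : M <= f z.
  rewrite leNgt; apply/negP => zM.
  have [|d d0 hd] := hcont_eps (fc z z0) (e := M - f z); first by rewrite subr_gt0.
  have [s [s0 Ms] sz] := inf_adherent d0 (conj Z0 Zl).
  have zs : z <= s by apply: ge_inf.
  have /hd : `|s - z| < d by rewrite ger0_norm ?subr_ge0// ltrBlDl.
  move=> /(_ s0) /(le_lt_trans (ler_norm _)); rewrite ltrD2r.
  by rewrite ltNge Ms.
have zpos : 0 < z.
  rewrite lt_neqAle z0 andbT; apply/eqP => z00.
  by move: f0; rewrite z00 ltNge Mz.
have zM : f z <= M.
  rewrite leNgt; apply/negP => Mz'.
  have [|d d0 hd] := hcont_eps (fc z z0) (e := f z - M); first by rewrite subr_gt0.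
  pose s := Order.max 0 (z - d / 2).
  have s0 : 0 <= s by rewrite le_max lexx.
  have sz : s < z by rewrite gt_max zpos/= gtrBl divr_gt0.
  have /hd : `|s - z| < d.
    rewrite ltr0_norm ?subr_lt0// opprB ltrBlDl -ltrBlDr.
    rewrite lt_max; apply/orP; right; rewrite ltrD2l ltrN2.
    by rewrite ltr_pdivrMr// ltr_pMr// ltr1n.
  move=> /(_ s0); rewrite distrC => /(le_lt_trans (ler_norm _)).
  by rewrite ltrD2l ltrN2 ltNge ltW// below.
suff : f z < M by rewrite ltNge Mz.
apply: H => // t /andP[t0].
by rewrite le_eqVlt => /predU1P[->//|tz]; rewrite ltW// below.
Qed.

(** (s + |s|) / 2 is the positive part of s: [f] is continued by the constant [f 0] to the negative
    reals, where the two-sided fundamental theorem of calculus needs values. *)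
Lemma continuous_extension f : (forall t, 0 <= t -> shcont f t) ->
  continuous ((fun s : R => f ((s + `|s|) / 2)) : R -> R^o).
Proof.
move=> fc x; have p (s : R) : 0 <= (s + `|s|) / 2.
  by rewrite divr_ge0// -lerBlDl sub0r -normrN ler_norm.
apply: half_cvg_comp (fc _ (p x)).
- exact: nearW.
- apply: cvgM; last exact: cvg_cst.
  apply: cvgD; first exact: cvg_id.
  by apply: cvg_norm; exact: cvg_id.
Qed.

Lemma half_line_primitive f : (forall t, 0 <= t -> shcont f t) ->
  exists F : R -> R, forall t : R, 0 <= t -> is_derive t 1 (F : R -> R^o) (f t).
Proof.
move=> fc; pose g (s : R) := f ((s + `|s|) / 2).
have gc : continuous (g : R -> R^o) by exact: continuous_extension.
(* Starting the integral at -1 makes [t = 0] an interior point, so that the derivative there is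
   two-sided. *)
exists (fun t => \int[lebesgue_measure]_(s in `[-1, t]) g s)%R => t t0.
have -> : f t = g t.
  by rewrite /g ger0_norm// -mulr2n -[t in RHS]mulr1 -mulrnAr mulfK// pnatr_eq0.
have [||||dF <-] := @continuous_FTC1 R g (BLeft (-1)) t (t + 1).
- by rewrite ltrDl.
- apply: continuous_compact_integrable; first exact: segment_compact.
  exact: continuous_subspaceT.
- by rewrite lte_fin (lt_le_trans _ t0)// ltrN10.
- exact: gc.
- by apply: DeriveDef; [exact: dF|rewrite derive1E].
Qed.

(** [dX] may fail to be integrable; therefore [X] plus a primitive of [f] is shown to be
    nonincreasing. *)
Lemma integral_le_Lyapunov f (X dX : R -> R) (T K : R) : 0 < T ->
  (forall t, 0 <= t -> shcont f t) ->
  (forall t, 0 <= t -> shder X t (dX t)) ->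
  (forall t, 0 <= t -> dX t <= - f t) -> X 0 - X T <= K ->
  (\int[lebesgue_measure]_(s in `[0%R, T]) (f s)%:E <= K%:E)%E.
Proof.
move=> T0 fc Xd dXf XK; have [F Fd] := half_line_primitive fc.
rewrite (@continuous_FTC2 R f F) //.
- rewrite -EFinB lee_fin; apply: le_trans XK.
  suff : X T + F T <= X 0 + F 0 by lra.
  apply: (@hder_nonincreasing (fun t => X t + F t) (fun t => dX t + f t)).
  + exact: ltW.
  + move=> t /andP[t0 _]; apply: hderD => //; first exact: Xd.
    by apply: is_derive_hder => //; exact: Fd.
  + by move=> t /andP[t0 _]; rewrite -lerBrDr sub0r dXf.
- apply: hcont_within => t /=; rewrite in_itv/= => /andP[t0 _]; last exact: fc.
  by rewrite in_itv/= t0.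
- split.
  + by move=> x; rewrite in_itv/= => /andP[x0 _]; have [] := Fd x (ltW x0).
  + apply: cvg_at_right_filter.
    by have [/derivable1_diffP/differentiable_continuous] := Fd 0 (lexx _).
  + apply: cvg_at_left_filter.
    by have [/derivable1_diffP/differentiable_continuous] := Fd T (ltW T0).
- move=> x; rewrite in_itv/= => /andP[x0 _].
  by rewrite derive1E; have [_] := Fd x (ltW x0).
Qed.

(** Fatou's lemma, with the index [n] serving also as the end of the interval: truncation and time
    horizon are removed by a single limit. *)
Lemma integral_half_line_le (f : nat -> R -> R) (g : R -> R) (K : R) :
  (forall n t, 0 <= t -> shcont (f n) t) ->
  (forall n t, 0 <= t -> 0 <= f n t) ->
  (forall t, 0 <= t -> f n t @[n --> \oo] --> g t) ->
  (forall n T, 0 < T ->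
    (\int[lebesgue_measure]_(s in `[0%R, T]) (f n s)%:E <= K%:E)%E) ->
  (\int[lebesgue_measure]_(s in `[0%R, +oo[) (g s)%:E <= K%:E)%E.
Proof.
move=> fc f0 fg fK.
(* The endpoint [n.+1] is positive already for [n = 0], as the hypothesis on [T] requires. *)
pose h n : R -> R := (f n) \_ `[0, n.+1%:R]%classic.
have hm n : measurable_fun (`[0%R, +oo[%classic : set R) (h n : R -> R).
  have sub : `[0%R, n.+1%:R]%classic `<=` (`[0%R, +oo[%classic : set R).
    by move=> x /=; rewrite !in_itv/= => /andP[->].
  apply/measurable_restrict => //.
  rewrite setIidr//; apply: subspace_continuous_measurable_fun => //.
  apply: hcont_within => // t /sub /=; rewrite in_itv/= andbT => t0.
  exact: fc.
have h0 n (s : R) : (0 <= (h n s)%:E)%E.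
  rewrite lee_fin /h patchE; case: ifP => //; rewrite inE/= in_itv/= => /andP[s0 _].
  exact: f0.
have hg (s : R) : 0 <= s -> (h n s)%:E @[n --> \oo] --> (g s)%:E.
  move=> s0; apply: cvg_EFin; first exact: nearW.
  apply: cvg_trans (fg s s0); apply: near_eq_cvg.
  near=> n; rewrite /= /h patchE mem_set//= in_itv/= s0/=.
  have : s <= n%:R by near: n; exact: nbhs_infty_ger.
  by move=> /le_trans; apply; rewrite ler_nat.
have -> : (\int[lebesgue_measure]_(s in `[0%R, +oo[) (g s)%:E =
    \int[lebesgue_measure]_(s in `[0%R, +oo[) limn_einf (fun n => (h n s)%:E))%E.
  apply: eq_integral => s; rewrite inE/= in_itv/= andbT => s0.
  by rewrite (is_cvg_limn_einfE (cvgP _ (hg s s0))); apply/esym/cvg_lim => //; exact: hg.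
apply: le_trans (fatou _ _ _ _) _ => //.
  by move=> n; apply/measurable_EFinP; exact: hm.
have le n : (\int[lebesgue_measure]_(s in `[0%R, +oo[) (h n s)%:E <= K%:E)%E.
  rewrite (_ : (fun s => (h n s)%:E) = (EFin \o f n) \_ `[0%R, n.+1%:R]%classic);
    last by rewrite restrict_EFin.
  rewrite -integral_mkcondr setIidr; first exact: fK.
  by move=> x /=; rewrite !in_itv/= => /andP[->].
rewrite limn_einf_lim; apply: lime_le; first exact: is_cvg_einfs.
near=> n; apply: le_trans (le n); apply: ereal_inf_lbound => /=.
by exists n => //=.
Unshelve. all: by end_near. Qed.

End HalfLineReal.

(** * Inner products *)

Section InnerProduct.
Variables (R : realType) (H : completeNormedModType R).
Variables (dot : {dot H for (@idfun R)}).

Lemma dotC x y : dot x y = dot y x.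
Proof.
by rewrite (hermC dot) expr0 mul1r.
Qed.

Lemma dotDr x y z : dot x (y + z) = dot x y + dot x z.
Proof. exact: raddfD. Qed.

Lemma dotDl x y z : dot (x + y) z = dot x z + dot y z.
Proof. by rewrite dotC dotDr !(dotC z). Qed.

Lemma dotZr a x y : dot x (a *: y) = a * dot x y.
Proof. exact: linearZ. Qed.

Lemma dotZl a x y : dot (a *: x) y = a * dot x y.
Proof. by rewrite dotC dotZr dotC. Qed.

Lemma dotNr x y : dot x (- y) = - dot x y.
Proof. by rewrite -scaleN1r dotZr mulN1r. Qed.

Lemma dotNl x y : dot (- x) y = - dot x y.
Proof. by rewrite dotC dotNr dotC. Qed.

Lemma dotBr x y z : dot x (y - z) = dot x y - dot x z.
Proof. by rewrite dotDr dotNr. Qed.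

Lemma dotBl x y z : dot (x - y) z = dot x z - dot y z.
Proof. by rewrite dotDl dotNl. Qed.

Lemma dot0r x : dot x 0 = 0.
Proof. by rewrite -(scale0r 0) dotZr mul0r. Qed.

Lemma dot0l x : dot 0 x = 0.
Proof. by rewrite dotC dot0r. Qed.

Definition dotE := (dotDl, dotDr, dotBl, dotBr, dotNl, dotNr, dotZl, dotZr,
  dot0l, dot0r).

Lemma dot_sumr (I : Type) (r : seq I) (F : I -> H) x :
  dot x (\sum_(i <- r) F i) = \sum_(i <- r) dot x (F i).
Proof. exact: raddf_sum. Qed.

Lemma dot_suml (I : Type) (r : seq I) (F : I -> H) x :
  dot (\sum_(i <- r) F i) x = \sum_(i <- r) dot (F i) x.
Proof. by rewrite dotC dot_sumr; apply: eq_bigr => i _; rewrite dotC. Qed.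

(** The form may be degenerate, as that of [A] is when [A] has a kernel; [b x x = 0] must then be
    shown to force [b x y = 0]. *)
Lemma form_Cauchy_Schwarz (b : H -> H -> R) x y :
  (forall x y z, b (x + y) z = b x z + b y z) ->
  (forall a x y, b (a *: x) y = a * b x y) ->
  (forall x y, b x y = b y x) -> (forall x, 0 <= b x x) ->
  b x y ^+ 2 <= b x x * b y y.
Proof.
move=> bD bZ bC b0.
have bDr u v w : b u (v + w) = b u v + b u w by rewrite bC bD !(bC u).
have bZr a u v : b u (a *: v) = a * b u v by rewrite bC bZ bC.
have [xx|xx] := eqVneq (b x x) 0.
  have [xy|xy] := eqVneq (b x y) 0.
    by rewrite xy expr0n/= mulr_ge0.
  (* With this [t] the form takes the value -1 at [t *: x + y]. *)
  pose t := - ((b y y + 1) / (2 * b x y)).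
  have tb : t * b x y = - ((b y y + 1) / 2) by rewrite /t; field.
  have := b0 (t *: x + y).
  rewrite !(bD, bDr, bZ, bZr) (bC y x) xx.
  have -> : t * (t * 0) + t * b x y + (t * b x y + b y y) =
    2 * (t * b x y) + b y y by ring.
  by rewrite tb => h; exfalso; lra.
have : 0 <= b x x * (b x x * b y y - b x y ^+ 2).
  have := b0 (b x x *: y + - b x y *: x).
  rewrite !(bD, bDr, bZ, bZr) (bC y x); congr (0 <= _); ring.
by rewrite pmulr_rge0 ?subr_ge0// lt_neqAle eq_sym xx b0.
Qed.

Hypothesis hdot : induces_norm dot.

Lemma dot_ge0 x : 0 <= dot x x.
Proof. by rewrite -hdot sqr_ge0. Qed.

Lemma dot_inj x y : (forall z, dot x z = dot y z) -> x = y.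
Proof.
move=> h; apply/eqP; rewrite -subr_eq0 -normr_eq0 -sqrf_eq0 hdot.
by rewrite dotBl h subrr.
Qed.

Lemma Cauchy_Schwarz x y : `|dot x y| <= `|x| * `|y|.
Proof.
rewrite -ler_sqr ?nnegrE ?mulr_ge0// -normrX ger0_norm ?sqr_ge0//.
rewrite exprMn !hdot; apply: form_Cauchy_Schwarz.
- exact: dotDl.
- exact: dotZl.
- exact: dotC.
- exact: dot_ge0.
Qed.

Lemma cvg_sqrnorm (T : Type) (G : set_system T) (FG : Filter G) (h : T -> H) c :
  h s @[s --> G] --> c -> `|h s| ^+ 2 @[s --> G] --> (`|c| ^+ 2 : R^o).
Proof.
move=> hc; rewrite expr2; under eq_cvg do rewrite expr2.
by apply: cvgM; exact: cvg_norm.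
Qed.

(** Polarization reduces the claim to the continuity of the norm. *)
Lemma cvg_dot (T : Type) (G : set_system T) (FG : Filter G) (f g : T -> H)
    (a b : H) : f s @[s --> G] --> a -> g s @[s --> G] --> b ->
  dot (f s) (g s) @[s --> G] --> (dot a b : R^o).
Proof.
move=> fa gb.
have polar x y : dot x y = (`|x + y| ^+ 2 - `|x| ^+ 2 - `|y| ^+ 2) / 2.
  by rewrite !hdot !dotE (dotC y x); field.
rewrite polar; under eq_cvg do rewrite polar.
apply: cvgM; last exact: cvg_cst.
apply: cvgB; last exact: cvg_sqrnorm.
apply: cvgB; last exact: cvg_sqrnorm.
by apply: cvg_sqrnorm; exact: cvgD.
Qed.

Lemma hder_dot (f g : R -> H) t l k : 0 <= t -> hder f t l -> hder g t k ->
  hder (V := R^o) (fun s => dot (f s) (g s)) t (dot l (g t) + dot (f t) k).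
Proof.
move=> t0 [p [pt pl fp]] hg; move: (hg) => [q [qt ql gq]].
exists (fun s => dot (p s) (g s) + dot (f t) (q s)); split.
- by rewrite pt qt.
- have FF := half_nbhs_filter t0; apply: cvgD.
    by apply: cvg_dot => //; exact: hder_cont hg.
  by apply: cvg_dot => //; exact: cvg_cst.
- move=> s s0; rewrite -[_ *: _]/(_ * _) mulrDr -dotZl -dotZr -fp// -gq//.
  by rewrite !dotE; ring.
Qed.

(* [<Ax, x> - <Ay, y> = <A (x + y), x - y>] for symmetric [A], so only the
   continuity of [A \o f], not its differentiability, is used. *)
Lemma hder_symmetric_form (D : set H) (A : H -> H) (f : R -> H) t l :
  0 <= t -> (forall x y, D x -> D y -> D (x + y) /\ A (x + y) = A x + A y) ->
  (forall x y, D x -> D y -> dot (A x) y = dot x (A y)) ->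
  (forall s, 0 <= s -> D (f s)) -> hcont (fun s => A (f s)) t ->
  hder f t l ->
  hder (V := R^o) (fun s => dot (A (f s)) (f s)) t (2 * dot (A (f t)) l).
Proof.
move=> t0 AD As Df Ac [p [pt pl fp]].
exists (fun s => dot (A (f s) + A (f t)) (p s)); split.
- by rewrite pt dotDl -mulr2n mulr_natl.
- have FF := half_nbhs_filter t0.
  rewrite [X in _ --> X](_ : _ = dot (A (f t) + A (f t)) l); last first.
    by rewrite dotDl -mulr2n mulr_natl.
  apply: cvg_dot => //; apply: cvgD => //; exact: cvg_cst.
- move=> s s0; rewrite -[_ *: _]/(_ * _) -dotZr -fp// !dotE.
  rewrite (As (f s) (f t)) ?(dotC (f s)); try exact: Df.
  by ring.
Qed.

End InnerProduct.

Import HBNNSimple.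

(** * Spectral truncation *)

Section SpectralCalculus.
Variables (R : realType) (H : completeNormedModType R).
Variables (dot : {dot H for (@idfun R)}) (hdot : induces_norm dot).
Variables (E : set R -> H -> H) (hE : resolution_of_identity dot E).

(** [spectral_mass] is a bare set function, arbitrary off the Borel sets. The integral evaluates it
    only on preimages under simple functions, so a genuine measure may replace it. *)
Lemma eq_setfun_integral (mu nu : set R -> \bar R) (D : set R) (f : R -> \bar R) :
  (forall B, measurable B -> mu B = nu B) ->
  (\int[mu]_(x in D) f x = \int[nu]_(x in D) f x)%E.
Proof.
move=> munu; rewrite /integral.
have e (h : {nnsfun R >-> R}) : sintegral mu h = sintegral nu h.
  rewrite /sintegral; apply: eq_fsbigr => y _; congr (_ * _)%E.
  by apply: munu; exact: measurable_funPTI.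
by congr (_ - _)%E; congr ereal_sup; apply: eq_imagel => h _; exact: e.
Qed.

Lemma E_linear B : measurable B -> linear (E B).
Proof. by case: hE => h _ _ _ _; exact: h. Qed.

Lemma E_sym B x y : measurable B -> dot (E B x) y = dot x (E B y).
Proof. by case: hE => _ h _ _ _ mB; exact: h. Qed.

Lemma E_setI B C x : measurable B -> measurable C -> E (B `&` C) x = E B (E C x).
Proof. by case: hE => _ _ h _ _ mB mC; exact: h. Qed.

Lemma E_half x : E `[0, +oo[%classic x = x.
Proof. by case: hE => _ _ _ h _; exact: h. Qed.

Lemma E_idem B x : measurable B -> E B (E B x) = E B x.
Proof. by move=> mB; rewrite -E_setI// setIid. Qed.

Lemma mass_norm B x : measurable B -> dot (E B x) x = `|E B x| ^+ 2.
Proof. by move=> mB; rewrite hdot -E_sym// E_idem. Qed.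

Lemma mass_setT_le B x : measurable B -> `|E B x| <= `|x|.
Proof.
move=> mB; have [->|Ex] := eqVneq `|E B x| 0; first exact: normr_ge0.
have Ex0 : 0 < `|E B x| by rewrite lt_neqAle eq_sym Ex normr_ge0.
rewrite -(ler_pM2l Ex0) -expr2 -mass_norm//.
exact: le_trans (ler_norm _) (Cauchy_Schwarz hdot _ _).
Qed.

(** Countable additivity for a sequence of empty sets gives a convergent series with constant term
    [E set0 x], which therefore vanishes. *)
Lemma E_set0 x : E set0 x = 0.
Proof.
case: hE => _ _ _ _ /(_ (fun=> set0) _ _ x); rewrite bigcup0//.
have t0 : trivIset [set: nat] (fun=> set0 : set R).
  by move=> i j _ _ [y []].
move=> /(_ (fun=> measurable0) t0) h.
have /cvg_series_cvg_0 h0 : cvgn (series (fun=> E set0 x : H)).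
  exact: cvgP h.
exact: (cvg_unique _ (cvg_cst _) h0).
Qed.

Lemma spectral_measure_exists x : exists mu : {measure set R -> \bar R},
  forall B, measurable B -> mu B = spectral_mass dot E x B.
Proof.
(* A measure must be nonnegative on every set, while the mass is known to be so only on measurable
   ones; elsewhere 0 is a default value. *)
pose m (B : set R) := if `[< measurable B >] then spectral_mass dot E x B else 0%E.
have mE B : measurable B -> m B = spectral_mass dot E x B.
  by move=> mB; rewrite /m; case: asboolP.
have m0 : m set0 = 0%E.
  by rewrite mE// /spectral_mass E_set0 dot0l.
have mge0 B : (0 <= m B)%E.
  by rewrite /m; case: asboolP => // mB; rewrite /spectral_mass mass_norm// lee_fin sqr_ge0.
have madd : semi_sigma_additive m.
  move=> F mF tF mUF; rewrite mE//.
  have -> : (fun n => \sum_(0 <= i < n) m (F i))%E =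
      (fun n => (dot (\sum_(0 <= i < n) E (F i) x) x)%:E).
    apply/funext => n; rewrite dot_suml -sumEFin; apply: eq_bigr => i _.
    by rewrite mE.
  apply: cvg_EFin; first exact: nearW.
  apply: cvg_dot => //; last exact: cvg_cst.
  by case: hE => _ _ _ _; apply.
by exists (HB.pack_for {measure set R -> \bar R} m
  (isMeasure.Build _ _ _ m m0 mge0 madd)).
Qed.

(* [calculus f T]: [f] is a simple function and [T] the integral of [f] against
   [E]; a relation, because [f] has several presentations. *)
Inductive calculus : (R -> R) -> (H -> H) -> Prop :=
| calculus0 : calculus (fun=> 0) (fun=> 0)
| calculusD a B f T : 0 <= a -> measurable B -> calculus f T ->
    calculus (fun l => a * \1_B l + f l) (fun x => a *: E B x + T x).

Lemma calculus_ge0 f T l : calculus f T -> 0 <= f l.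
Proof.
elim=> // a B {}f {}T a0 _ _ IH; rewrite addr_ge0// mulr_ge0//.
Qed.

Lemma calculus_measurable f T : calculus f T -> measurable_fun [set: R] f.
Proof.
elim=> [|a B {}f {}T a0 mB _ IH]; first exact: measurable_cst.
apply: measurable_funD => //; apply: measurable_funM => //.
Qed.

Lemma calculus_linear f T : calculus f T -> linear T.
Proof.
elim=> [a x y|a B {}f {}T a0 mB _ IH c x y]; first by rewrite scaler0 addr0.
rewrite IH E_linear// !scalerDr !scalerA (mulrC a c) addrACA.
by rewrite -!scalerA.
Qed.

Lemma calculus_sym f T x y : calculus f T -> dot (T x) y = dot x (T y).
Proof.
elim=> [|a B {}f {}T a0 mB _ IH]; first by rewrite dot0l dot0r.
by rewrite !dotE E_sym// IH.
Qed.

Lemma calculus_sum f T g S : calculus f T -> calculus g S ->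
  calculus (fun l => f l + g l) (fun x => T x + S x).
Proof.
move=> fT gS; elim: fT => [|a B {}f {}T a0 mB _ IH].
  rewrite (_ : (fun l => 0 + g l) = g); last by apply/funext => l; rewrite add0r.
  by rewrite (_ : (fun x => 0 + S x) = S)//; apply/funext => l; rewrite add0r.
rewrite (_ : (fun l => _ + g l) = (fun l => a * \1_B l + (f l + g l))); last first.
  by apply/funext => l; rewrite addrA.
rewrite (_ : (fun x => _ + S x) = (fun x => a *: E B x + (T x + S x))); last first.
  by apply/funext => l; rewrite addrA.
exact: calculusD.
Qed.

Lemma calculus_scale_indic a B g S : 0 <= a -> measurable B -> calculus g S ->
  calculus (fun l => a * \1_B l * g l) (fun x => a *: E B (S x)).
Proof.
move=> a0 mB; elim=> [|b C {}g {}S b0 mC _ IH].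
  rewrite (_ : (fun l => _ * 0) = (fun=> 0)); last by apply/funext => l; rewrite mulr0.
  rewrite (_ : (fun x => a *: E B 0) = (fun=> 0)); first exact: calculus0.
  by apply/funext => x; rewrite (linear_map0 (E_linear mB)) scaler0.
rewrite (_ : (fun l => a * \1_B l * _) =
   (fun l => a * b * \1_(B `&` C) l + a * \1_B l * g l)); last first.
  by apply/funext => l; rewrite indicI /=; ring.
rewrite (_ : (fun x => _ *: E B _) =
   (fun x => (a * b) *: E (B `&` C) x + a *: E B (S x))); last first.
  by apply/funext => l; rewrite E_linear// E_setI// scalerDr scalerA.
apply: calculusD => //; [exact: mulr_ge0|exact: measurableI].
Qed.

(** Multiplicativity comes from [E] sending intersections to products; it turns |T x|^2 into the
    spectral integral of f^2. *)
Lemma calculusM f T g S : calculus f T -> calculus g S ->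
  calculus (fun l => f l * g l) (fun x => T (S x)).
Proof.
move=> fT gS; elim: fT => [|a B {}f {}T a0 mB _ IH].
  rewrite (_ : (fun l => 0 * g l) = (fun=> 0)); first exact: calculus0.
  by apply/funext => l; rewrite mul0r.
rewrite (_ : (fun l => _ * g l) = (fun l => a * \1_B l * g l + f l * g l)).
  by apply: calculus_sum => //; exact: calculus_scale_indic.
by apply/funext => l; rewrite mulrDl.
Qed.

Lemma calculus_indic B : measurable B -> calculus (\1_B) (E B).
Proof.
move=> mB; have := calculusD (ler01 : 0 <= 1 :> R) mB calculus0.
rewrite (_ : (fun l => _) = \1_B); last first.
  by apply/funext => l; rewrite mul1r addr0.
by rewrite (_ : (fun x => _) = E B)//; apply/funext => l; rewrite scale1r addr0.
Qed.

Lemma calculus_nnsfun (h : {nnsfun R >-> R}) : exists T, calculus h T.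
Proof.
suff [T] : exists T, calculus
    (fun l => \sum_(y <- fset_set (range h)) y * \1_(h @^-1` [set y]) l) T.
  have -> : (fun l => \sum_(y <- fset_set (range h)) y * \1_(h @^-1` [set y]) l)
      = (h : R -> R).
    by apply/funext => l; rewrite [RHS]fimfunE fsbig_finite.
  by move=> fT; exists T.
have : forall y, y \in (fset_set (range h) : seq R) -> 0 <= y.
  move=> y; rewrite in_fset_set// => /set_mem[l _ <-]; exact: fun_ge0.
elim: (fset_set (range h) : seq R) => [|y s IH] ys.
  exists (fun=> 0); rewrite (_ : (fun l => _) = (fun=> 0)); first exact: calculus0.
  by apply/funext => l; rewrite big_nil.
have [|T fT] := IH; first by move=> z zs; apply: ys; rewrite inE zs orbT.
exists (fun x => y *: E (h @^-1` [set y]) x + T x).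
rewrite (_ : (fun l => _) = (fun l => y * \1_(h @^-1` [set y]) l +
  \sum_(y0 <- s) y0 * \1_(h @^-1` [set y0]) l)); last first.
  by apply/funext => l; rewrite big_cons.
by apply: calculusD => //; apply: ys; rewrite inE eqxx.
Qed.


Implicit Types (x y z : H) (f g : R -> R).

Local Notation half := (`[0%R, +oo[%classic : set R).
Local Notation I x f := (spectral_integral dot E f x).

Lemma spectral_integralE x : exists mu : {measure set R -> \bar R},
  (forall B, measurable B -> mu B = spectral_mass dot E x B) /\
  forall f, I x f = (\int[mu]_(l in half) (f l)%:E)%E.
Proof.
have [mu muE] := spectral_measure_exists x; exists mu; split=> // f.
by apply: eq_setfun_integral => B mB; rewrite muE.
Qed.

Lemma spectral_integral_ge0 x f : (forall l, 0 <= l -> 0 <= f l) -> (0 <= I x f)%E.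
Proof.
move=> f0; have [mu [_ ->]] := spectral_integralE x.
by apply: integral_ge0 => l /=; rewrite in_itv/= andbT lee_fin => /f0.
Qed.

Lemma spectral_integral_le x f g : measurable_fun [set: R] f ->
  measurable_fun [set: R] g ->
  (forall l, 0 <= l -> 0 <= f l <= g l) -> (I x f <= I x g)%E.
Proof.
move=> mf mg fg; have [mu [_ IE]] := spectral_integralE x; rewrite !IE.
apply: ge0_le_integral => //.
- by move=> l /=; rewrite in_itv/= andbT lee_fin => /fg/andP[].
- by apply/measurable_EFinP; exact: measurable_funTS.
- by apply/measurable_EFinP; exact: measurable_funTS.
- by move=> l /=; rewrite in_itv/= andbT lee_fin => /fg/andP[].
Qed.

Lemma spectral_integralD x f g : measurable_fun [set: R] f ->
  measurable_fun [set: R] g ->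
  (forall l, 0 <= l -> 0 <= f l) -> (forall l, 0 <= l -> 0 <= g l) ->
  I x (fun l => f l + g l) = (I x f + I x g)%E.
Proof.
move=> mf mg f0 g0; have [mu [_ IE]] := spectral_integralE x; rewrite !IE.
under eq_integral do rewrite EFinD.
apply: ge0_integralD => //.
- by move=> l /=; rewrite in_itv/= andbT lee_fin => /f0.
- by apply/measurable_EFinP; exact: measurable_funTS.
- by move=> l /=; rewrite in_itv/= andbT lee_fin => /g0.
- by apply/measurable_EFinP; exact: measurable_funTS.
Qed.

Lemma calculus_integral f T x : calculus f T -> I x f = (dot (T x) x)%:E.
Proof.
elim=> [|a B {}f {}T a0 mB fT IH].
  have [mu [_ ->]] := spectral_integralE x.
  by rewrite dot0l integral0.
rewrite spectral_integralD//; last 3 first.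
- exact: calculus_measurable fT.
- by move=> l _; rewrite mulr_ge0.
- by move=> l _; exact: calculus_ge0 fT.
- rewrite IH; have [mu [muE IE]] := spectral_integralE x; rewrite !IE.
  under eq_integral do rewrite EFinM.
  rewrite ge0_integralZl_EFin//; last first.
    by apply/measurable_EFinP; apply: measurable_funTS.
  rewrite integral_indic// muE; last exact: measurableI.
  by rewrite /spectral_mass E_setI// E_half -EFinM -EFinD dotDl dotZl.
- by apply: measurable_funM.
Qed.

Lemma spectral_integral_monotone x f (F : nat -> R -> R) :
  (forall n, measurable_fun [set: R] (F n)) ->
  (forall n l, 0 <= l -> 0 <= F n l) ->
  (forall l, 0 <= l -> nondecreasing_seq (F ^~ l)) ->
  (forall l, 0 <= l -> F n l @[n --> \oo] --> f l) ->
  I x (F n) @[n --> \oo] --> I x f.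
Proof.
move=> mF F0 ndF cF; have [mu [_ IE]] := spectral_integralE x.
under eq_cvg do rewrite IE.
rewrite IE.
have -> : (\int[mu]_(l in half) (f l)%:E =
    \int[mu]_(l in half) limn (fun n => (F n l)%:E))%E.
  apply: eq_integral => l /set_mem/=; rewrite in_itv/= andbT => l0.
  by apply/esym/cvg_lim => //; apply: cvg_EFin; [exact: nearW|exact: cF].
apply: cvg_monotone_convergence => //.
- by move=> n; apply/measurable_EFinP; exact: measurable_funTS.
- by move=> n l /=; rewrite in_itv/= andbT lee_fin => /F0.
- by move=> l /=; rewrite in_itv/= andbT => /ndF h n m nm; rewrite lee_fin; exact: h.
Qed.

(** On [spectral_dom] of an unbounded [f] the bounded operators [T n] converge strongly to f(A), so
    that identities between simple functions pass to the limit. *)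
Definition spectral_approx f (F : nat -> R -> R) (T : nat -> H -> H) :=
  [/\ forall n, calculus (F n) (T n),
      forall l, 0 <= l -> nondecreasing_seq (F ^~ l) &
      forall l, 0 <= l -> F n l @[n --> \oo] --> f l].

Lemma spectral_approx_exists f : measurable_fun [set: R] f ->
  (forall l, 0 <= l -> 0 <= f l) -> exists F T, spectral_approx f F T.
Proof.
move=> mf f0.
have mh : measurable half by [].
have mf' : measurable_fun half (EFin \o f).
  by apply/measurable_EFinP; exact: measurable_funTS.
pose F := nnsfun_approx mh mf'.
have /choice[T FT] : forall n, exists T, calculus (F n) T.
  by move=> n; exact: calculus_nnsfun.
exists (fun n => F n : R -> R), T; split=> //.
- by move=> l l0 n m nm; exact/lefP/nd_nnsfun_approx.
- move=> l l0.
  have hl : half l by rewrite /= in_itv/= andbT.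
  have f0' t : half t -> (0%E <= (EFin \o f) t)%E.
    by rewrite /= in_itv/= andbT lee_fin => /f0.
  by have /fine_cvgP[_] := cvg_nnsfun_approx mh mf' f0' hl.
Qed.

Lemma spectral_approxM f F T g G S : spectral_approx f F T ->
  spectral_approx g G S ->
  spectral_approx (fun l => f l * g l) (fun n l => F n l * G n l)
    (fun n x => T n (S n x)).
Proof.
move=> [FT ndF cF] [GS ndG cG]; split.
- by move=> n; exact: calculusM.
- move=> l l0 n m nm; rewrite ler_pM//; [exact: calculus_ge0 (FT _)|
    exact: calculus_ge0 (GS _)|exact: ndF|exact: ndG].
- by move=> l l0; apply: cvgM; [exact: cF|exact: cG].
Qed.

Lemma spectral_approx_integral f F T x : spectral_approx f F T ->
  (dot (T n x) x)%:E @[n --> \oo] --> I x f.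
Proof.
move=> [FT ndF cF]; under eq_cvg do rewrite -(calculus_integral _ (FT _)).
apply: spectral_integral_monotone => //.
- by move=> n; exact: calculus_measurable (FT n).
- by move=> n l _; exact: calculus_ge0 (FT n).
Qed.


Lemma spectral_approx_sqr f F T x : spectral_approx f F T ->
  (`|T n x| ^+ 2)%:E @[n --> \oo] --> I x (fun l => f l ^+ 2).
Proof.
move=> fFT; have := spectral_approx_integral (x := x) (spectral_approxM fFT fFT).
have [FT _ _] := fFT.
under eq_cvg => n do rewrite (calculus_sym _ _ (FT n)) -hdot.
by under [X in I x X]eq_fun do rewrite -expr2.
Qed.

Lemma spectral_approx_le f F T n l : spectral_approx f F T -> 0 <= l ->
  F n l <= f l.
Proof.
move=> [_ ndF cF] l0; have := nondecreasing_cvgn_le (ndF l l0) (cvgP _ (cF l l0)) n.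
by rewrite (cvg_lim _ (cF l l0)).
Qed.

Lemma spectral_dom_fin f x : spectral_dom dot E f x ->
  I x (fun l => f l ^+ 2) \is a fin_num.
Proof.
move=> fx; rewrite ge0_fin_numE//.
by apply: spectral_integral_ge0 => l _; exact: sqr_ge0.
Qed.

Lemma spectral_approx_bound f F T x n : measurable_fun [set: R] f ->
  spectral_approx f F T -> spectral_dom dot E f x ->
  `|T n x| ^+ 2 <= fine (I x (fun l => f l ^+ 2)).
Proof.
move=> mf fFT fx; rewrite -lee_fin fineK; last exact: spectral_dom_fin.
have [FT ndF cF] := fFT.
rewrite hdot -(calculus_sym _ _ (FT n)).
rewrite -(calculus_integral _ (calculusM (FT n) (FT n))).
apply: spectral_integral_le.
- exact: calculus_measurable (calculusM (FT n) (FT n)).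
- by apply: measurable_funX.
- move=> l l0; have Fl := calculus_ge0 l (FT n).
  by rewrite mulr_ge0//= expr2 ler_pM// (spectral_approx_le n fFT).
Qed.

(** For N <= n, monotonicity gives |T N x|^2 <= <T n x, T N x>, hence |T n x - T N x|^2 <= |T n x|^2
    - |T N x|^2, and these squares converge to a finite integral. *)
Lemma spectral_approx_cvg f F T x : measurable_fun [set: R] f ->
  spectral_approx f F T -> spectral_dom dot E f x ->
  cvgn (fun n => T n x).
Proof.
move=> mf fFT fx; apply/cauchy_cvgP; apply: cauchy_exP => e e0.
have [FT ndF cF] := fFT.
have /fine_cvgP[_] : (`|T n x| ^+ 2)%:E @[n --> \oo] -->
    (fine (I x (fun l => f l ^+ 2)))%:E.
  rewrite fineK; last exact: spectral_dom_fin.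
  exact: spectral_approx_sqr.
set a := fine _ => /cvgrPdist_lt/(_ (e ^+ 2)); rewrite exprn_gt0// => /(_ isT)[N _ hN].
exists (T N x); exists N => // n /= Nn; rewrite -ball_normE/=.
have key : `|T N x - T n x| ^+ 2 <= `|T n x| ^+ 2 - `|T N x| ^+ 2.
  have le : dot (T N x) (T N x) <= dot (T n x) (T N x).
    have Ie k : (dot (T k x) (T N x))%:E = I x (fun l => F N l * F k l).
      by rewrite (calculus_integral _ (calculusM (FT N) (FT k)))
        (calculus_sym _ _ (FT N)).
    rewrite -lee_fin !Ie.
    apply: spectral_integral_le.
    - exact: calculus_measurable (calculusM (FT N) (FT N)).
    - exact: calculus_measurable (calculusM (FT N) (FT n)).
    - move=> l l0; have Fl := calculus_ge0 l (FT N).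
      by rewrite mulr_ge0//= ler_wpM2l// ndF.
  by rewrite !hdot !dotE (dotC _ (T N x) (T n x)); lra.
rewrite -(@ltr_pXn2r _ 2) ?nnegrE ?normr_ge0 ?ltW//.
apply: le_lt_trans key _; have := hN N (leqnn N); have /= := hN n Nn.
have := spectral_approx_bound n mf fFT fx; rewrite -/a => h1 h2.
rewrite ger0_norm; last by rewrite subr_ge0 (spectral_approx_bound N mf fFT fx).
by lra.
Qed.

Lemma spectral_approx_domD f F T x z : measurable_fun [set: R] f ->
  spectral_approx f F T ->
  (exists K, forall n, `|T n x| <= K) -> exists K, forall n, dot (T n x) x <= K.
Proof.
move=> mf fFT [K hK]; exists (K * `|x|) => n.
apply: le_trans (ler_norm _) _; apply: le_trans (Cauchy_Schwarz hdot _ _) _.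
by rewrite ler_wpM2r.
Qed.

(** The polarized integrals at [x + z] and [x - z] must be finite for [fine] to be meaningful; this
    follows by linearity from the bounds on [T n] at [x] and at [z]. *)
Lemma spectral_approx_value f F T x : measurable_fun [set: R] f ->
  spectral_approx f F T -> spectral_dom dot E f x ->
  exists y, [/\ T n x @[n --> \oo] --> y, spectral_value dot E f x y &
    (`|y| ^+ 2)%:E = I x (fun l => f l ^+ 2)].
Proof.
move=> mf fFT fx; have [FT ndF cF] := fFT.
have /cvg_ex[y Ty] := spectral_approx_cvg mf fFT fx.
exists y; split => //; last first.
  apply: (cvg_unique _ _ (spectral_approx_sqr (x := x) fFT)) => //.
  apply: cvg_EFin; first exact: nearW.
  exact: cvg_sqrnorm.
move=> z fz.
have finI w : (exists K, forall n, `|T n w| <= K) -> dot (T n w) w @[n --> \oo] -->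
    (fine (I w f) : R^o).
  move=> /(spectral_approx_domD w mf fFT)[K hK].
  have h := spectral_approx_integral (x := w) fFT.
  suff fin : I w f \is a fin_num.
    by have /fine_cvgP[_] : (dot (T n w) w)%:E @[n --> \oo] --> (fine (I w f))%:E
      by rewrite fineK.
  have IK : (I w f <= K%:E)%E.
    rewrite -(cvg_lim _ h)//; apply: lime_le; first exact: cvgP h.
    by apply: nearW => n; rewrite lee_fin.
  rewrite ge0_fin_numE; first exact: le_lt_trans IK (ltry _).
  rewrite -(cvg_lim _ h)//; apply: lime_ge; first exact: cvgP h.
  apply: nearW => n; rewrite -(calculus_integral _ (FT n)).
  by apply: spectral_integral_ge0 => l _; exact: calculus_ge0 (FT n).
have bd w : spectral_dom dot E f w -> exists K, forall n, `|T n w| <= K.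
  move=> fw; exists (Num.sqrt (fine (I w (fun l => f l ^+ 2)))) => n.
  rewrite -[leLHS]ger0_norm// -sqrtr_sqr ler_wsqrtr//.
  exact: spectral_approx_bound.
have [Kx hx] := bd x fx; have [Kz hz] := bd z fz.
have TD n u v : T n (u + v) = T n u + T n v.
  by have := calculus_linear (FT n) 1 u v; rewrite !scale1r.
have TB n u v : T n (u - v) = T n u - T n v.
  by exact: (zmod_morphism_linear (calculus_linear (FT n))).
have h1 : dot (T n (x + z)) (x + z) @[n --> \oo] --> (fine (I (x + z) f) : R^o).
  apply: finI; exists (Kx + Kz) => n; rewrite TD.
  by apply: le_trans (ler_normD _ _) _; exact: lerD.
have h2 : dot (T n (x - z)) (x - z) @[n --> \oo] --> (fine (I (x - z) f) : R^o).
  apply: finI; exists (Kx + Kz) => n; rewrite TB.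
  by apply: le_trans (ler_normB _ _) _; exact: lerD.
have h3 : dot (T n x) z @[n --> \oo] -->
    (4^-1 * (fine (I (x + z) f) - fine (I (x - z) f)) : R^o).
  have : 4^-1 * (dot (T n (x + z)) (x + z) - dot (T n (x - z)) (x - z))
      @[n --> \oo] --> (4^-1 * (fine (I (x + z) f) - fine (I (x - z) f)) : R^o).
    by apply: cvgM; [exact: cvg_cst|exact: cvgB].
  apply: cvg_trans; apply: near_eq_cvg; apply: nearW => n.
  rewrite TD TB !dotE (calculus_sym z x (FT n)) (dotC _ z (T n x)).
  by field.
apply: (cvg_unique _ _ h3) => //.
by apply: cvg_dot => //; exact: cvg_cst.
Qed.

Lemma calculus_comm f T B x : calculus f T -> measurable B ->
  E B (T x) = T (E B x).
Proof.
move=> fT mB; elim: fT => [|a C {}f {}T a0 mC _ IH].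
  exact: linear_map0 (E_linear mB).
have EL := E_linear mB.
rewrite -[a *: E C x + T x]scale1r scalerDr.
rewrite (_ : 1 *: _ = a *: E C x) ?scale1r// EL IH.
by rewrite -!E_setI// setIC.
Qed.

Lemma E_setT x : E [set: R] x = x.
Proof. by rewrite -{1}(E_half x) -E_setI// setTI E_half. Qed.

Lemma spectral_integral_cst x a : 0 <= a -> I x (fun=> a) = (a * `|x| ^+ 2)%:E.
Proof.
move=> a0; have := calculus_integral x (calculusD a0 measurableT calculus0).
rewrite (_ : (fun l => _ * _ + _) = (fun=> a)); last first.
  by apply/funext => l; rewrite indicT mulr1 addr0.
by move=> ->; rewrite addr0 E_setT dotZl hdot.
Qed.

Definition spectral_proj (n : nat) : H -> H := E `[0%R, n%:R]%classic.

Lemma proj_linear n : linear (spectral_proj n).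
Proof. exact: E_linear. Qed.

Lemma proj_le n x : `|spectral_proj n x| <= `|x|.
Proof. exact: mass_setT_le. Qed.

(** Continuity from below of the measure <E x, x> gives |P n x|^2 --> |x|^2, and |x - P n x|^2 is
    the difference of these squares because [P n] is an orthogonal projection. *)
Lemma proj_cvg x : spectral_proj n x @[n --> \oo] --> x.
Proof.
have [mu [muE _]] := spectral_integralE x.
have : (mu \o (fun n => `[0%R, n%:R]%classic)) n @[n --> \oo] -->
    mu (\bigcup_n `[0%R, n%:R]%classic).
  apply: nondecreasing_cvg_mu => //; first exact: bigcup_measurable.
  move=> n m nm; apply/subsetPset => l /=; rewrite !in_itv/= => /andP[->] /le_trans.
  by apply; rewrite ler_nat.
have -> : \bigcup_n `[0%R, n%:R]%classic = half.
  apply/seteqP; split=> l /=.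
    by move=> [n _ /=]; rewrite !in_itv/= => /andP[->].
  rewrite in_itv/= andbT => l0; exists (Num.truncn l).+1 => //=.
  by rewrite in_itv/= l0 ltW// truncnS_gt.
rewrite muE// /spectral_mass E_half -hdot.
under eq_cvg => n do rewrite /comp muE// /spectral_mass mass_norm//.
move=> /fine_cvgP[_ h]; apply/cvgrPdist_lt => e e0.
move/cvgrPdist_lt : h => /(_ (e ^+ 2)); rewrite exprn_gt0// => /(_ isT).
apply: filterS => n /= h.
rewrite -(@ltr_pXn2r _ 2) ?nnegrE ?normr_ge0 ?ltW//.
apply: le_lt_trans h; apply: le_trans (ler_norm _).
rewrite -/(spectral_proj n x) [leLHS]hdot !dotE -!hdot.
have e1 : dot x (spectral_proj n x) = `|spectral_proj n x| ^+ 2 by rewrite dotC mass_norm.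
by rewrite (dotC _ (spectral_proj n x)) e1; lra.
Qed.

(** The projection multiplies the simple functions by the indicator of [0, n], where they are at
    most [C]; the bound then passes to the limit. *)
Lemma spectral_integral_proj f F T n x (C : R) : measurable_fun [set: R] f ->
  spectral_approx f F T -> (forall l, 0 <= l <= n%:R -> f l <= C) ->
  (I (spectral_proj n x) (fun l => (f l ^+ 2)%R) <= (C ^+ 2 * `|x| ^+ 2)%:E)%E.
Proof.
move=> mf fFT fC; have [FT ndF cF] := fFT.
have h := spectral_approx_sqr (x := spectral_proj n x) fFT.
rewrite -(cvg_lim _ h)//; apply: lime_le; first exact: cvgP h.
apply: nearW => k.
have mB : measurable (`[0%R, n%:R]%classic : set R) by [].
have c := calculusM (calculus_indic mB)
  (calculusM (FT k) (calculusM (FT k) (calculus_indic mB))).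
have -> : (`|T k (spectral_proj n x)| ^+ 2)%:E =
    I x (fun l => \1_`[0%R, n%:R]%classic l *
      (F k l * (F k l * \1_`[0%R, n%:R]%classic l))).
  by rewrite (calculus_integral _ c) E_sym// hdot -(calculus_sym _ _ (FT k)).
rewrite -spectral_integral_cst ?sqr_ge0//.
apply: spectral_integral_le; [exact: calculus_measurable c|exact: measurable_cst|].
move=> l l0; rewrite (calculus_ge0 l c)/= indicE.
have [ln|_] := boolP (l \in _); last by rewrite mul0r sqr_ge0.
rewrite mul1r mulr1 -expr2 ler_sqr ?nnegrE.
- apply: le_trans (spectral_approx_le k fFT l0) _; apply: fC.
  by move/set_mem : ln; rewrite /= in_itv.
- exact: calculus_ge0 (FT k).
- apply: le_trans (calculus_ge0 l (FT k)) _.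
  apply: le_trans (spectral_approx_le k fFT l0) _; apply: fC.
  by move/set_mem : ln; rewrite /= in_itv.
Qed.

Lemma spectral_dom_proj f F T n x (C : R) : measurable_fun [set: R] f ->
  spectral_approx f F T -> (forall l, 0 <= l <= n%:R -> f l <= C) ->
  spectral_dom dot E f (spectral_proj n x).
Proof.
move=> mf fFT fC; apply: le_lt_trans (spectral_integral_proj x mf fFT fC) _.
exact: ltry.
Qed.

(** The truncations of [w = y - z] are admissible test vectors and converge to [w], whence <w, w> =
    0. *)
Lemma spectral_value_unique f x y z :
  (forall n w, spectral_dom dot E f (spectral_proj n w)) ->
  spectral_value dot E f x y -> spectral_value dot E f x z -> y = z.
Proof.
move=> fd fy fz; apply/eqP; rewrite -subr_eq0 -normr_eq0 -sqrf_eq0 hdot.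
set w := y - z; apply/eqP.
have h : dot w (spectral_proj n w) @[n --> \oo] --> (dot w w : R^o).
  by apply: cvg_dot => //; [exact: cvg_cst|exact: proj_cvg].
have e : (fun n => dot w (spectral_proj n w)) = (fun=> 0).
  by apply/funext => n; rewrite {1}/w dotBl fy// fz// subrr.
move: h; rewrite e => h.
by apply: (cvg_unique _ h) => //; exact: cvg_cst.
Qed.

Lemma spectral_operatorE f x y :
  (forall n w, spectral_dom dot E f (spectral_proj n w)) ->
  spectral_value dot E f x y -> spectral_operator dot E f x = y.
Proof.
move=> fd fy; rewrite /spectral_operator/=; apply: xget_unique => // z fz.
exact: spectral_value_unique fz fy.
Qed.

End SpectralCalculus.

(** * Bounded truncations of the operator *)

Section Truncation.
Variables (R : realType) (H : completeNormedModType R).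
Variables (dot : {dot H for (@idfun R)}) (hdot : induces_norm dot).
Variables (A : operator H) (hA : self_adjoint dot A).
Hypothesis hA0 : nonnegative_operator dot A.
Variables (E : set R -> H -> H) (hE : spectral_resolution dot A E).

Let resE : resolution_of_identity dot E. Proof. by case: hE. Qed.
Local Notation P := (spectral_proj E).
Local Notation I x f := (spectral_integral dot E f x).

Lemma self_adjoint_sym x y : dom A x -> dom A y -> dot (A x) y = dot x (A y).
Proof.
move=> Ax Ay; have [_ _ /(_ y (A y))[_ h]] := hA.
by apply: h.
Qed.

Let midl : measurable_fun [set: R] (id : R -> R). Proof. exact: measurable_id. Qed.

Let approx_id : exists F T, spectral_approx E (id : R -> R) F T.
Proof. by apply: spectral_approx_exists. Qed.

Lemma proj_dom n x : dom A (P n x).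
Proof.
have [_ -> _] := hE; have [F [T FT]] := approx_id.
by apply: (@spectral_dom_proj _ _ _ hdot _ resE id F T n x n%:R) => // l /andP[].
Qed.

Lemma dom_approx_cvg F T x : spectral_approx E (id : R -> R) F T -> dom A x ->
  T n x @[n --> \oo] --> A x.
Proof.
move=> FT Ax; have [_ domA valA] := hE.
have fx : spectral_dom dot E id x by rewrite -domA.
have [y [Ty vy _]] := spectral_approx_value hdot resE midl FT fx.
have -> // : A x = y.
apply: (spectral_value_unique hdot resE _ (valA _ Ax) vy) => n w.
rewrite -domA; exact: proj_dom.
Qed.

(** Both sides are limits of P n (T k x) = T k (P n x), where the simple [T k] approximate [A]. *)
Lemma proj_comm n x : dom A x -> P n (A x) = A (P n x).
Proof.
move=> Ax; have [F [T FT]] := approx_id.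
have h1 := dom_approx_cvg FT (proj_dom n x).
have h2 : P n (T k x) @[k --> \oo] --> P n (A x).
  apply: (@bounded_cvg _ _ _ _ _ _ _ 1) => //; last exact: (dom_approx_cvg FT Ax).
    exact: proj_linear resE _.
  by move=> y; rewrite mul1r; exact: proj_le.
have [FTn _ _] := FT.
have e : (fun k => P n (T k x)) = (fun k => T k (P n x)).
  by apply/funext => k; exact: calculus_comm resE _ _ _ _ (FTn k) _.
by move: h2; rewrite e => h2; exact: cvg_unique h2 h1.
Qed.

Definition trunc_op n x := A (P n x).

Lemma trunc_op_linear n : linear (trunc_op n).
Proof.
move=> a x y; rewrite /trunc_op (proj_linear resE).
by have [[_ h] _ _] := hA; have [_ ->] := h a _ _ (proj_dom n x) (proj_dom n y).
Qed.

Lemma proj_proj n x : P n (P n x) = P n x.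
Proof. exact: E_idem resE _ _ _. Qed.

Lemma proj_sym n x y : dot (P n x) y = dot x (P n y).
Proof. exact: E_sym resE _ _ _ _. Qed.

Lemma trunc_op_proj n x : dom A x -> P n (A x) = trunc_op n (P n x).
Proof. by move=> Ax; rewrite proj_comm// /trunc_op proj_proj. Qed.

Lemma proj_trunc_op n x : P n (trunc_op n x) = trunc_op n x.
Proof. by rewrite /trunc_op proj_comm ?proj_proj//; exact: proj_dom. Qed.

Lemma trunc_op_sym n x y : dot (trunc_op n x) y = dot x (trunc_op n y).
Proof.
rewrite -proj_trunc_op proj_sym self_adjoint_sym; try exact: proj_dom.
by rewrite proj_sym -/(trunc_op n y) proj_trunc_op.
Qed.

Lemma trunc_op_ge0 n x : 0 <= dot (trunc_op n x) x.
Proof. by rewrite -proj_trunc_op proj_sym; apply: hA0; exact: proj_dom. Qed.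

Lemma trunc_op_bound n x : `|trunc_op n x| <= n%:R * `|x|.
Proof.
have [F [T FT]] := approx_id.
have [_ domA valA] := hE.
have fx : spectral_dom dot E id (P n x) by rewrite -domA; exact: proj_dom.
have [y [Ty _ ny]] := spectral_approx_value hdot resE midl FT fx.
have -> : trunc_op n x = y.
  by apply: cvg_unique (dom_approx_cvg FT (proj_dom n x)) Ty.
rewrite -(@ler_pXn2r _ 2) ?nnegrE ?mulr_ge0// -lee_fin ny exprMn.
by apply: (@spectral_integral_proj _ _ _ hdot _ resE id F T) => // l /andP[].
Qed.

(** Serves for bounds uniform in [n]: with [S] the identity and g(l) = l for [u1], with [S]
    approximating [A] and g(l) = l^3 for [u0]. *)
Lemma trunc_form_le F T G S (g : R -> R) n x (C : R) :
  spectral_approx E (id : R -> R) F T -> calculus E G S ->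
  measurable_fun [set: R] g ->
  (forall k l, 0 <= l -> F k l * G l ^+ 2 <= g l) -> (I x g <= C%:E)%E ->
  dot (trunc_op n (P n (S x))) (P n (S x)) <= C.
Proof.
move=> FT GS mg FG gC; have [FTn _ _] := FT.
have h : dot (T k (P n (S x))) (P n (S x)) @[k --> \oo] -->
    (dot (trunc_op n (P n (S x))) (P n (S x)) : R^o).
  apply: cvg_dot => //; last exact: cvg_cst.
  by rewrite /trunc_op proj_proj; exact: (dom_approx_cvg FT (proj_dom n (S x))).
rewrite -(cvg_lim _ h)//; apply: limr_le; first exact: cvgP h.
apply: nearW => k; rewrite -lee_fin; apply: le_trans gC.
have mB : measurable (`[0%R, n%:R]%classic : set R) by [].
have c := calculusM resE GS (calculusM resE (calculus_indic E mB)
  (calculusM resE (FTn k) (calculusM resE (calculus_indic E mB) GS))).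
have -> : (dot (T k (P n (S x))) (P n (S x)))%:E = I x (fun l => G l *
  (\1_`[0%R, n%:R]%classic l * (F k l * (\1_`[0%R, n%:R]%classic l * G l)))).
  by rewrite (calculus_integral hdot resE _ c) (calculus_sym resE _ _ GS) proj_sym.
apply: (spectral_integral_le hdot resE) => //; first exact: calculus_measurable c.
move=> l l0; rewrite (calculus_ge0 l c)/=; apply: le_trans (FG k l l0).
have G0 := calculus_ge0 l GS; have F0 := calculus_ge0 l (FTn k).
rewrite indicE; case: (l \in _); last by rewrite mul0r mulr0 mulr_ge0 ?sqr_ge0.
by rewrite !mul1r le_eqVlt; apply/orP; left; apply/eqP; ring.
Qed.

End Truncation.

Section SpectralTruncation.
Variables (R : realType) (H : completeNormedModType R).
Variables (dot : {dot H for (@idfun R)}) (hdot : induces_norm dot).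
Variables (A : operator H) (hA : self_adjoint dot A).
Hypothesis hA0 : nonnegative_operator dot A.

Local Notation I E x f := (spectral_integral dot E f x).

(** Squaring l^(1/2) in the spectral integral gives the identity function, whose integral is <A x,
    x> by monotone approximation. *)
Lemma spectral_sqrt_norm E x : spectral_resolution dot A E -> dom A x ->
  `|spectral_operator dot E (fun l => l `^ 2^-1) x| ^+ 2 = dot (A x) x.
Proof.
move=> hE Ax; have [resE domA valA] := hE.
pose f (l : R) := l `^ 2^-1.
have mf : measurable_fun [set: R] f by exact: measurable_powR.
have f2 l : 0 <= l -> f l ^+ 2 = l.
  by move=> l0; rewrite /f powR12_sqrt// sqr_sqrtr.
have If y : I E y (fun l => f l ^+ 2) = I E y (id : R -> R).
  have [mu [_ IE]] := spectral_integralE hdot resE y; rewrite !IE.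
  apply: eq_integral => l; rewrite inE/= in_itv/= andbT => l0.
  by rewrite f2.
have [F [T FT]] : exists F T, spectral_approx E f F T.
  by apply: spectral_approx_exists => // l _; exact: powR_ge0.
have [F' [T' FT']] : exists F T, spectral_approx E (id : R -> R) F T.
  by apply: spectral_approx_exists => //; exact: measurable_id.
have Ix : I E x (id : R -> R) = (dot (A x) x)%:E.
  have h := spectral_approx_integral hdot resE (x := x) FT'.
  apply: (cvg_unique _ h) => //; apply: cvg_EFin; first exact: nearW.
  apply: cvg_dot => //; last exact: cvg_cst.
  exact: (dom_approx_cvg hdot hE FT' Ax).
have fx : spectral_dom dot E f x by rewrite /spectral_dom/= If Ix ltry.
have [y [Ty vy ny]] := spectral_approx_value hdot resE mf FT fx.
have -> : spectral_operator dot E f x = y.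
  apply: (spectral_operatorE hdot resE _ vy) => n w.
  apply: (spectral_dom_proj hdot resE w mf FT (C := Num.sqrt n%:R)) => l /andP[l0 ln].
  by rewrite /f powR12_sqrt// ler_wsqrtr.
by apply/EFin_inj; rewrite ny If.
Qed.

(** The interface between spectral theory and evolution equations: A^(1/2) disappears in favour of
    <A x, x>, and the domains of the powers survive only as the last bound, uniform in [n]. *)
Theorem spectral_truncation u0 u1 :
  dom (operator_power dot A (3 / 2)) u0 -> dom (half_power dot A) u1 ->
  dom A u0 ->
  exists P B : nat -> H -> H,
  [/\ (forall n, linear (P n)) /\ (forall n x, `|P n x| <= `|x|),
      forall x, P n x @[n --> \oo] --> x,
      (forall n, linear (B n)) /\ (forall n x, `|B n x| <= n%:R * `|x|),
      (forall n x y, dot (B n x) y = dot x (B n y)) /\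
      (forall n x, 0 <= dot (B n x) x) &
      [/\ forall n x, dom A x -> P n (A x) = B n (P n x),
          forall x, dom A x -> `|half_power dot A x| ^+ 2 = dot (A x) x &
          exists C : R, forall n, dot (B n (P n u1)) (P n u1) <= C /\
            dot (B n (P n (A u0))) (P n (A u0)) <= C]].
Proof.
(* In the other branch the powers have empty domain, which [u0] excludes: hence a resolution of the
   identity exists. *)
rewrite /half_power /operator_power; case: pselect => // hex.
set E := projT1 (cid hex); have hE : spectral_resolution dot A E := projT2 (cid hex).
move=> /= u0d u1d Au0.
have [resE domA valA] := hE.
exists (spectral_proj E), (trunc_op A E); split.
- by split=> n; [exact: proj_linear resE n|move=> x; exact: (proj_le hdot resE)].
- by move=> x; exact: (proj_cvg hdot resE).
- by split=> n; [exact: (trunc_op_linear hdot hA hE n)|move=> x;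
    exact: (trunc_op_bound hdot hE)].
- by split=> n x => [y|]; [exact: (trunc_op_sym hdot hA hE)|
    exact: (trunc_op_ge0 hdot hA0 hE)].
split.
- by move=> n x; exact: (trunc_op_proj hdot hE).
- by move=> x; exact: spectral_sqrt_norm.
- have [F [T FT]] : exists F T, spectral_approx E (id : R -> R) F T.
    by apply: spectral_approx_exists => //; exact: measurable_id.
  have [FTn _ _] := FT.
  pose C1 := fine (I E u1 (fun l => (l `^ 2^-1) ^+ 2)).
  pose C3 := fine (I E u0 (fun l => (l `^ (3 / 2)) ^+ 2)).
  have eC1 : I E u1 (fun l => (l `^ 2^-1) ^+ 2) = C1%:E.
    by rewrite fineK//; exact: (spectral_dom_fin hdot resE u1d).
  have eC3 : I E u0 (fun l => (l `^ (3/2)) ^+ 2) = C3%:E.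
    by rewrite fineK//; exact: (spectral_dom_fin hdot resE u0d).
  exists (Num.max C1 C3) => n; split.
  + apply: (@le_trans _ _ C1); last by rewrite le_max lexx.
    have := @trunc_form_le _ _ _ hdot _ _ hE F T _ _ (fun l => (l `^ 2^-1) ^+ 2) n u1 C1 FT
       (calculus_indic E measurableT).
    rewrite (E_setT resE); apply; last by rewrite eC1.
      by apply: measurable_funX; exact: measurable_powR.
    move=> k l l0; rewrite indicT expr1n mulr1 powR12_sqrt// sqr_sqrtr//.
    exact: spectral_approx_le FT l0.
  + apply: (@le_trans _ _ C3); last by rewrite le_max lexx orbT.
    (* [A] is not the integral of a simple function, so [A u0] is replaced by the approximations
       [T j u0], to which [trunc_form_le] applies, before [j] tends to infinity. *)
    have Ty : T j u0 @[j --> \oo] --> A u0 by exact: (dom_approx_cvg hdot hE FT Au0).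
    have h : dot (trunc_op A E n (spectral_proj E n (T j u0)))
          (spectral_proj E n (T j u0)) @[j --> \oo] -->
        (dot (trunc_op A E n (spectral_proj E n (A u0)))
          (spectral_proj E n (A u0)) : R^o).
      have hP : spectral_proj E n (T j u0) @[j --> \oo] --> spectral_proj E n (A u0).
        apply: (@bounded_cvg _ _ _ _ _ _ _ 1) => //.
          exact: proj_linear resE n.
        by move=> y; rewrite mul1r; exact: (proj_le hdot resE).
      apply: cvg_dot => //.
      apply: (@bounded_cvg _ _ _ _ _ _ _ n%:R) => //.
        exact: (trunc_op_linear hdot hA hE n).
      by move=> y; exact: (trunc_op_bound hdot hE).
    rewrite -(cvg_lim _ h)//; apply: limr_le; first exact: cvgP h.
    apply: nearW => j.
    apply: (@trunc_form_le _ _ _ hdot _ _ hE F T _ _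
      (fun l => (l `^ (3/2)) ^+ 2) n u0 C3 FT (FTn j)); last by rewrite eC3.
      by apply: measurable_funX; exact: measurable_powR.
    move=> k l l0.
    have -> : (l `^ (3/2)) ^+ 2 = l * l ^+ 2.
      rewrite -powR_mulrn ?powR_ge0// -powRrM divfK//.
      by rewrite powR_mulrn// exprS.
    have F0 i := calculus_ge0 l (FTn i).
    rewrite ler_pM ?sqr_ge0//; first exact: spectral_approx_le FT l0.
    by rewrite ler_sqr ?nnegrE//; exact: spectral_approx_le FT l0.
Qed.

End SpectralTruncation.

Lemma hder_eq (R : realType) (V : normedModType R) (f : R -> V) t l l' :
  hder f t l -> l = l' -> hder f t l'.
Proof. by move=> ? <-. Qed.

Lemma hderX1 (R : realType) n (t : R) : 0 <= t ->
  hder (V := R^o) (fun s => (1 + s) ^+ n) t (n%:R * (1 + t) ^+ n.-1).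
Proof.
move=> t0; elim: n => [|n IH].
  rewrite mul0r (_ : (fun s => _) = (fun=> 1)); first exact: hder_cst.
  by apply/funext => s; rewrite expr0.
rewrite (_ : (fun s => _) = (fun s => (1 + s) * (1 + s) ^+ n)); last first.
  by apply/funext => s; rewrite exprS.
apply: hder_eq; first apply: hderM => //.
  by apply: hderD => //; [exact: hder_cst|exact: hder_id].
  exact: IH.
case: n {IH} => [|n] /=; first by rewrite expr0; ring.
by rewrite -[n.+2%:R]natr1 exprS; ring.
Qed.

(** * Energy estimates for bounded operators *)

Section TruncatedEnergies.
Variables (R : realType) (H : completeNormedModType R).
Variables (dot : {dot H for (@idfun R)}) (hdot : induces_norm dot).
Variables (B : H -> H) (KB : R).
Hypothesis Blin : linear B.
Hypothesis Bbd : forall x, `|B x| <= KB * `|x|.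
Hypothesis Bsym : forall x y, dot (B x) y = dot x (B y).
Hypothesis Bge0 : forall x, 0 <= dot (B x) x.

Local Notation shder := (@hder R R^o).

Lemma BD x y : B (x + y) = B x + B y.
Proof. by have := Blin 1 x y; rewrite !scale1r. Qed.

Lemma BZ a x : B (a *: x) = a *: B x.
Proof. exact: (scalable_linear Blin). Qed.

Lemma BN x : B (- x) = - B x.
Proof. by rewrite -scaleN1r BZ scaleN1r. Qed.

Definition BE := (BD, BZ, BN).

Lemma hderB_op f t l : 0 <= t -> hder f t l -> hder (fun s => B (f s)) t (B l).
Proof. by move=> t0; apply: hder_lin Bbd. Qed.

Lemma hder_sqr f t l : 0 <= t -> hder f t l ->
  shder (fun s => dot (f s) (f s)) t (2 * dot (f t) l).
Proof.
move=> t0 fl; apply: hder_eq; first exact: (hder_dot hdot t0 fl fl).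
by rewrite (dotC _ l) -mulr2n mulr_natl.
Qed.

Lemma hder_form f t l : 0 <= t -> hder f t l ->
  shder (fun s => dot (B (f s)) (f s)) t (2 * dot (B (f t)) l).
Proof.
move=> t0 fl; apply: hder_eq; first exact: (hder_dot hdot t0 (hderB_op t0 fl) fl).
by rewrite Bsym (dotC _ l) -mulr2n mulr_natl.
Qed.

(** * Decay for the linear parabolic equation *)

Section Parabolic.
Variables (u : R -> H) (c : R -> R) (mu : R).
Hypothesis mu0 : 0 < mu.
Hypothesis cmu : forall t, 0 <= t -> mu <= c t.
Hypothesis ud : forall t, 0 <= t -> hder u t (- ((1 + t) * c t) *: B (u t)).

(* Each coefficient is chosen so that the derivative of its term dominates what
   the weight of the previous one contributes. *)
Definition parabolic_energy (x : H) (tau : R) :=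
  tau ^+ 6 * dot (B (B x)) (B x) + (4 / mu) * (tau ^+ 4 * dot (B x) (B x))
  + ((2 * (4 / mu) + 1) / mu) * (tau ^+ 2 * dot (B x) x)
  + (((2 * (4 / mu) + 1) / mu + 1) / mu) * dot x x.

(** The last term keeps the factor [mu] because the leading term of the energy has coefficient 1;
    the other coefficients of the energy are tuned so that the remaining terms have factor 1. *)
Definition parabolic_dissipation (x : H) (tau : R) :=
  tau * dot (B x) x + tau ^+ 3 * dot (B x) (B x)
  + tau ^+ 5 * dot (B (B x)) (B x) + mu * (tau ^+ 7 * dot (B (B x)) (B (B x))).

Lemma parabolic_energy_der t : 0 <= t ->
  exists2 dU, shder (fun s => parabolic_energy (u s) (1 + s)) t dU &
    dU <= - (2 * parabolic_dissipation (u t) (1 + t)).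
Proof.
move=> t0; have du := ud t0; have dBu := hderB_op t0 du.
eexists.
  rewrite /parabolic_energy.
  apply: hderD => //; last first.
    apply: hderM => //; [exact: hder_cst|exact: (hder_sqr t0 du)].
  apply: hderD => //; last first.
    apply: hderM => //; [exact: hder_cst|].
    by apply: hderM => //; [exact: hderX1|exact: (hder_form t0 du)].
  apply: hderD => //; last first.
    apply: hderM => //; [exact: hder_cst|].
    by apply: hderM => //; [exact: hderX1|exact: (hder_sqr t0 dBu)].
  by apply: hderM => //; [exact: hderX1|exact: (hder_form t0 dBu)].
rewrite /parabolic_dissipation !BE !dotE /= (dotC _ (u t) (B (u t))).
rewrite (dotC _ (B (u t)) (B (B (u t)))).
set tau := 1 + t; have tau0 : 0 <= tau by rewrite addr_ge0.
have := dot_ge0 hdot (B (u t)); have := Bge0 (u t); have := Bge0 (B (u t)).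
have := dot_ge0 hdot (B (B (u t))).
move: (dot (u t) (u t)) (dot (B (u t)) (u t)) (dot (B (u t)) (B (u t)))
  (dot (B (B (u t))) (B (u t))) (dot (B (B (u t))) (B (B (u t)))).
move=> F0 F1 F2 F3 F4 F4ge F3ge F1ge F2ge.
have cm := cmu t0; move: (c t) cm => k kmu.
have kle K : 0 <= K -> K <= k * (K / mu).
  by move=> K0; rewrite mulrA ler_pdivlMr// mulrC ler_wpM2r.
have mui : 0 <= mu^-1 by rewrite invr_ge0 ltW.
have k2 : 4 <= k * (4 / mu) by apply: kle.
set K2 := 4 / mu in k2 *; have K20 : 0 <= K2 by rewrite mulr_ge0.
have k1 : 2 * K2 + 1 <= k * ((2 * K2 + 1) / mu) by apply: kle; lra.
set K1 := (2 * K2 + 1) / mu in k1 *.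
have K10 : 0 <= K1 by rewrite mulr_ge0//; lra.
have k0 : K1 + 1 <= k * ((K1 + 1) / mu) by apply: kle; lra.
move: K2 K1 ((K1 + 1) / mu) K20 K10 k2 k1 k0 => K2 K1 K0 K20 K10 k2 k1 k0.
have G1 : 0 <= tau * F1 by rewrite mulr_ge0.
have G2 : 0 <= tau ^+ 3 * F2 by rewrite mulr_ge0 ?exprn_ge0.
have G3 : 0 <= tau ^+ 5 * F3 by rewrite mulr_ge0 ?exprn_ge0.
have G4 : 0 <= tau ^+ 7 * F4 by rewrite mulr_ge0 ?exprn_ge0.
have H1 : 0 <= (k * K0 - (K1 + 1)) * (tau * F1) by rewrite mulr_ge0 ?subr_ge0.
have H2 : 0 <= (k * K1 - (2 * K2 + 1)) * (tau ^+ 3 * F2) by rewrite mulr_ge0 ?subr_ge0.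
have H3 : 0 <= (k * K2 - 4) * (tau ^+ 5 * F3) by rewrite mulr_ge0 ?subr_ge0.
have H4 : 0 <= (k - mu) * (tau ^+ 7 * F4) by rewrite mulr_ge0 ?subr_ge0.
lra.
Qed.

Lemma parabolic_energy_le t : 0 <= t ->
  parabolic_energy (u t) (1 + t) <= parabolic_energy (u 0) 1.
Proof.
move=> t0; rewrite -[X in _ <= parabolic_energy _ X]addr0.
have /choice[dU hU] : forall s, exists dU, 0 <= s ->
    shder (fun s => parabolic_energy (u s) (1 + s)) s dU /\ dU <= 0.
  move=> s; have [s0|s0] := boolP (0 <= s); last by exists 0.
  have [d dd dle] := parabolic_energy_der s0; exists d => _; split=> //.
  apply: le_trans dle _; rewrite oppr_le0 /parabolic_dissipation.
  have tau0 : 0 <= 1 + s by rewrite addr_ge0.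
  by rewrite mulr_ge0// !addr_ge0 ?mulr_ge0 ?exprn_ge0// ?(dot_ge0 hdot)// ltW.
apply: (@hder_nonincreasing R (fun s => parabolic_energy (u s) (1 + s)) dU) => //.
  by move=> s /andP[s0 _]; case: (hU s s0).
by move=> s /andP[s0 _]; case: (hU s s0).
Qed.

End Parabolic.

(** * Energies of the linear hyperbolic equation *)

Section Hyperbolic.
Variables (v v1 v2 : R -> H) (c d d1 : R -> R) (mu eps T : R).
Hypotheses (mu0 : 0 < mu) (eps0 : 0 < eps).
Hypothesis cmu : forall t, 0 <= t -> mu <= c t.
Hypothesis cd : forall t, 0 <= t -> c t * d t = 1.
Hypothesis dd : forall t, 0 <= t -> shder d t (d1 t).
Hypothesis d1le : forall t, 0 <= t <= T -> eps * (1 + t) * d1 t <= d t.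
Hypothesis vd : forall t, 0 <= t -> hder v t (v1 t).
Hypothesis v1d : forall t, 0 <= t -> hder v1 t (v2 t).
Hypothesis eqv : forall t, 0 <= t ->
  (eps * (1 + t)) *: v2 t = - v1 t - ((1 + t) * c t) *: B (v t).

(** With the weight d = 1 / c on the kinetic term the products <B v, v'> cancel, and the time
    dependence of c contributes only d' |v'|^2, which the damping dominates under [d1le]. *)
Definition hyperbolic_energy0 t :=
  eps * (d t * dot (v1 t) (v1 t)) + dot (B (v t)) (v t).

Definition hyperbolic_energy1 t :=
  eps * (d t * dot (B (v1 t)) (v1 t)) + dot (B (v t)) (B (v t)).

Lemma d_gt0 t : 0 <= t -> 0 < d t.
Proof.
move=> t0; have c0 : 0 < c t by apply: lt_le_trans (cmu t0).
by have := cd t0; rewrite -(pmulr_rgt0 _ c0) => ->.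
Qed.

Lemma hyperbolic_energy0_le : 0 <= T -> hyperbolic_energy0 T <= hyperbolic_energy0 0.
Proof.
move=> T0.
apply: (@hder_nonincreasing R hyperbolic_energy0 (fun t =>
  (eps * d1 t - 2 * d t / (1 + t)) * dot (v1 t) (v1 t))) => //.
- move=> t /andP[t0 _]; have dv := vd t0; have dv1 := v1d t0.
  apply: hder_eq.
    apply: hderD => //; last exact: (hder_form t0 dv).
    apply: hderM => //; first exact: hder_cst.
    by apply: hderM => //; [exact: dd|exact: (hder_sqr t0 dv1)].
  have tau0 : 1 + t != 0 by rewrite gt_eqF// ltr_wpDr.
  have e : dot (v1 t) (v2 t) = 
    (- dot (v1 t) (v1 t) - (1 + t) * c t * dot (B (v t)) (v1 t)) / (eps * (1 + t)).
    have := congr1 (dot (v1 t)) (eqv t0); rewrite !dotE (dotC _ (v1 t) (B (v t))) => <-.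
    by rewrite mulrC mulKf// mulf_neq0// gt_eqF.
  rewrite e; have c1 := cd t0.
  have -> : c t = (d t)^-1 by rewrite -[RHS]mul1r -c1 mulfK// gt_eqF// d_gt0.
  have := d_gt0 t0; have := eps0; move=> /gt_eqF e0 /gt_eqF f0; field.
  by rewrite tau0 e0 f0.
- move=> t /andP[t0 tT]; have tau0 : 0 < 1 + t by rewrite ltr_wpDr.
  rewrite mulr_le0_ge0 ?(dot_ge0 hdot)// subr_le0 ler_pdivlMr// mulrAC.
  apply: le_trans (d1le _) _; first by rewrite t0.
  by rewrite ler_peMl ?ltW ?d_gt0// ltr1n.
Qed.

Lemma hyperbolic_energy1_le : 0 <= T -> hyperbolic_energy1 T <= hyperbolic_energy1 0.
Proof.
move=> T0.
apply: (@hder_nonincreasing R hyperbolic_energy1 (fun t =>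
  (eps * d1 t - 2 * d t / (1 + t)) * dot (B (v1 t)) (v1 t))) => //.
- move=> t /andP[t0 _]; have dv := vd t0; have dv1 := v1d t0.
  apply: hder_eq.
    apply: hderD => //; last exact: (hder_sqr t0 (hderB_op t0 dv)).
    apply: hderM => //; first exact: hder_cst.
    by apply: hderM => //; [exact: dd|exact: (hder_form t0 dv1)].
  have tau0 : 1 + t != 0 by rewrite gt_eqF// ltr_wpDr.
  have e : dot (B (v1 t)) (v2 t) = (- dot (B (v1 t)) (v1 t) -
    (1 + t) * c t * dot (B (v t)) (B (v1 t))) / (eps * (1 + t)).
    have := congr1 (dot (B (v1 t))) (eqv t0).
    rewrite !dotE (dotC _ (B (v1 t)) (B (v t))) => <-.
    by rewrite mulrC mulKf// mulf_neq0// gt_eqF.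
  rewrite e; have c1 := cd t0.
  have -> : c t = (d t)^-1 by rewrite -[RHS]mul1r -c1 mulfK// gt_eqF// d_gt0.
  have := d_gt0 t0; have := eps0; move=> /gt_eqF e0 /gt_eqF f0; field.
  by rewrite tau0 e0 f0.
- move=> t /andP[t0 tT]; have tau0 : 0 < 1 + t by rewrite ltr_wpDr.
  rewrite mulr_le0_ge0// subr_le0 ler_pdivlMr// mulrAC.
  apply: le_trans (d1le _) _; first by rewrite t0.
  by rewrite ler_peMl ?ltW ?d_gt0// ltr1n.
Qed.

End Hyperbolic.

(** * Energies weighted by the square of 1 + t *)

Section Weighted.
Variables (Lam eps : R).

(** The bracket after [Lam] results from testing the equation with rho. The factor 1 - eps makes the
    products <r, rho> cancel: the damping yields -1 and the derivative of tau yields eps. *)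
Definition weighted_energy (d tau : R) (r rho : H) :=
  tau ^+ 2 * (eps * (d * dot r r) + dot (B rho) rho) +
  Lam * ((eps * tau) * dot r rho + ((1 - eps) / 2) * dot rho rho).

(** The indefinite product <r, rho> is completed to the square of tau d r + Lam rho. This uses half
    of the kinetic term, and the smallness of eps leaves at least Lam / 8 of |rho|^2. *)
Lemma weighted_energy_ge (mu L c d tau : R) r rho : 0 < mu -> 0 < eps ->
  mu <= c <= L -> c * d = 1 -> 0 <= Lam -> eps * (8 * (1 + Lam * L)) <= 1 ->
  1 <= tau ->
  2^-1 * (tau ^+ 2 * (eps * (d * dot r r) + dot (B rho) rho))
    + Lam / 8 * dot rho rho <= weighted_energy d tau r rho.
Proof.
move=> mu0 e0 /andP[cmu cL] cd Lam0 epsL tau1; rewrite /weighted_energy.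
have c0 : 0 < c by apply: lt_le_trans cmu.
have d0 : 0 < d by have := ltr01 (R := R); rewrite -cd pmulr_rgt0.
have L0 : 0 <= L by apply: ltW; apply: lt_le_trans cL.
have := dot_ge0 hdot ((tau * d) *: r + Lam *: rho).
have := Bge0 rho; have := dot_ge0 hdot rho; rewrite !dotE (dotC _ rho r).
move: (dot r r) (dot r rho) (dot rho rho) (dot (B rho) rho) => a q n b n0 b0 sq.
have ec : 0 <= eps * c by rewrite ltW// mulr_gt0.
have k1 := mulr_ge0 ec sq.
have e1 : eps * c * tau ^+ 2 * d ^+ 2 * a = eps * tau ^+ 2 * d * a.
  by rewrite -[RHS]mul1r -cd; ring.
have e2 : eps * c * tau * d * Lam * q = eps * tau * Lam * q.
  by rewrite -[RHS]mul1r -cd; ring.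
have k2 : eps * Lam * c <= 1 / 8.
  have : eps * (Lam * c) <= eps * (Lam * L) by rewrite ler_wpM2l ?(ltW e0)// ler_wpM2l.
  lra.
have k3 : eps <= 1 / 8.
  have : 0 <= eps * (Lam * L) by rewrite mulr_ge0 ?(ltW e0)// mulr_ge0.
  lra.
have k4 : 0 <= (1/8 - eps * Lam * c) * (Lam * n).
  by rewrite mulr_ge0 ?mulr_ge0// subr_ge0.
have k5 : 0 <= (1/8 - eps) * (Lam * n).
  by rewrite mulr_ge0 ?mulr_ge0// subr_ge0.
have k6 : 0 <= Lam * n by rewrite mulr_ge0.
have k7 : 0 <= tau ^+ 2 * b by rewrite mulr_ge0// sqr_ge0.
lra.
Qed.

(* In the application [del = c - c0], [sig = (tau c0)'], [k = c0], [psi] is the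
   initial layer and [w = w0]. *)
Definition weighted_error (d tau psi del sig k : R) (u w : H) :=
  del ^+ 2 * (16 * d * (tau ^+ 3 * dot (B u) (B u))
    + Lam ^+ 2 / 4 * (tau * dot (B u) u)) +
  eps ^+ 2 * (16 * d * sig ^+ 2 * (tau ^+ 3 * dot (B u) (B u))
    + 8 * d * k ^+ 4 * (tau ^+ 7 * dot (B (B u)) (B (B u)))
    + Lam ^+ 2 / 4 * (sig ^+ 2 * (tau * dot (B u) u)
      + k ^+ 4 * (tau ^+ 5 * dot (B (B u)) (B u)))) +
  eps * psi * (tau ^+ 2 * dot (B w) w + Lam / 2 * tau * dot w w
    + Lam / 2 * dot w w).

(** Used for the hyperbolic solution itself, with vanishing source and layer, and for the error. The
    product of [r] and [B rho] cancels through [c * d = 1]; products with [g] and [w] are split by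
    Young's inequality, and the terms in |r|^2 carrying a factor [eps] are absorbed by smallness. *)
Lemma weighted_energy_der (rho r : R -> H) (d : R -> R) (mu L c d1 psi del sig k t : R)
    (r2 g u w : H) : let tau := 1 + t in
  0 < mu -> 0 < eps -> Lam = 6 / mu -> eps * (8 * (1 + Lam * L)) <= 1 ->
  0 <= t -> mu <= c <= L -> c * d t = 1 -> eps * tau * d1 <= d t ->
  0 <= psi <= 1 ->
  hder rho t (r t + psi *: w) -> hder r t r2 -> shder d t d1 ->
  (eps * tau) *: r2 = - r t - (tau * c) *: B (rho t) - tau *: g ->
  g = (del - eps * sig) *: B u + (eps * tau ^+ 2 * k ^+ 2) *: B (B u) ->
  exists2 D, shder (fun s => weighted_energy (d s) (1 + s) (r s) (rho s)) t D &
  D <= - (tau * dot (B (rho t)) (rho t) + d t / 2 * (tau * dot (r t) (r t)))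
    + psi / eps * (tau ^+ 2 * dot (B (rho t)) (rho t)
        + Lam / 2 * dot (rho t) (rho t))
    + weighted_error (d t) tau psi del sig k u w.
Proof.
move=> tau mu0 e0 LamE epsL t0 /andP[cmu cL] cd d1d /andP[psi0 psi1] drho dr hd eqr gE.
eexists.
  rewrite /weighted_energy; apply: hderD => //.
    apply: hderM => //; first exact: hderX1.
    apply: hderD => //; last exact: (hder_form t0 drho).
    apply: hderM => //; first exact: hder_cst.
    by apply: hderM => //; [exact: hd|exact: (hder_sqr t0 dr)].
  apply: hderM => //; first exact: hder_cst.
  apply: hderD => //; last first.
    by apply: hderM => //; [exact: hder_cst|exact: (hder_sqr t0 drho)].
  apply: hderM => //; last exact: (hder_dot hdot t0 dr drho).
  apply: hderM => //; first exact: hder_cst.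
  by apply: hderD => //; [exact: hder_cst|exact: hder_id].
rewrite /= -/tau.
have c0 : 0 < c by apply: lt_le_trans cmu.
have d0 : 0 < d t by have := ltr01 (R := R); rewrite -cd pmulr_rgt0.
have L0 : 0 <= L by apply: ltW; apply: lt_le_trans cL.
have Lam0 : 0 <= Lam by rewrite LamE mulr_ge0// invr_ge0 ltW.
(* 6 = 2 + 3 + 1: the derivative of tau^2 produces 2 tau <B rho, rho>, each of [Y5], [Y6], [Y7]
   costs one such term, and one is kept as dissipation. *)
have Lamc : 6 <= Lam * c by rewrite LamE mulrAC ler_pdivlMr// ler_wpM2l.
have tau1 : 1 <= tau by rewrite lerDl.
have tau0 : 0 <= tau by apply: le_trans tau1.
have dL : 1 <= L * d t by rewrite -cd ler_wpM2r// ltW.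
(* Young's inequality, in each case as the positivity of a quadratic form *)
have Y1 := dot_ge0 hdot (2^-1 *: r t + (2 * tau) *: g).
have Y1' := dot_ge0 hdot ((del - eps * sig) *: B u -
  (eps * tau ^+ 2 * k ^+ 2) *: B (B u)).
have Y2 := Bge0 (rho t - eps *: w).
have Y3 := dot_ge0 hdot (r t - w).
have Y4 := dot_ge0 hdot (rho t - eps *: w).
have Y5 := Bge0 (rho t + (Lam / 2 * del) *: u).
have Y6 := Bge0 (rho t - (Lam / 2 * (eps * sig)) *: u).
have Y7 := Bge0 (rho t + (Lam / 2 * (eps * tau ^+ 2 * k ^+ 2)) *: B u).
have e1 := congr1 (dot (r t)) eqr.
have e2 := congr1 (dot (rho t)) eqr.
have gg : dot g g = dot ((del - eps * sig) *: B u + (eps * tau ^+ 2 * k ^+ 2) *: B (B u))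
  ((del - eps * sig) *: B u + (eps * tau ^+ 2 * k ^+ 2) *: B (B u)) by rewrite gE.
have gr : dot (rho t) g = (del - eps * sig) * dot (B u) (rho t) +
   (eps * tau ^+ 2 * k ^+ 2) * dot (B (B u)) (rho t).
  by rewrite gE !dotE !(dotC _ (rho t)).
move: Y1 Y1' Y2 Y3 Y4 Y5 Y6 Y7 e1 e2 gg gr.
have := dot_ge0 hdot (r t); have := dot_ge0 hdot w; have := Bge0 (rho t).
have := dot_ge0 hdot (rho t); have := dot_ge0 hdot (B u).
have := Bge0 w; have := Bge0 u; have := dot_ge0 hdot (B (B u)); have := Bge0 (B u).
rewrite /weighted_error !BE !dotE (dotC _ g (r t)) (dotC _ w (r t)).
rewrite (dotC _ w (rho t)) (Bsym w (rho t)) (dotC _ w (B (rho t))).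
rewrite (Bsym u (rho t)) (dotC _ u (B (rho t))) (Bsym (B u) (rho t)).
rewrite (dotC _ (B u) (B (rho t))) (dotC _ (B u) (B (B u))).
rewrite (dotC _ (r t) (B (rho t))) (dotC _ (rho t) (r t)).
rewrite (dotC _ (rho t) (B (rho t))) (dotC _ r2 (rho t)).
move: (dot (r t) (r t)) (dot (B (rho t)) (rho t)) (dot (rho t) (rho t))
  (dot (r t) (rho t)) (dot w w) (dot (B w) w) (dot (r t) w) (dot (rho t) w)
  (dot (B (rho t)) w) (dot (B (rho t)) (r t)) (dot (r t) g) (dot g g)
  (dot (B u) u) (dot (B u) (B u)) (dot (B (B u)) (B u)) (dot (B (B u)) (B (B u)))
  (dot (B (rho t)) u) (dot (B (rho t)) (B u)) (dot (r t) r2) (dot (rho t) r2)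
  (dot (rho t) g).
move=> A b n q nw bw rw pw bpw bpr rg gg F1 F2 F3 F4 x1 x2 X Y yg.
move=> F3ge F4ge F1ge bwge F2ge nge bge nwge Age.
move=> Y1 Y1' Y2 Y3 Y4 Y5 Y6 Y7 e1 e2 ggE ygE.
move: (d t) d1d d0 dL cd hd => D d1d d0 dL cd _.
have [eps_ge D_ge] := (ltW e0, ltW d0).
have P0 : 2 * (eps * tau ^+ 2 * D * X) =
    - (2 * (D * tau * A)) - 2 * (tau ^+ 2 * bpr) - 2 * (D * tau ^+ 2 * rg).
  have -> : 2 * (eps * tau ^+ 2 * D * X) = 2 * D * tau * (eps * tau * X) by ring.
  by rewrite e1 -[X in _ = - _ - 2 * X - _]mul1r -cd; ring.
have P1 := congr1 (fun z => Lam * z) e2; rewrite /= ygE in P1.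
have dt0 : 0 <= D * tau by rewrite mulr_ge0.
(* [Y1] costs 4 |g|^2, [Y1'] doubles this, and splitting (del - eps sig)^2 doubles its first part
   again: hence the coefficients 8 and 16 of [weighted_error]. *)
have P2 := mulr_ge0 dt0 Y1.
have dt3 : 0 <= D * tau ^+ 3 by rewrite mulr_ge0 ?exprn_ge0.
have P3 := mulr_ge0 dt3 Y1'.
have P3' : 0 <= D * tau ^+ 3 * ((del + eps * sig) ^+ 2 * F2).
  by rewrite mulr_ge0// mulr_ge0// sqr_ge0.
have P3'' := congr1 (fun z => D * tau ^+ 3 * z) ggE; rewrite /= in P3''.
have ki : 0 <= eps^-1 by rewrite invr_ge0.
have ek : eps * eps^-1 = 1 by rewrite divff// gt_eqF.
have P4 : 0 <= tau ^+ 2 * psi * eps^-1 * b - 2 * (tau ^+ 2 * psi * bpw)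
    + eps * tau ^+ 2 * psi * bw.
  have := mulr_ge0 (mulr_ge0 (mulr_ge0 (sqr_ge0 tau) psi0) ki) Y2.
  congr (0 <= _); have := gt_eqF e0 => en; field; by rewrite en.
have P5 := mulr_ge0 (mulr_ge0 (mulr_ge0 (mulr_ge0 Lam0 eps_ge) tau0) psi0) Y3.
have P5' : 0 <= (1 - psi) * (Lam * eps * tau * A).
  by rewrite mulr_ge0 ?subr_ge0// !mulr_ge0.
have P5'' : 0 <= Lam * eps * tau * psi * nw by rewrite !mulr_ge0.
(* The balance of tau |r|^2: of the damping 2 d, [P10] takes d and [Y1] takes d / 4; one half of d
   is kept, and the last d / 4 absorbs the terms with a factor [eps]. *)
have P11 : 0 <= (D / 4 - eps * (2 * D + 3 / 2 * Lam)) * (tau * A).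
  rewrite mulr_ge0 ?mulr_ge0// subr_ge0.
  have h1 : 0 <= (L * D - 1) * (Lam * eps) by rewrite mulr_ge0 ?subr_ge0// mulr_ge0.
  have h2 : 0 <= (1 - eps * (8 * (1 + Lam * L))) * D by rewrite mulr_ge0 ?subr_ge0.
  have h3 : 0 <= Lam * eps * L * D by rewrite !mulr_ge0.
  have h4 : 0 <= eps * D by rewrite !mulr_ge0.
  lra.
have eps1 : eps <= 1.
  have : 0 <= eps * (Lam * L) by rewrite !mulr_ge0.
  lra.
have P6 : 0 <= Lam * psi * (1 - eps) * (eps^-1 * n - 2 * pw + eps * nw).
  apply: mulr_ge0; first by rewrite !mulr_ge0// subr_ge0.
  have := mulr_ge0 ki Y4.
  congr (0 <= _); have := gt_eqF e0 => en; field; by rewrite en.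
have P6' : 0 <= Lam * psi * (n + eps ^+ 2 * nw).
  by rewrite mulr_ge0 ?mulr_ge0// addr_ge0// mulr_ge0// sqr_ge0.
have P6'' : Lam * psi * (1 - eps) * (eps^-1 * n - 2 * pw + eps * nw) =
   Lam * (psi * eps^-1 * n) - Lam * psi * n - 2 * (Lam * psi * pw)
   + 2 * (Lam * psi * eps * pw) + Lam * psi * eps * nw - Lam * psi * eps ^+ 2 * nw.
  have en : eps != 0 by rewrite gt_eqF.
  by field.
rewrite P6'' in P6.
have P7 := mulr_ge0 tau0 Y5.
have P8 := mulr_ge0 tau0 Y6.
have P9 := mulr_ge0 tau0 Y7.
have P10 : 0 <= (D - eps * tau * d1) * (tau * A).
  by rewrite mulr_ge0 ?subr_ge0// mulr_ge0.
have P12 : 0 <= (Lam * c - 6) * (tau * b) by rewrite mulr_ge0 ?subr_ge0// mulr_ge0.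
clear - P0 P1 P2 P3 P3' P3'' P4 P5 P5' P5'' P11 P6 P6' P7 P8 P9 P10 P12.
lra.
Qed.

End Weighted.
End TruncatedEnergies.

Lemma hder_inv (R : realType) (c : R -> R^o) (t k : R) : 0 <= t ->
  (forall s, 0 <= s -> 0 < c s) -> hder c t k ->
  hder (V := R^o) (fun s => (c s)^-1) t (- k / c t ^+ 2).
Proof.
move=> t0 cp ck; have ct := cp t t0.
have ni : c t != 0 by rewrite gt_eqF.
have h : hder (V := R^o) (fun x => x^-1) (c t) (- (c t) ^- 2).
  apply: is_derive_hder; first exact: ltW.
  have hd := is_deriveV (f := id) ni (is_derive_id (c t : R^o) 1).
  by apply: (is_derive_eq hd); rewrite /GRing.scale/= mulr1.
apply: hder_eq; first apply: (hder_comp t0 _ ck h).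
  by move=> s s0; apply: ltW; exact: cp.
by rewrite /GRing.scale/= mulrN mulNr.
Qed.

Lemma hder_expR (R : realType) (h : R -> R^o) (t k : R) : 0 <= t ->
  (forall s, 0 <= s -> 0 <= h s) -> hder h t k ->
  hder (V := R^o) (fun s => expR (h s)) t (k * expR (h t)).
Proof.
move=> t0 h0 hk; apply: hder_comp => //.
by apply: is_derive_hder; exact: h0.
Qed.

Lemma hder_1D (R : realType) (t : R) : 0 <= t ->
  hder (V := R^o) (fun s => 1 + s) t 1.
Proof.
move=> t0; apply: hder_eq; first by apply: hderD => //; [exact: hder_cst|exact: hder_id].
by rewrite add0r.
Qed.

(** * The initial layer *)

Section InitialLayer.
Variables (R : realType) (eps : R).
Hypothesis eps0 : 0 < eps.

(* [layer t = (1 + t) ^ (- 1 / eps)] *)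
Definition layer (t : R) : R := (expR (eps^-1 * ln (1 + t)))^-1.

Lemma layer0 : layer 0 = 1.
Proof. by rewrite /layer addr0 ln1 mulr0 expR0 invr1. Qed.

Lemma layer_gt0 t : 0 < layer t.
Proof. by rewrite invr_gt0 expR_gt0. Qed.

(** The half-line chain rule requires nonnegative inner functions, which is why the layer is the
    inverse of an exponential with nonnegative exponent. *)
Lemma layer_der t : 0 <= t ->
  hder (V := R^o) layer t (- (layer t / (eps * (1 + t)))).
Proof.
move=> t0; have tau0 (s : R) : 0 <= s -> 0 < 1 + s by move=> s0; rewrite ltr_wpDr.
have ln_ge0' (s : R) : 0 <= s -> 0 <= eps^-1 * ln (1 + s).
  by move=> s0; rewrite mulr_ge0 ?invr_ge0 ?(ltW eps0)// ln_ge0// lerDl.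
have h1 : hder (V := R^o) (fun s => ln (1 + s)) t ((1 + t)^-1).
  apply: hder_eq; first apply: (hder_comp (f := (@ln R : R -> R^o)) t0 _ (hder_1D t0)).
  - by move=> s s0; apply: ltW; exact: tau0.
  - apply: is_derive_hder; first by apply: ltW; exact: tau0.
    by apply: is_derive1_ln; exact: tau0.
  - by rewrite scale1r.
apply: hder_eq.
  apply: (hder_inv t0); first by move=> s _; exact: expR_gt0.
  apply: hder_expR => //.
  by apply: hderM => //; [exact: hder_cst|exact: h1].
rewrite mul0r add0r /layer.
have := expR_gt0 (eps^-1 * ln (1 + t)); move: (expR _) => e e0.
have := tau0 t t0 => tt; field.
by rewrite !gt_eqF.
Qed.

(** The derivative is (k - 1 / eps) (1 + t)^(k - 1) times the layer. The case [k = 0] is separate on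
    account of [k.-1]. *)
Lemma layer_power_le k t : 0 <= t -> k%:R * eps <= 1 ->
  (1 + t) ^+ k * layer t <= 1.
Proof.
move=> t0 ke.
rewrite -[leRHS](_ : (1 + 0) ^+ k * layer 0 = 1); last first.
  by rewrite addr0 expr1n mul1r layer0.
apply: (@hder_nonincreasing R (fun t => (1 + t) ^+ k * layer t) (fun t =>
  k%:R * (1 + t) ^+ k.-1 * layer t - (1 + t) ^+ k * (layer t / (eps * (1 + t))))) => //.
  move=> s /andP[s0 _]; apply: hder_eq.
    by apply: hderM => //; [exact: hderX1|exact: layer_der].
  by rewrite mulrN.
move=> s /andP[s0 _]; have tau0 : 0 < 1 + s by rewrite ltr_wpDr.
case: k ke => [_|k ke].
  by rewrite !mul0r expr0 mul1r sub0r oppr_le0 divr_ge0 ?(ltW (layer_gt0 _))// mulr_ge0// ltW.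
rewrite subr_le0 /= exprSr.
have -> : (1 + s) ^+ k * (1 + s) * (layer s / (eps * (1 + s))) =
   eps^-1 * ((1 + s) ^+ k * layer s).
  by field; rewrite !gt_eqF.
rewrite -mulrA ler_wpM2r ?mulr_ge0 ?exprn_ge0 ?(ltW tau0) ?(ltW (layer_gt0 _))//.
by rewrite -[leRHS]mul1r ler_pdivlMr.
Qed.

Lemma layer_le1 t : 0 <= t -> layer t <= 1.
Proof. by move=> t0; have := @layer_power_le 0 t t0; rewrite mul0r expr0 mul1r; apply. Qed.

(** The difference [z] from the expected solution satisfies z' = - z / (eps (1 + t)) and vanishes at
    0, so |z|^2 cannot grow. *)
Lemma layer_unique (H : completeNormedModType R) (dot : {dot H for (@idfun R)})
    (hdot : induces_norm dot) (w w2 : R -> H) t : 0 <= t ->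
  (forall s, 0 <= s -> hder w s (w2 s)) ->
  (forall s, 0 <= s -> eps *: w2 s + (1 + s)^-1 *: w s = 0) ->
  w t = layer t *: w 0.
Proof.
move=> t0 wd eqw; pose z s := w s - layer s *: w 0.
suff : dot (z t) (z t) <= dot (z 0) (z 0).
  rewrite -!hdot /z layer0 scale1r subrr normr0 expr0n/= => h.
  have : `|w t - layer t *: w 0| ^+ 2 = 0.
    by apply/eqP; rewrite eq_le h sqr_ge0.
  by move/eqP; rewrite sqrf_eq0 normr_eq0 subr_eq0 => /eqP.
have w2E s : 0 <= s -> w2 s = - (eps * (1 + s))^-1 *: w s.
  move=> s0; have tau0 : 1 + s != 0 by rewrite gt_eqF// ltr_wpDr.
  have e0 : eps != 0 by rewrite gt_eqF.
  have := congr1 (fun x => eps^-1 *: x) (eqw s s0).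
  rewrite /= scaler0 scalerDr !scalerA mulVf// scale1r => /eqP; rewrite addr_eq0 => /eqP ->.
  by rewrite scaleNr invfM.
apply: (@hder_nonincreasing R (fun s => dot (z s) (z s))
  (fun s => - (2 / (eps * (1 + s)) * dot (z s) (z s)))) => //.
  move=> s /andP[s0 _].
  have zd : hder z s (- (eps * (1 + s))^-1 *: z s).
    apply: hder_eq.
      apply: hderB => //; first exact: wd.
      by apply: hderZ => //; [exact: layer_der|exact: hder_cst].
    rewrite w2E// scaler0 addr0 /z scalerBr scalerA; congr (_ - _ *: _).
    by rewrite mulNr mulrC.
  apply: hder_eq; first exact: (hder_sqr hdot s0 zd).
  by rewrite dotZr; ring.
move=> s /andP[s0 _]; rewrite oppr_le0 mulr_ge0 ?(dot_ge0 hdot)// divr_ge0//.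
by rewrite mulr_ge0 ?(ltW eps0)// addr_ge0.
Qed.

End InitialLayer.

Lemma derivative_bound_lipschitz (R : realType) (m m1 : R -> R) (K L : R) (x y : R) :
  (forall s, 0 <= s -> hder (V := R^o) m s (m1 s)) ->
  (forall s, 0 <= s <= K -> `|m1 s| <= L) -> 0 <= x <= K -> 0 <= y <= K ->
  `|m x - m y| <= L * `|x - y|.
Proof.
move=> md mL; wlog xy : x y / y <= x.
  move=> H hx hy; have [/H|/ltW/H] := leP y x; first exact.
  by rewrite distrC (distrC y x); apply.
move=> /andP[x0 xK] /andP[y0 yK].
have [] := @MVT_segment R m m1 y x xy.
- move=> z; rewrite in_itv/= => /andP[yz zx]; apply: hder_is_derive.
    exact: le_lt_trans yz.
  by apply: md; apply: ltW; exact: le_lt_trans yz.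
- apply: hcont_within => z /=; rewrite in_itv/= => /andP[yz zx].
    by rewrite in_itv/= andbT (le_trans y0).
  have z0 : 0 <= z by apply: le_trans yz.
  by apply: hder_cont (md z z0).
- move=> c; rewrite in_itv/= => /andP[yc cx] ->; rewrite normrM ler_wpM2r//.
  by apply: mL; rewrite (le_trans y0 yc) (le_trans cx xK).
Qed.

Lemma half_line_bounded (R : realType) (m : R -> R) (K : R) :
  (forall s, 0 <= s -> hcont (V := R^o) m s) ->
  exists L, forall s, 0 <= s <= K -> `|m s| <= L.
Proof.
move=> mc; have [K0|K0] := leP 0 K; last first.
  by exists 0 => s /andP[s0 /(le_trans s0)]; rewrite leNgt K0.
have [] := @EVT_max R (fun s => `|m s|) 0 K K0.
  apply: hcont_within => t /=; rewrite in_itv/= => /andP[t0 _].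
    by rewrite in_itv/= t0.
  by apply: cvg_norm; exact: mc.
by move=> c _ h; exists `|m c| => s sK; apply: h; rewrite in_itv.
Qed.

(** * The singular perturbation problem *)

Lemma cvg_le_cst (R : realType) (f : nat -> R) (l K : R) :
  f n @[n --> \oo] --> l -> (forall n, f n <= K) -> l <= K.
Proof.
move=> fl fK; rewrite -(cvg_lim _ fl)//; apply: limr_le; first exact: cvgP fl.
exact: nearW.
Qed.

Section Kirchhoff.
Variables (R : realType) (H : completeNormedModType R).
Variables (dot : {dot H for (@idfun R)}) (hdot : induces_norm dot).
Variables (D : set H) (A : H -> H) (P B : nat -> H -> H).
Hypothesis AD : forall x y, D x -> D y -> D (x + y) /\ A (x + y) = A x + A y.
Hypothesis AB : forall x y, D x -> D y -> D (x - y) /\ A (x - y) = A x - A y.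
Hypothesis Asym : forall x y, D x -> D y -> dot (A x) y = dot x (A y).
Hypothesis Age0 : forall x, D x -> 0 <= dot (A x) x.
Hypothesis Plin : forall n, linear (P n).
Hypothesis Ple : forall n x, `|P n x| <= `|x|.
Hypothesis Pcvg : forall x, P n x @[n --> \oo] --> x.
Hypothesis Blin : forall n, linear (B n).
Hypothesis Bbd : forall n x, `|B n x| <= n%:R * `|x|.
Hypothesis Bsym : forall n x y, dot (B n x) y = dot x (B n y).
Hypothesis Bge0 : forall n x, 0 <= dot (B n x) x.
Hypothesis PA : forall n x, D x -> P n (A x) = B n (P n x).
Variables (m m1 : R -> R) (mu : R).
Hypothesis mu0 : 0 < mu.
Hypothesis mge : forall s, 0 <= s -> mu <= m s.
Hypothesis md : forall s, 0 <= s -> hder (V := R^o) m s (m1 s).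
Hypothesis m1c : forall s, 0 <= s -> hcont (V := R^o) m1 s.

Lemma hder_P n f t l : 0 <= t -> hder f t l -> hder (fun s => P n (f s)) t (P n l).
Proof.
move=> t0; apply: (@hder_lin _ _ _ _ 1) => // x; by rewrite mul1r.
Qed.

Lemma PD n x y : P n (x + y) = P n x + P n y.
Proof. by have := Plin n 1 x y; rewrite !scale1r. Qed.

Lemma PZ n a x : P n (a *: x) = a *: P n x.
Proof. exact: (scalable_linear (Plin n)). Qed.

Lemma PB n x y : P n (x - y) = P n x - P n y.
Proof. exact: (zmod_morphism_linear (Plin n)). Qed.

Lemma sqr_P_le n x : dot (P n x) (P n x) <= dot x x.
Proof. by rewrite -!hdot ler_sqr ?nnegrE. Qed.

Lemma form_P_cvg x : D x -> dot (B n (P n x)) (P n x) @[n --> \oo] --> (dot (A x) x : R^o).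
Proof.
move=> Dx; have -> : (fun n => dot (B n (P n x)) (P n x)) = (fun n => dot (P n (A x)) (P n x)).
  by apply/funext => n; rewrite PA.
exact: cvg_dot.
Qed.

Lemma sqr_BP_cvg x : D x ->
  dot (B n (P n x)) (B n (P n x)) @[n --> \oo] --> (dot (A x) (A x) : R^o).
Proof.
move=> Dx; have -> : (fun n => dot (B n (P n x)) (B n (P n x))) =
    (fun n => dot (P n (A x)) (P n (A x))).
  by apply/funext => n; rewrite PA.
exact: cvg_dot.
Qed.

Lemma form_P_cvg2 x y : D x ->
  dot (B n (P n x)) (P n y) @[n --> \oo] --> (dot (A x) y : R^o).
Proof.
move=> Dx; have -> : (fun n => dot (B n (P n x)) (P n y)) = (fun n => dot (P n (A x)) (P n y)).
  by apply/funext => n; rewrite PA.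
exact: cvg_dot.
Qed.

(** [A] is controlled only on [D], so the inequality is taken for the everywhere defined forms of
    [B n] and passed to the limit. *)
Lemma form_CS x y : D x -> D y ->
  dot (A x) y ^+ 2 <= dot (A x) x * dot (A y) y.
Proof.
move=> Dx Dy; rewrite -subr_le0.
have cv : dot (B n (P n x)) (P n y) ^+ 2 - dot (B n (P n x)) (P n x) *
    dot (B n (P n y)) (P n y) @[n --> \oo] -->
    dot (A x) y ^+ 2 - dot (A x) x * dot (A y) y.
  apply: cvgB; last by apply: cvgM; exact: form_P_cvg2.
  by apply: (@cvgM _ _ _ _ (fun n => dot (B n (P n x)) (P n y))
    (fun n => dot (B n (P n x)) (P n y))); exact: form_P_cvg2.
apply: (cvg_le_cst cv) => n; rewrite subr_le0.
apply: (@form_Cauchy_Schwarz R H (fun x y => dot (B n x) y)) => //.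
- by move=> a b z; rewrite (BE (Blin n)) dotDl.
- by move=> a b z; rewrite (BE (Blin n)) dotZl.
- by move=> a b; rewrite Bsym dotC.
Qed.

Lemma form_P_le n x : D x -> dot (B n (P n x)) (P n x) <= `|A x| * `|x|.
Proof.
move=> Dx; rewrite -PA//; apply: le_trans (ler_norm _) _.
by apply: le_trans (Cauchy_Schwarz hdot _ _) _; exact: ler_pM.
Qed.

Definition coefficient (v : R -> H) t := m (dot (A (v t)) (v t)).
Definition coefficient' (v v1 : R -> H) t :=
  m1 (dot (A (v t)) (v t)) * (2 * dot (A (v t)) (v1 t)).

Lemma coefficient_der (v v1 : R -> H) t : (forall s, 0 <= s -> D (v s)) ->
  0 <= t -> hcont (fun s => A (v s)) t -> hder v t (v1 t) ->
  hder (V := R^o) (coefficient v) t (coefficient' v v1 t).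
Proof.
move=> Dv t0 Ac vd; apply: hder_eq.
  apply: (hder_comp t0 _ (hder_symmetric_form hdot t0 AD Asym Dv Ac vd)).
    by move=> s s0; apply: Age0; exact: Dv.
  by apply: md; apply: Age0; exact: Dv.
by rewrite /coefficient' [RHS]mulrC.
Qed.

Lemma coefficient'_cont (v v1 : R -> H) t : (forall s, 0 <= s -> D (v s)) ->
  0 <= t -> hcont (fun s => A (v s)) t -> hder v t (v1 t) -> hcont v1 t ->
  hcont (V := R^o) (coefficient' v v1) t.
Proof.
move=> Dv t0 Ac vd v1c; have FF := half_nbhs_filter t0.
apply: cvgM; last by apply: cvgM; [exact: cvg_cst|apply: cvg_dot].
apply: half_cvg_comp (m1c (Age0 (Dv t t0))).
  near=> s; apply: Age0; apply: Dv; near: s; exact: half_nbhs_ge0.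
apply: cvg_dot => //; exact: hder_cont vd.
Unshelve. all: by end_near. Qed.

(** * A priori bounds for the hyperbolic problem *)

Section HyperbolicBounds.
Variables (u0 u1 : H) (C1 K L L' : R).
Hypothesis Du0 : D u0.
Hypothesis hC1 : forall n, dot (B n (P n u1)) (P n u1) <= C1.
Hypothesis hK : dot u1 u1 / mu + `|A u0| * `|u0| <= K.
Hypothesis hL : forall s, 0 <= s <= K -> m s <= L /\ `|m1 s| <= L'.

Let Lam := 6 / mu.
(** Dominates the weighted energy of the truncated data at time 0: [K] its quadratic part, the rest
    the correction. *)
Definition hyperbolic_weighted_bound := K + Lam * (dot u1 u1 + dot u0 u0).
Local Notation PhiK := hyperbolic_weighted_bound.
(** Only data occur here, [K], [L] and [L'] being fixed beforehand, so that one threshold for [eps]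
    serves all solutions. The second clause makes the weighted energy coercive and dissipated. *)
Definition hyperbolic_smallness (eps : R) :=
  [/\ 0 < eps, eps * (8 * (1 + Lam * L)) <= 1,
      eps * `|m1 (dot (A u0) u0) * (2 * dot (A u0) u1)| < mu &
      eps * (8 * L' ^+ 2 * (C1 / mu + dot (A u0) (A u0)) * PhiK * L) < mu ^+ 2].

Variables (eps : R) (v v1 v2 : R -> H).
Hypothesis heps : hyperbolic_smallness eps.
Hypothesis Dv : forall t, 0 <= t -> D (v t).
Hypothesis Avc : forall t, 0 <= t -> hcont (fun s => A (v s)) t.
Hypothesis vd : forall t, 0 <= t -> hder v t (v1 t).
Hypothesis v1d : forall t, 0 <= t -> hder v1 t (v2 t).
Hypothesis eqv : forall t, 0 <= t ->
  eps *: v2 t + (1 + t)^-1 *: v1 t + coefficient v t *: A (v t) = 0.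
Hypotheses (v0 : v 0 = u0) (v10 : v1 0 = u1).

Let c := coefficient v.
Let c1 := coefficient' v v1.

Lemma hyperbolic_truncated n t : 0 <= t -> (eps * (1 + t)) *: P n (v2 t) =
  - P n (v1 t) - ((1 + t) * c t) *: B n (P n (v t)).
Proof.
move=> t0; have tau0 : 1 + t != 0 by rewrite gt_eqF// ltr_wpDr.
have := congr1 (fun x => P n ((1 + t) *: x)) (eqv t0).
rewrite /= scaler0 !scalerDr !PD !PZ !scalerA mulfV// scale1r PA//; last exact: Dv.
rewrite (linear_map0 (Plin n)) => /eqP; rewrite addrC addr_eq0 -/c => /eqP e.
by rewrite e opprK addrCA addNr addr0 [eps * _]mulrC.
Qed.

Lemma dom_v_ge0 t : 0 <= t -> 0 <= dot (A (v t)) (v t).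
Proof. by move=> t0; apply: Age0; exact: Dv. Qed.

Lemma c_ge t : 0 <= t -> mu <= c t.
Proof. by move=> t0; apply: mge; exact: dom_v_ge0. Qed.

Lemma c_gt0 t : 0 <= t -> 0 < c t.
Proof. by move=> t0; apply: lt_le_trans (c_ge t0). Qed.

Lemma c_der t : 0 <= t -> hder (V := R^o) c t (c1 t).
Proof. by move=> t0; apply: coefficient_der => //; [exact: Avc|exact: vd]. Qed.

Lemma inv_c_der t : 0 <= t ->
  hder (V := R^o) (fun s => (c s)^-1) t (- c1 t / c t ^+ 2).
Proof. by move=> t0; apply: hder_inv => //; [exact: c_gt0|exact: c_der]. Qed.

Lemma inv_c_der_le t : 0 <= t -> eps * (1 + t) * `|c1 t| <= mu ->
  eps * (1 + t) * (- c1 t / c t ^+ 2) <= (c t)^-1.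
Proof.
move=> t0 h; have c0 := c_gt0 t0; have [e0 _ _ _] := heps.
rewrite mulrA ler_pdivrMr ?exprn_gt0// expr2 mulKf ?gt_eqF//.
apply: le_trans (c_ge t0); apply: le_trans h.
rewrite ler_wpM2l ?mulr_ge0 ?(ltW e0) ?addr_ge0//.
by rewrite -normrN ler_norm.
Qed.

Lemma L_ge0 : 0 <= L.
Proof.
have [|mL _] := hL (s := 0).
  rewrite lexx; apply: le_trans hK; rewrite addr_ge0//.
  by rewrite divr_ge0 ?(dot_ge0 hdot)// ltW.
by apply: le_trans mL; apply: le_trans (mge _) => //; exact: ltW.
Qed.

Lemma Lam_ge0 : 0 <= Lam.
Proof. by rewrite mulr_ge0// invr_ge0 ltW. Qed.

Lemma eps_gt0 : 0 < eps. Proof. by case: heps. Qed.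

Lemma eps_le1 : eps <= 1.
Proof.
have [e0 eL _ _] := heps.
have : 0 <= eps * (Lam * L).
  by rewrite mulr_ge0 ?(ltW e0)// mulr_ge0 ?Lam_ge0 ?L_ge0.
lra.
Qed.

Lemma kinetic_le a X : 0 <= a -> a <= X -> eps * ((c 0)^-1 * a) <= X / mu.
Proof.
move=> a0 aX; have c0 := c_gt0 (lexx 0).
apply: (@le_trans _ _ ((c 0)^-1 * a)).
  by rewrite ler_piMl ?eps_le1// mulr_ge0// invr_ge0 ltW.
by rewrite mulrC ler_pM// ?invr_ge0 ?(ltW c0)// lef_pV2 ?posrE// c_ge.
Qed.

(* The bootstrap assumption [hT] holds at time [0] by the third clause of
   [hyperbolic_smallness], and the fourth one makes it strict. *)
Section UpTo.
Variable T : R.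
Hypothesis hT : forall t, 0 <= t <= T -> eps * (1 + t) * `|c1 t| <= mu.

Lemma form_le_K t : 0 <= t <= T -> dot (A (v t)) (v t) <= K.
Proof.
move=> /andP[t0 tT]; apply: (cvg_le_cst (form_P_cvg (Dv t0))) => n.
have h : hyperbolic_energy0 dot (B n) (P n \o v) (P n \o v1)
    (fun s => (c s)^-1) eps t <=
  hyperbolic_energy0 dot (B n) (P n \o v) (P n \o v1) (fun s => (c s)^-1) eps 0.
  apply: (hyperbolic_energy0_le hdot (Blin n) (Bbd n) (Bsym n)
    (v2 := P n \o v2) (c := c) (d1 := fun s => - c1 s / c s ^+ 2) mu0 eps_gt0 c_ge) => //.
  - by move=> s s0; rewrite divff// gt_eqF// c_gt0.
  - exact: inv_c_der.
  - move=> s /andP[s0 st]; apply: inv_c_der_le => //; apply: hT.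
    by rewrite s0 (le_trans st).
  - by move=> s s0; apply: hder_P => //; exact: vd.
  - by move=> s s0; apply: hder_P => //; exact: v1d.
  - by move=> s s0; exact: hyperbolic_truncated.
apply: le_trans (_ : _ <= hyperbolic_energy0 dot (B n) (P n \o v) (P n \o v1)
    (fun s => (c s)^-1) eps t) _.
  rewrite /hyperbolic_energy0/= lerDr mulr_ge0 ?(ltW eps_gt0)//.
  by rewrite mulr_ge0 ?(dot_ge0 hdot)// invr_ge0 ltW// c_gt0.
apply: le_trans h _; apply: le_trans hK.
rewrite /hyperbolic_energy0/= v0 v10; apply: lerD; last exact: form_P_le.
by apply: kinetic_le; [exact: dot_ge0|exact: sqr_P_le].
Qed.

Lemma sqrA_le t : 0 <= t <= T ->
  dot (A (v t)) (A (v t)) <= C1 / mu + dot (A u0) (A u0).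
Proof.
move=> /andP[t0 tT]; apply: (cvg_le_cst (sqr_BP_cvg (Dv t0))) => n.
have h : hyperbolic_energy1 dot (B n) (P n \o v) (P n \o v1)
    (fun s => (c s)^-1) eps t <=
  hyperbolic_energy1 dot (B n) (P n \o v) (P n \o v1) (fun s => (c s)^-1) eps 0.
  apply: (hyperbolic_energy1_le hdot (Blin n) (Bbd n) (Bsym n) (Bge0 n)
    (v2 := P n \o v2) (c := c) (d1 := fun s => - c1 s / c s ^+ 2) mu0 eps_gt0 c_ge) => //.
  - by move=> s s0; rewrite divff// gt_eqF// c_gt0.
  - exact: inv_c_der.
  - move=> s /andP[s0 st]; apply: inv_c_der_le => //; apply: hT.
    by rewrite s0 (le_trans st).
  - by move=> s s0; apply: hder_P => //; exact: vd.
  - by move=> s s0; apply: hder_P => //; exact: v1d.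
  - by move=> s s0; exact: hyperbolic_truncated.
apply: le_trans (_ : _ <= hyperbolic_energy1 dot (B n) (P n \o v) (P n \o v1)
    (fun s => (c s)^-1) eps t) _.
  rewrite /hyperbolic_energy1/= lerDr mulr_ge0 ?(ltW eps_gt0)//.
  by rewrite mulr_ge0// invr_ge0 ltW// c_gt0.
apply: le_trans h _.
rewrite /hyperbolic_energy1/= v0 v10; apply: lerD; first exact: kinetic_le.
by rewrite -PA//; exact: sqr_P_le.
Qed.

Lemma c_le_L t : 0 <= t <= T -> c t <= L.
Proof.
move=> tT; have /andP[t0 _] := tT.
by have [] := hL (s := dot (A (v t)) (v t)); rewrite ?dom_v_ge0 ?form_le_K.
Qed.

(** The homogeneous case of [weighted_energy_der], with v and v' as rho and r: the weighted energy
    does not increase, and its lower bound gives the decay. *)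
Lemma weighted_le t : 0 <= t <= T ->
  (1 + t) ^+ 2 * (eps * ((c t)^-1 * dot (v1 t) (v1 t)) + dot (A (v t)) (v t))
    <= 2 * PhiK.
Proof.
move=> tT; have /andP[t0 _] := tT; have [e0 eL _ _] := heps.
have cd s : 0 <= s -> c s * (c s)^-1 = 1.
  by move=> s0; rewrite divff// gt_eqF// c_gt0.
have cv : (1 + t) ^+ 2 * (eps * ((c t)^-1 * dot (P n (v1 t)) (P n (v1 t)))
    + dot (B n (P n (v t))) (P n (v t))) @[n --> \oo] -->
  (1 + t) ^+ 2 * (eps * ((c t)^-1 * dot (v1 t) (v1 t)) + dot (A (v t)) (v t)).
  apply: cvgM; first exact: cvg_cst.
  apply: cvgD; last exact: form_P_cvg (Dv t0).
  apply: cvgM; first exact: cvg_cst.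
  by apply: cvgM; [exact: cvg_cst|exact: cvg_dot].
apply: (cvg_le_cst cv) => n.
have ge s : 0 <= s <= T -> 2^-1 * ((1 + s) ^+ 2 * (eps * ((c s)^-1 *
     dot (P n (v1 s)) (P n (v1 s))) + dot (B n (P n (v s))) (P n (v s)))) +
   Lam / 8 * dot (P n (v s)) (P n (v s)) <=
   weighted_energy dot (B n) Lam eps (c s)^-1 (1 + s) (P n (v1 s)) (P n (v s)).
  move=> sT; have /andP[s0 _] := sT.
  apply: (weighted_energy_ge hdot (Bge0 n) _ _ mu0 e0 _ (cd s s0)) eL _.
  - by rewrite c_ge// c_le_L.
  - exact: Lam_ge0.
  - by rewrite lerDl.
have le : weighted_energy dot (B n) Lam eps (c t)^-1 (1 + t) (P n (v1 t)) (P n (v t))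
  <= weighted_energy dot (B n) Lam eps (c 0)^-1 (1 + 0) (P n (v1 0)) (P n (v 0)).
  have /choice[dU hU] : forall s, exists dU, 0 <= s <= T ->
    hder (V := R^o) (fun s => weighted_energy dot (B n) Lam eps (c s)^-1 (1 + s)
      (P n (v1 s)) (P n (v s))) s dU /\ dU <= 0.
    move=> s; have [sT|_] := boolP (0 <= s <= T); last by exists 0.
    have /andP[s0 _] := sT.
    have [|||||||||d dd dle] := @weighted_energy_der R H dot hdot (B n) n%:R (Blin n) (Bbd n)
      (Bsym n) (Bge0 n) Lam eps (P n \o v) (P n \o v1) (fun s => (c s)^-1) mu L (c s)
      (- c1 s / c s ^+ 2) 0 0 0 0 s (P n (v2 s)) 0 0 0 mu0 e0 erefl eL s0.
    - by rewrite c_ge// c_le_L.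
    - exact: cd.
    - by apply: inv_c_der_le => //; exact: hT.
    - by rewrite lexx ler01.
    - by rewrite scaler0 addr0; apply: hder_P => //; exact: vd.
    - by apply: hder_P => //; exact: v1d.
    - exact: inv_c_der.
    - by rewrite scaler0 subr0; exact: hyperbolic_truncated.
    - by rewrite !(linear_map0 (Blin n)) !scaler0 addr0.
    exists d => _; split => //; apply: le_trans dle _.
    rewrite mul0r mul0r addr0 /weighted_error !(linear_map0 (Blin n)) !(dot0l, dot0r).
    rewrite !(mulr0, mul0r, addr0) oppr_le0 addr_ge0// mulr_ge0//.
    + by rewrite addr_ge0.
    + by rewrite divr_ge0// invr_ge0 ltW// c_gt0.
    + by rewrite mulr_ge0 ?(dot_ge0 hdot)// addr_ge0.
  apply: (@hder_nonincreasing R (fun s => weighted_energy dot (B n) Lam eps (c s)^-1 (1 + s)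
      (P n (v1 s)) (P n (v s))) dU t t0) => s /andP[s0 st].
    by case: (hU s); rewrite ?s0 ?(le_trans st)//; case/andP: tT.
  by case: (hU s); rewrite ?s0 ?(le_trans st)//; case/andP: tT.
have h0 : weighted_energy dot (B n) Lam eps (c 0)^-1 (1 + 0) (P n (v1 0)) (P n (v 0))
    <= PhiK.
  rewrite /weighted_energy /PhiK addr0 expr1n mul1r mulr1 v0 v10.
  apply: lerD.
    apply: le_trans hK; apply: lerD; last exact: form_P_le.
    by apply: kinetic_le; [exact: dot_ge0|exact: sqr_P_le].
  rewrite ler_wpM2l ?Lam_ge0//.
  have := sqr_P_le n u1; have := sqr_P_le n u0.
  have := dot_ge0 hdot (P n u1); have := dot_ge0 hdot (P n u0).
  have := dot_ge0 hdot (P n u1 - P n u0); rewrite !dotE (dotC _ (P n u0) (P n u1)).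
  move: (dot (P n u1) (P n u1)) (dot (P n u0) (P n u0)) (dot (P n u1) (P n u0)).
  move=> x y z xyz y0 x0 yu xu.
  have e1 := eps_le1.
  have k1 := mulr_ge0 (ltW e0) xyz.
  have k2 : 0 <= (1 - eps) * x by rewrite mulr_ge0// subr_ge0.
  lra.
have := ge t tT; have := dot_ge0 hdot (P n (v t)); have := Lam_ge0.
move=> l0 n0; have : 0 <= Lam / 8 * dot (P n (v t)) (P n (v t)).
  by rewrite mulr_ge0// divr_ge0.
lra.
Qed.

(** Since c' = 2 m' <A v, v'>, the square of eps tau c' is eps times 4 m'^2 eps tau^2 <A v, v'>^2.
    [sqrA_le] bounds |A v|^2 and [weighted_le] bounds eps tau^2 |v'|^2; the spare factor eps makes
    the inequality strict. *)
Lemma sqr_c1_lt t : 0 <= t <= T -> eps * (1 + t) * `|c1 t| < mu.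
Proof.
move=> tT; have /andP[t0 _] := tT; have [e0 _ _ smallness] := heps.
have c0 := c_gt0 t0; have cL := c_le_L tT.
have h1 := sqrA_le tT; have h2 := weighted_le tT.
have [|_ h3] := hL (s := dot (A (v t)) (v t)); first by rewrite dom_v_ge0 ?form_le_K.
have L0 := L_ge0.
have tau0 : 0 <= 1 + t by rewrite addr_ge0.
have e3 : 0 <= (1 + t) ^+ 2 * dot (A (v t)) (v t).
  by rewrite mulr_ge0 ?sqr_ge0// dom_v_ge0.
have h4 : eps * (1 + t) ^+ 2 * dot (v1 t) (v1 t) <= 2 * PhiK * L.
  have : (1 + t) ^+ 2 * (eps * ((c t)^-1 * dot (v1 t) (v1 t))) <= 2 * PhiK by lra.
  move=> h; apply: (@le_trans _ _ (2 * PhiK * c t)); last first.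
    rewrite ler_wpM2l//; apply: le_trans h.
    by rewrite mulr_ge0 ?sqr_ge0// mulr_ge0 ?(ltW e0)// mulr_ge0 ?(dot_ge0 hdot)// invr_ge0 ltW.
  rewrite -ler_pdivrMr//; apply: le_trans h; rewrite le_eqVlt; apply/orP; left.
  by apply/eqP; ring.
have mu0' := mu0.
rewrite -(@ltr_pXn2r _ 2) ?nnegrE ?(ltW mu0)// ?mulr_ge0 ?(ltW e0)//.
apply: le_lt_trans smallness.
rewrite /c1 /coefficient' normrM normrM.
have CS : `|dot (A (v t)) (v1 t)| ^+ 2 <= dot (A (v t)) (A (v t)) * dot (v1 t) (v1 t).
  rewrite -!hdot -exprMn ler_sqr ?nnegrE ?mulr_ge0//; exact: Cauchy_Schwarz.
rewrite (_ : (_ * _) ^+ 2 = eps * (4 * `|m1 (dot (A (v t)) (v t))| ^+ 2 *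
   (eps * (1 + t) ^+ 2 * `|dot (A (v t)) (v1 t)| ^+ 2))); last first.
  by rewrite (ger0_norm (ler0n _ 2)); ring.
rewrite ler_wpM2l ?(ltW e0)//.
have l3 : `|m1 (dot (A (v t)) (v t))| ^+ 2 <= L' ^+ 2.
  by rewrite ler_sqr ?nnegrE//; apply: le_trans h3.
have l4 : eps * (1 + t) ^+ 2 * `|dot (A (v t)) (v1 t)| ^+ 2 <=
    (C1 / mu + dot (A u0) (A u0)) * (2 * PhiK * L).
  apply: (@le_trans _ _ (dot (A (v t)) (A (v t)) * (eps * (1 + t) ^+ 2 * dot (v1 t) (v1 t)))).
    by rewrite [X in _ <= X]mulrCA ler_wpM2l// mulr_ge0 ?(ltW e0)// sqr_ge0.
  apply: ler_pM => //; first exact: dot_ge0.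
  by rewrite mulr_ge0 ?(dot_ge0 hdot)// mulr_ge0 ?(ltW e0)// sqr_ge0.
apply: (@le_trans _ _ (4 * L' ^+ 2 * ((C1 / mu + dot (A u0) (A u0)) * (2 * PhiK * L)))).
  apply: ler_pM => //.
  - by rewrite mulr_ge0 ?sqr_ge0// mulr_ge0 ?(ltW e0)// sqr_ge0.
  - by rewrite ler_wpM2l.
by rewrite le_eqVlt; apply/orP; left; apply/eqP; ring.
Qed.

End UpTo.

Lemma hyperbolic_bounds t : 0 <= t ->
  [/\ mu <= c t <= L, eps * (1 + t) * `|c1 t| <= mu,
      dot (A (v t)) (v t) <= K &
      (1 + t) ^+ 2 * dot (A (v t)) (v t) <= 2 * PhiK].
Proof.
have small : forall s, 0 <= s -> eps * (1 + s) * `|c1 s| < mu.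
  apply: (@continuity_bootstrap R (fun s => eps * (1 + s) * `|c1 s|)).
  - move=> s s0; have FF := half_nbhs_filter s0.
    apply: cvgM.
      apply: cvgM; first exact: cvg_cst.
      by apply: cvgD; [exact: cvg_cst|exact: cvg_id_half].
    apply: cvg_norm; apply: coefficient'_cont => //; [exact: Avc|exact: vd|].
    exact: hder_cont (v1d s0).
  - have [_ _ h _] := heps; rewrite addr0 mulr1 /c1 /coefficient' v0 v10.
    exact: h.
  - by move=> T T0 hT; apply: (sqr_c1_lt hT); rewrite T0 lexx.
have hT s : 0 <= s <= t -> eps * (1 + s) * `|c1 s| <= mu.
  by move=> /andP[s0 _]; apply: ltW; exact: small.
move=> t0; have tt : 0 <= t <= t by rewrite t0 lexx.
split.
- by rewrite c_ge// (c_le_L hT).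
- exact: hT.
- exact: (form_le_K hT).
- apply: le_trans (weighted_le hT tt).
  rewrite ler_wpM2l ?sqr_ge0// lerDr mulr_ge0 ?(ltW eps_gt0)//.
  by rewrite mulr_ge0 ?(dot_ge0 hdot)// invr_ge0 ltW// c_gt0.
Qed.

(** * Comparison with the parabolic solution *)

Section Error.
Variables (C3 : R) (u : R -> H).
Hypothesis hC3 : forall n, dot (B n (P n (A u0))) (P n (A u0)) <= C3.
Hypothesis Du : forall t, 0 <= t -> D (u t).
Hypothesis Auc : forall t, 0 <= t -> hcont (fun s => A (u s)) t.
Hypothesis ud : forall t, 0 <= t ->
  hder u t (- ((1 + t) * coefficient u t) *: A (u t)).
Hypothesis uu0 : u 0 = u0.

Let c0 := coefficient u.
Let c01 := coefficient' u (fun t => - ((1 + t) * coefficient u t) *: A (u t)).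
(** The coefficient of tau^2 <B x, x> in [parabolic_energy]. *)
Let kap := (2 * (4 / mu) + 1) / mu.

Definition parabolic_bound := C3 + 4 / mu * dot (A u0) (A u0)
  + kap * (`|A u0| * `|u0|) + (kap + 1) / mu * dot u0 u0.
Local Notation Ubar := parabolic_bound.
Hypothesis hK' : Ubar / kap <= K.

Lemma kap_gt0 : 0 < kap.
Proof.
have : 0 < 4 / mu by rewrite divr_gt0.
by move=> h; rewrite divr_gt0//; lra.
Qed.

Lemma dom_u_ge0 t : 0 <= t -> 0 <= dot (A (u t)) (u t).
Proof. by move=> t0; apply: Age0; exact: Du. Qed.

Lemma c0_ge t : 0 <= t -> mu <= c0 t.
Proof. by move=> t0; apply: mge; exact: dom_u_ge0. Qed.

Lemma u_truncated_der n t : 0 <= t ->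
  hder (P n \o u) t (- ((1 + t) * c0 t) *: B n ((P n \o u) t)).
Proof.
move=> t0; apply: hder_eq; first exact: (hder_P n t0 (ud t0)).
by rewrite PZ PA//; exact: Du.
Qed.

Lemma parabolic_energy_bound n t : 0 <= t ->
  parabolic_energy dot (B n) mu (P n (u t)) (1 + t) <= Ubar.
Proof.
move=> t0; apply: le_trans (parabolic_energy_le hdot (Blin n) (Bbd n) (Bsym n)
  (Bge0 n) mu0 c0_ge (@u_truncated_der n) t0) _.
rewrite /parabolic_energy /parabolic_bound /= uu0 !expr1n !mul1r -PA//.
have k0 := kap_gt0.
apply: lerD; first apply: lerD; first apply: lerD.
- exact: hC3.
- by rewrite ler_wpM2l ?sqr_P_le// divr_ge0// ltW.
- by rewrite PA// ler_wpM2l ?(ltW k0)//; exact: form_P_le.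
- by rewrite ler_wpM2l ?sqr_P_le// divr_ge0 ?(ltW mu0)// addr_ge0// ltW.
Qed.

Lemma parabolic_energy_ge n t x : 0 <= t ->
  [/\ 0 <= parabolic_energy dot (B n) mu x (1 + t),
      (1 + t) ^+ 2 * dot (B n x) x <=
        parabolic_energy dot (B n) mu x (1 + t) / kap &
      (1 + t) ^+ 4 * dot (B n x) (B n x) <=
        mu / 4 * parabolic_energy dot (B n) mu x (1 + t)].
Proof.
move=> t0; have tau0 : 0 <= 1 + t by rewrite addr_ge0.
have k0 := kap_gt0; rewrite /parabolic_energy -/kap.
have h3 : 0 <= (1 + t) ^+ 6 * dot (B n (B n x)) (B n x).
  by rewrite mulr_ge0// exprn_ge0.
have h2 : 0 <= (1 + t) ^+ 4 * dot (B n x) (B n x).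
  by rewrite mulr_ge0 ?(dot_ge0 hdot)// exprn_ge0.
have h1 : 0 <= (1 + t) ^+ 2 * dot (B n x) x.
  by rewrite mulr_ge0// exprn_ge0.
have h0 : 0 <= (kap + 1) / mu * dot x x.
  by rewrite mulr_ge0 ?(dot_ge0 hdot)// divr_ge0 ?(ltW mu0)// addr_ge0// ltW.
move: ((1 + t) ^+ 6 * _) ((1 + t) ^+ 4 * _) ((1 + t) ^+ 2 * _) ((kap + 1) / mu * _)
  h3 h2 h1 h0 => F3 F2 F1 F0 h3 h2 h1 h0.
have h2' : 0 <= 4 / mu * F2 by rewrite mulr_ge0// divr_ge0// ltW.
have h1' : 0 <= kap * F1 by rewrite mulr_ge0// ltW.
split; first by rewrite !addr_ge0.
  by rewrite ler_pdivlMr//; lra.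
rewrite [leLHS](_ : F2 = mu / 4 * (4 / mu * F2)); last by field; rewrite gt_eqF.
by rewrite ler_wpM2l ?divr_ge0 ?(ltW mu0)//; lra.
Qed.

Lemma Ubar_ge0 : 0 <= Ubar.
Proof.
have [h _ _] := parabolic_energy_ge 0 (P 0 (u 0)) (lexx 0).
exact: le_trans h (parabolic_energy_bound 0 (lexx 0)).
Qed.

Lemma truncated_u_le n t : 0 <= t ->
  (1 + t) ^+ 2 * dot (B n (P n (u t))) (P n (u t)) <= Ubar / kap /\
  (1 + t) ^+ 4 * dot (B n (P n (u t))) (B n (P n (u t))) <= mu / 4 * Ubar.
Proof.
move=> t0; have [_ h1 h2] := parabolic_energy_ge n (P n (u t)) t0.
have h := parabolic_energy_bound n t0.
have k0 := kap_gt0; split.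
  by apply: le_trans h1 _; rewrite ler_wpM2r// invr_ge0 ltW.
by apply: le_trans h2 _; rewrite ler_wpM2l// divr_ge0// ltW.
Qed.

Lemma form_u_le t : 0 <= t ->
  (1 + t) ^+ 2 * dot (A (u t)) (u t) <= Ubar / kap.
Proof.
move=> t0; have cv : (1 + t) ^+ 2 * dot (B n (P n (u t))) (P n (u t)) @[n --> \oo]
    --> (1 + t) ^+ 2 * dot (A (u t)) (u t).
  by apply: cvgM; [exact: cvg_cst|exact: form_P_cvg (Du t0)].
by apply: (cvg_le_cst cv) => n; have [] := truncated_u_le n t0.
Qed.

Lemma sqrA_u_le t : 0 <= t ->
  (1 + t) ^+ 4 * dot (A (u t)) (A (u t)) <= mu / 4 * Ubar.
Proof.
move=> t0; have cv : (1 + t) ^+ 4 * dot (B n (P n (u t))) (B n (P n (u t))) @[n --> \oo]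
    --> (1 + t) ^+ 4 * dot (A (u t)) (A (u t)).
  by apply: cvgM; [exact: cvg_cst|exact: sqr_BP_cvg (Du t0)].
by apply: (cvg_le_cst cv) => n; have [] := truncated_u_le n t0.
Qed.

Lemma form_u_le_K t : 0 <= t -> dot (A (u t)) (u t) <= K.
Proof.
move=> t0; apply: le_trans hK'; apply: le_trans (form_u_le t0).
by rewrite ler_peMl ?dom_u_ge0// exprn_ege1// lerDl.
Qed.

Lemma c0_le t : 0 <= t -> c0 t <= L.
Proof.
by move=> t0; have [] := hL (s := dot (A (u t)) (u t));
  rewrite ?dom_u_ge0 ?form_u_le_K.
Qed.

Definition drift_bound := L + L' * L * (mu * Ubar) / 2.
Local Notation S := drift_bound.
(** The derivative of (1 + t) c0, which enters u''. By the equation (1 + t) c0' is - 2 m' c0 (1 +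
    t)^2 |A u|^2, so the parabolic decay bounds it. *)
Let sig t := c0 t + (1 + t) * c01 t.

Lemma sig_le t : 0 <= t -> sig t ^+ 2 <= S ^+ 2.
Proof.
move=> t0; have tau1 : 1 <= 1 + t by rewrite lerDl.
have tau0 : 0 <= 1 + t by rewrite addr_ge0.
have c0p : 0 <= c0 t by apply: le_trans (c0_ge t0); exact: ltW.
have c0L := c0_le t0.
suff : `|sig t| <= S.
  move=> h; rewrite -(ger0_norm (sqr_ge0 (sig t))) normrX ler_sqr ?nnegrE//.
  exact: le_trans h.
apply: le_trans (ler_normD _ _) _; apply: lerD; first by rewrite ger0_norm.
have [|_ hm] := hL (s := dot (A (u t)) (u t)).
  by rewrite dom_u_ge0 ?form_u_le_K.
rewrite /c01 /coefficient' dotZr -/c0.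
rewrite (_ : (1 + t) * _ = m1 (dot (A (u t)) (u t)) * (- (2 * c0 t *
  ((1 + t) ^+ 2 * dot (A (u t)) (A (u t)))))); last by ring.
rewrite normrM normrN (_ : L' * L * (mu * Ubar) / 2 = L' * (L * (mu * Ubar) / 2));
  last by ring.
apply: ler_pM => //.
have a0 := dot_ge0 hdot (A (u t)).
have h2 : (1 + t) ^+ 2 * dot (A (u t)) (A (u t)) <= mu / 4 * Ubar.
  apply: le_trans (sqrA_u_le t0); rewrite ler_wpM2r//.
  by rewrite ler_weXn2l.
have h20 : 0 <= (1 + t) ^+ 2 * dot (A (u t)) (A (u t)).
  by rewrite mulr_ge0// exprn_ge0.
rewrite ger0_norm; last by rewrite !mulr_ge0.
apply: (@le_trans _ _ (2 * (L * (mu / 4 * Ubar)))).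
  by rewrite -mulrA ler_wpM2l//; apply: ler_pM.
by rewrite le_eqVlt; apply/orP; left; apply/eqP; field.
Qed.

Let w0 := u1 + c0 0 *: A u0.

Definition layer_bound := 2 * C1 + 2 * (L ^+ 2 * C3) + Lam * dot w0 w0.
Local Notation Wbar := layer_bound.

(** Here the regularity of both data meets: [u1] and [A u0] have finite form, hence so does the
    initial velocity of the corrector. *)
Lemma form_w0_le n : dot (B n (P n w0)) (P n w0) <= 2 * C1 + 2 * (L ^+ 2 * C3).
Proof.
have h1 := hC1 n; have h3 := hC3 n.
have := Bge0 n (P n u1 - c0 0 *: P n (A u0)).
have := Bge0 n (P n (A u0)).
rewrite /w0 PD PZ !(BE (Blin n)) !dotE.
move: (dot (B n (P n u1)) (P n u1)) (dot (B n (P n (A u0))) (P n (A u0)))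
 (dot (B n (P n u1)) (P n (A u0))) (dot (B n (P n (A u0))) (P n u1)) h1 h3.
move=> a b x y h1 h3 b0 h.
have c0p : 0 <= c0 0 by apply: le_trans (c0_ge (lexx 0)); exact: ltW.
have c0L : c0 0 ^+ 2 * b <= L ^+ 2 * C3.
  apply: ler_pM => //; first exact: sqr_ge0.
  by rewrite ler_sqr ?nnegrE ?L_ge0// c0_le.
lra.
Qed.

Let rho n t := P n (v t) - P n (u t).
(** [r] truncates the derivative of u_eps - u - theta, not that function: u' and theta' are replaced
    by their explicit expressions. *)
Let r n t := P n (v1 t) + ((1 + t) * c0 t) *: B n (P n (u t))
  - layer eps t *: P n w0.
Let s t := dot (A (v t - u t)) (v t - u t).

Lemma s_ge0 t : 0 <= t -> 0 <= s t.
Proof. by move=> t0; apply: Age0; have [] := AB (Dv t0) (Du t0). Qed.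

Definition coupling_bound :=
  L' ^+ 2 * (2 * (2 * PhiK + Ubar / kap)) * (4 * Ubar + Lam ^+ 2 / 4 * (Ubar / kap)).
Local Notation Cd := coupling_bound.

(** The difference of the two forms is <A (v + u), v - u>. Cauchy-Schwarz for the form of [A] bounds
    its square by <A (v + u), v + u> times [s t], and the first factor decays like (1 + t)^(-2) by
    the bounds on both solutions. *)
Lemma sqr_coefficient_diff t : 0 <= t -> (c t - c0 t) ^+ 2 <=
  L' ^+ 2 * (2 * (2 * PhiK + Ubar / kap)) * (s t / (1 + t) ^+ 2).
Proof.
move=> t0; have [_ _ vK vPhi] := hyperbolic_bounds t0.
have uPhi := form_u_le t0; have uK := form_u_le_K t0.
have tau0 : 0 < (1 + t) ^+ 2 by rewrite exprn_gt0// ltr_wpDr.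
set X := dot (A (v t)) (v t) in vK vPhi; set Y := dot (A (u t)) (u t) in uPhi uK.
have X0 : 0 <= X by exact: dom_v_ge0.
have Y0 : 0 <= Y by exact: dom_u_ge0.
have lip : `|c t - c0 t| <= L' * `|X - Y|.
  rewrite /c /c0 /coefficient -/X -/Y.
  apply: (derivative_bound_lipschitz (m1 := m1) (K := K)) => //.
  - by move=> z /hL[].
  - by rewrite X0 vK.
  - by rewrite Y0 uK.
have L'0 : 0 <= L'.
  by have [|_] := hL (s := X); [rewrite X0 vK|exact: le_trans].
have form : (X - Y) ^+ 2 <= 2 * (X + Y) * s t.
  have [Dp Ap] := AD (Dv t0) (Du t0); have [Dm Am] := AB (Dv t0) (Du t0).
  have Buv : dot (A (u t)) (v t) = dot (A (v t)) (u t).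
    by rewrite Asym ?(dotC _ (u t))//; [exact: Du|exact: Dv].
  have := form_CS Dp Dm; have := s_ge0 t0.
  rewrite /s Ap Am !dotE Buv -/X -/Y.
  move: (dot (A (v t)) (u t)) => z.
  have -> : X - z + (z - Y) = X - Y by ring.
  move=> h /le_trans; apply; rewrite ler_wpM2r//; lra.
have s0 := s_ge0 t0.
rewrite -(ger0_norm (sqr_ge0 (c t - c0 t))) normrX.
apply: (@le_trans _ _ ((L' * `|X - Y|) ^+ 2)); first by rewrite ler_sqr ?nnegrE// mulr_ge0.
rewrite exprMn -normrX (ger0_norm (sqr_ge0 _)) -mulrA ler_wpM2l ?sqr_ge0//.
apply: le_trans form _; rewrite [leRHS]mulrCA [leRHS]mulrC ler_wpM2r//.
by rewrite ler_pdivlMr//; lra.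
Qed.

(** One power of [mu] in the second denominator comes from 1 / c <= 1 / mu, the other offsets the
    factor [mu] in [parabolic_dissipation]. *)
Definition source_bound := 16 * S ^+ 2 / mu + 8 * L ^+ 4 / mu ^+ 2
  + Lam ^+ 2 / 4 * (S ^+ 2 + L ^+ 4).
Local Notation Cb := source_bound.

Lemma weighted_error_le n t : 0 <= t ->
  weighted_error dot (B n) Lam eps (c t)^-1 (1 + t) (layer eps t)
    (c t - c0 t) (sig t) (c0 t) (P n (u t)) (P n w0) <=
  Cd * (s t / (1 + t) ^+ 3)
  + eps ^+ 2 * (Cb * parabolic_dissipation dot (B n) mu (P n (u t)) (1 + t))
  + eps * layer eps t * ((1 + t) ^+ 2 * Wbar).
Proof.
move=> t0; have tau1 : 1 <= 1 + t by rewrite lerDl.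
have tau0 : 0 < 1 + t by apply: lt_le_trans tau1.
have e0 := eps_gt0; have Lam0 := Lam_ge0; have L0 := L_ge0.
have c0p := c_gt0 t0; have [F1le F2le] := truncated_u_le n t0.
have U0 := Ubar_ge0; have k0 := kap_gt0.
have di : (c t)^-1 <= mu^-1 by rewrite lef_pV2 ?posrE// c_ge.
have d0 : 0 <= (c t)^-1 by rewrite invr_ge0 ltW.
have mi : 0 < mu^-1 by rewrite invr_gt0.
have kk : 0 <= c0 t ^+ 4 <= L ^+ 4.
  have c0t : 0 <= c0 t by apply: le_trans (c0_ge t0); exact: ltW.
  by rewrite exprn_ge0//= ler_pXn2r ?nnegrE// c0_le.
have ss : 0 <= sig t ^+ 2 <= S ^+ 2 by rewrite sqr_ge0 sig_le.
have diff := sqr_coefficient_diff t0.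
rewrite /weighted_error /parabolic_dissipation.
have F1p := Bge0 n (P n (u t)); have F2p := dot_ge0 hdot (B n (P n (u t))).
have F3p := Bge0 n (B n (P n (u t))); have F4p := dot_ge0 hdot (B n (B n (P n (u t)))).
have Wb := form_w0_le n; have Wn := sqr_P_le n w0.
have Wn0 := dot_ge0 hdot (P n w0); have Wb0 := Bge0 n (P n w0).
move: (dot (B n (P n (u t))) (P n (u t))) (dot (B n (P n (u t))) (B n (P n (u t))))
  (dot (B n (B n (P n (u t)))) (B n (P n (u t))))
  (dot (B n (B n (P n (u t)))) (B n (B n (P n (u t)))))
  (dot (P n w0) (P n w0)) (dot (B n (P n w0)) (P n w0))
  F1p F2p F3p F4p F1le F2le Wb Wn Wn0 Wb0 =>
  F1 F2 F3 F4 nw bw F1p F2p F3p F4p F1le F2le Wb Wn Wn0 Wb0.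
have psi0 := layer_gt0 eps t; move: (layer eps t) psi0 => psi psi0.
move: (1 + t) tau1 tau0 F1le F2le diff => tau tau1 tau0 F1le F2le diff.
apply: lerD; first apply: lerD.
(* By the parabolic decay both weighted forms of [u] are O(1 / tau); together with the tau^(-2) of
   [diff] this gives the power 3. *)
- have h1 : 16 * (c t)^-1 * (tau ^+ 3 * F2) + Lam ^+ 2 / 4 * (tau * F1) <=
     (4 * Ubar + Lam ^+ 2 / 4 * (Ubar / kap)) / tau.
    rewrite ler_pdivlMr// mulrDl; apply: lerD.
      rewrite (_ : _ * tau = 16 * ((c t)^-1 * (tau ^+ 4 * F2))); last by ring.
      apply: (@le_trans _ _ (16 * (mu^-1 * (mu / 4 * Ubar)))).
        by rewrite ler_wpM2l// ler_pM// mulr_ge0// exprn_ge0// ltW.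
      by rewrite le_eqVlt; apply/orP; left; apply/eqP; field; rewrite gt_eqF.
    rewrite (_ : _ * tau = Lam ^+ 2 / 4 * (tau ^+ 2 * F1)); last by ring.
    by rewrite ler_wpM2l// divr_ge0// sqr_ge0.
  apply: le_trans (_ : _ <= (c t - c0 t) ^+ 2 *
     ((4 * Ubar + Lam ^+ 2 / 4 * (Ubar / kap)) / tau)) _.
    by rewrite ler_wpM2l// sqr_ge0.
  apply: le_trans (ler_wpM2r _ diff) _.
    have z1 : 0 <= Ubar / kap by rewrite divr_ge0 ?(ltW k0).
    have z2 : 0 <= Lam ^+ 2 / 4 by rewrite divr_ge0// sqr_ge0.
    by apply: divr_ge0; [apply: addr_ge0; exact: mulr_ge0|exact: ltW].
  by rewrite le_eqVlt; apply/orP; left; apply/eqP; rewrite /Cd; field; rewrite !gt_eqF.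
- rewrite ler_wpM2l ?sqr_ge0//.
  have [/andP[k40 k4L] /andP[s20 s2S]] := (kk, ss).
  move: (c0 t ^+ 4) (sig t ^+ 2) k40 k4L s20 s2S => k4 s2 k40 k4L s20 s2S.
  have G1 : 0 <= tau * F1 by rewrite mulr_ge0// ltW.
  have G2 : 0 <= tau ^+ 3 * F2 by rewrite mulr_ge0 ?exprn_ge0// ltW.
  have G3 : 0 <= tau ^+ 5 * F3 by rewrite mulr_ge0 ?exprn_ge0// ltW.
  have G4 : 0 <= tau ^+ 7 * F4 by rewrite mulr_ge0 ?exprn_ge0// ltW.
  have a1 : 16 * (c t)^-1 * s2 <= 16 * S ^+ 2 / mu.
    by rewrite mulrAC ler_pM ?mulr_ge0// ler_wpM2l.
  have a2 : 8 * (c t)^-1 * k4 <= 8 * L ^+ 4 / mu ^+ 2 * mu.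
    rewrite (_ : _ / mu ^+ 2 * mu = 8 * L ^+ 4 / mu); last by field; rewrite gt_eqF.
    by rewrite mulrAC ler_pM ?mulr_ge0// ler_wpM2l.
  have l4 : 0 <= Lam ^+ 2 / 4 by rewrite divr_ge0// sqr_ge0.
  rewrite /Cb; move: (Lam ^+ 2 / 4) l4 => l l4.
  have A1 : 0 <= 16 * S ^+ 2 / mu by rewrite divr_ge0 ?(ltW mu0)// mulr_ge0// sqr_ge0.
  have A2 : 0 <= 8 * L ^+ 4 / mu ^+ 2.
    by rewrite divr_ge0 ?sqr_ge0// mulr_ge0// exprn_ge0.
  have LL : 0 <= L ^+ 4 by apply: le_trans k4L.
  have SS : 0 <= S ^+ 2 by apply: le_trans s2S.
  move: (S ^+ 2) (L ^+ 4) (16 * S ^+ 2 / mu) (8 * L ^+ 4 / mu ^+ 2) A1 A2 a1 a2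
    LL SS s2S k4L => x3 x4 x1 x2 A1 A2 a1 a2 LL SS s2S k4L.
  move: (16 * (c t)^-1 * s2) (8 * (c t)^-1 * k4) a1 a2 => y1 y2 a1 a2.
  have b1 : y1 * (tau ^+ 3 * F2) <= x1 * (tau ^+ 3 * F2) by exact: ler_wpM2r.
  have b2 : y2 * (tau ^+ 7 * F4) <= x2 * mu * (tau ^+ 7 * F4) by exact: ler_wpM2r.
  have b3 : s2 * (tau * F1) <= x3 * (tau * F1) by exact: ler_wpM2r.
  have b4 : k4 * (tau ^+ 5 * F3) <= x4 * (tau ^+ 5 * F3) by exact: ler_wpM2r.
  move: (tau ^+ 3 * F2) (tau ^+ 7 * F4) (tau * F1) (tau ^+ 5 * F3)
    G1 G2 G3 G4 b1 b2 b3 b4 => g2 g4 g1 g3 G1 G2 G3 G4 b1 b2 b3 b4.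
  have b34 : l * (s2 * g1 + k4 * g3) <= l * (x3 * g1 + x4 * g3).
    by rewrite ler_wpM2l// lerD.
  have z1 : 0 <= x1 * (g1 + g3 + mu * g4).
    by rewrite mulr_ge0// !addr_ge0// mulr_ge0// ltW.
  have z2 : 0 <= x2 * (g1 + g2 + g3) by rewrite mulr_ge0// !addr_ge0.
  have z3 : 0 <= l * x3 * (g2 + g3 + mu * g4).
    by rewrite mulr_ge0 ?mulr_ge0// !addr_ge0// mulr_ge0// ltW.
  have z4 : 0 <= l * x4 * (g1 + g2 + mu * g4).
    by rewrite mulr_ge0 ?mulr_ge0// !addr_ge0// mulr_ge0// ltW.
  lra.
- rewrite ler_wpM2l ?mulr_ge0 ?(ltW e0) ?(ltW psi0)// /Wbar.
  have tt : tau <= tau ^+ 2 by rewrite expr2 ler_peMl// ltW.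
  have t1 : 1 <= tau ^+ 2 by rewrite exprn_ege1.
  have LN : 0 <= Lam * nw by rewrite mulr_ge0.
  have LW : Lam * nw <= Lam * dot w0 w0 by rewrite ler_wpM2l.
  have q1 : 0 <= tau ^+ 2 * (2 * C1 + 2 * (L ^+ 2 * C3) - bw).
    by rewrite mulr_ge0 ?sqr_ge0// subr_ge0.
  have q2 : 0 <= tau ^+ 2 * (Lam * dot w0 w0 - Lam * nw).
    by rewrite mulr_ge0 ?sqr_ge0// subr_ge0.
  have q3 : 0 <= (tau ^+ 2 - tau) * (Lam * nw) by rewrite mulr_ge0// subr_ge0.
  have q4 : 0 <= (tau ^+ 2 - 1) * (Lam * nw) by rewrite mulr_ge0// subr_ge0.
  lra.
Qed.

Lemma rho_der n t : 0 <= t -> hder (rho n) t (r n t + layer eps t *: P n w0).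
Proof.
move=> t0; apply: hder_eq.
  by apply: hderB => //; [apply: (hder_P n t0 (vd t0))|apply: (u_truncated_der n t0)].
by rewrite /r subrK scaleNr opprK.
Qed.

Lemma c0_der t : 0 <= t -> hder (V := R^o) c0 t (c01 t).
Proof. by move=> t0; apply: coefficient_der => //; [exact: Auc|exact: ud]. Qed.

Lemma error_der n t : 0 <= t ->
  let b := dot (B n (rho n t)) (rho n t) in let a := dot (r n t) (r n t) in
  let tau := 1 + t in
  exists2 dP, hder (V := R^o) (fun s => weighted_energy dot (B n) Lam eps (c s)^-1
      (1 + s) (r n s) (rho n s)) t dP &
    dP <= - (tau * b + (c t)^-1 / 2 * (tau * a))
      + layer eps t / eps * (tau ^+ 2 * b + Lam / 2 * dot (rho n t) (rho n t))
      + (Cd * (s t / tau ^+ 3)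
         + eps ^+ 2 * (Cb * parabolic_dissipation dot (B n) mu (P n (u t)) tau)
         + eps * layer eps t * (tau ^+ 2 * Wbar)).
Proof.
move=> t0 b a tau; have [e0 eL _ _] := heps.
have [cL c1mu _ _] := hyperbolic_bounds t0.
have c0p := c_gt0 t0; have tau0 : 0 < tau by rewrite ltr_wpDr.
(* [y] is the truncation of u' and [y2] its derivative: boundedness of [B n] makes the truncation of
   [u] twice differentiable although [u] is only of class C^1. *)
set y := fun z => - ((1 + z) * c0 z) *: B n (P n (u z)).
pose y2 := - sig t *: B n (P n (u t)) + (tau ^+ 2 * c0 t ^+ 2) *: B n (B n (P n (u t))).
have yd : hder y t y2.
  apply: hder_eq.
    apply: hderZ => //.
      apply: hderN => //; apply: hderM => //; [exact: hder_1D|exact: c0_der].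
    by apply: (hderB_op (Blin n) (Bbd n)) => //; exact: (u_truncated_der n t0).
  rewrite /y2 (BE (Blin n)) scalerA mul1r -/tau; congr (_ *: _ + _ *: _) => /=; ring.
have rd : hder (r n) t (P n (v2 t) - y2 + (layer eps t / (eps * tau)) *: P n w0).
  rewrite (_ : r n = fun z => P n (v1 z) - y z - layer eps z *: P n w0); last first.
    by apply/funext => z; rewrite /r /y scaleNr opprK.
  apply: hder_eq.
    apply: hderB => //; first apply: hderB => //.
    - exact: (hder_P n t0 (v1d t0)).
    - exact: yd.
    - by apply: hderZ => //; [exact: (layer_der e0 t0)|exact: hder_cst].
  by rewrite scaler0 addr0 scaleNr opprK.
have en : eps != 0 by rewrite gt_eqF.
have tn : tau != 0 by rewrite gt_eqF.
pose g := (c t - c0 t - eps * sig t) *: B n (P n (u t))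
  + (eps * tau ^+ 2 * c0 t ^+ 2) *: B n (B n (P n (u t))).
have eqr : (eps * tau) *: (P n (v2 t) - y2 + (layer eps t / (eps * tau)) *: P n w0) =
    - r n t - (tau * c t) *: B n (rho n t) - tau *: g.
  rewrite scalerDr scalerBr (hyperbolic_truncated n t0) scalerA.
  rewrite (_ : eps * tau * (layer eps t / (eps * tau)) = layer eps t); last first.
    by field; rewrite en tn.
  rewrite /r /rho /g /y2 -/tau !(BE (Blin n)).
  move: (P n (v1 t)) (B n (P n (v t))) (P n w0) (B n (P n (u t)))
    (B n (B n (P n (u t)))) => z1 z2 z3 z4 z5.
  apply: (dot_inj hdot) => z; rewrite !dotE -/tau; ring.
have [||||| dP dPd dPle] := @weighted_energy_der R H dot hdot (B n) n%:R (Blin n)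
  (Bbd n) (Bsym n) (Bge0 n) Lam eps (rho n) (r n) (fun s => (c s)^-1) mu L (c t)
  (- c1 t / c t ^+ 2) (layer eps t) (c t - c0 t) (sig t) (c0 t) t _ g (P n (u t))
  (P n w0) mu0 e0 erefl eL t0 cL _ _ _ (rho_der n t0) rd _ eqr.
- by rewrite divff// gt_eqF.
- exact: inv_c_der_le.
- by rewrite (ltW (layer_gt0 _ _))//= layer_le1.
- exact: inv_c_der.
- by [].
exists dP => //; apply: le_trans dPle _.
by rewrite lerD2l; exact: weighted_error_le.
Qed.

Lemma eps_le8 : eps * 8 <= 1.
Proof.
have [e0 eL _ _] := heps.
have : 0 <= eps * (Lam * L).
  by rewrite mulr_ge0 ?(ltW e0)// mulr_ge0 ?Lam_ge0 ?L_ge0.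
lra.
Qed.

Lemma rho0 n : rho n 0 = 0.
Proof. by rewrite /rho v0 uu0 subrr. Qed.

(** [w0] is the initial value of v' - u'; without the corrector the energy would start at order eps
    instead of 0. *)
Lemma r0 n : r n 0 = 0.
Proof.
by rewrite /r v10 uu0 addr0 mul1r layer0 scale1r /w0 PD PZ -PA// subrr.
Qed.

(* [s] is not the form of a truncated error because [c - c0] is not. *)
Variable J : R -> R.
Hypothesis Jd : forall t, 0 <= t -> hder (V := R^o) J t (s t / (1 + t) ^+ 3).
Hypothesis J0 : J 0 = 0.

Let e8 := expR 8 : R.
Definition error_data_bound := Cb / 2 * Ubar + 2 * Wbar.
Local Notation C0 := error_data_bound.

Definition error_energy n t :=
  weighted_energy dot (B n) Lam eps (c t)^-1 (1 + t) (r n t) (rho n t).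

(* The exponent [8 * tau * psi] lies in [0, 8] and has derivative at most
   [- 4 * psi / eps], which absorbs the singular term of [weighted_energy_der]. *)
Definition error_Lyapunov n t :=
  expR (8 * ((1 + t) * layer eps t)) * error_energy n t
  + e8 * (Cb / 2 * eps ^+ 2 * parabolic_energy dot (B n) mu (P n (u t)) (1 + t)
          + 2 * Wbar * eps ^+ 2 * ((1 + t) ^+ 3 * layer eps t)
          - Cd * J t).

Lemma error_energy_ge n t : 0 <= t ->
  2^-1 * ((1 + t) ^+ 2 * (eps * ((c t)^-1 * dot (r n t) (r n t)) +
     dot (B n (rho n t)) (rho n t))) + Lam / 8 * dot (rho n t) (rho n t)
  <= error_energy n t.
Proof.
move=> t0; have [cL _ _ _] := hyperbolic_bounds t0; have [e0 eL _ _] := heps.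
apply: (weighted_energy_ge hdot (Bge0 n) _ _ mu0 e0 cL _ Lam_ge0 eL).
  by rewrite divff// gt_eqF// c_gt0.
by rewrite lerDl.
Qed.

Lemma bounds_ge0 : [/\ 0 <= Cb, 0 <= Wbar & 0 <= Cd].
Proof.
have L0 := L_ge0; have Lam0 := Lam_ge0; have U0 := Ubar_ge0; have k0 := kap_gt0.
have l2 : 0 <= Lam ^+ 2 / 4 by rewrite divr_ge0// sqr_ge0.
have Uk : 0 <= Ubar / kap by rewrite divr_ge0// ltW.
have PhiK0 : 0 <= PhiK.
  rewrite addr_ge0//; last by rewrite mulr_ge0// addr_ge0// (dot_ge0 hdot).
  by apply: le_trans hK'.
split.
- rewrite /Cb addr_ge0//; last by rewrite mulr_ge0// addr_ge0// ?sqr_ge0// exprn_ge0.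
  rewrite addr_ge0// divr_ge0 ?sqr_ge0 ?(ltW mu0)// mulr_ge0 ?sqr_ge0//.
  exact: exprn_ge0.
- have h1 : 0 <= C1 by apply: le_trans (hC1 0).
  have h3 : 0 <= C3 by apply: le_trans (hC3 0).
  have h2 : 0 <= L ^+ 2 * C3 by rewrite mulr_ge0// sqr_ge0.
  have h4 : 0 <= Lam * dot w0 w0 by rewrite mulr_ge0// (dot_ge0 hdot).
  by rewrite /Wbar; lra.
- have h1 : 0 <= Lam ^+ 2 / 4 * (Ubar / kap) by rewrite mulr_ge0.
  have h2 : 0 <= L' ^+ 2 * (2 * (2 * PhiK + Ubar / kap)).
    by rewrite mulr_ge0 ?sqr_ge0//; lra.
  by rewrite /Cd mulr_ge0//; lra.
Qed.

Lemma error_Lyapunov_der n t : 0 <= t ->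
  exists2 dX, hder (V := R^o) (error_Lyapunov n) t dX &
    dX <= - ((1 + t) * dot (B n (rho n t)) (rho n t) +
             (c t)^-1 / 2 * ((1 + t) * dot (r n t) (r n t))).
Proof.
move=> t0; have [e0 _ _ _] := heps; have c0p := c_gt0 t0.
have [dP dPd dPle] := error_der n t0.
have [dU dUd dUle] := parabolic_energy_der hdot (Blin n) (Bbd n) (Bsym n) (Bge0 n)
  mu0 c0_ge (@u_truncated_der n) t0.
have ge := error_energy_ge n t0.
have tau1 : 1 <= 1 + t by rewrite lerDl.
have tau0 : 0 < 1 + t by apply: lt_le_trans tau1.
eexists.
  apply: hderD => //.
    apply: hderM => //; last exact: dPd.
    apply: hder_expR => //.
      move=> z z0; rewrite mulr_ge0// mulr_ge0 ?(ltW (layer_gt0 _ _))//.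
      exact: addr_ge0.
    apply: hderM => //; first exact: hder_cst.
    by apply: hderM => //; [exact: hder_1D|exact: (layer_der e0 t0)].
  apply: hderM => //; first exact: hder_cst.
  apply: hderB => //; last by apply: hderM => //; [exact: hder_cst|exact: Jd].
  apply: hderD => //.
    by apply: hderM => //; [exact: hder_cst|exact: dUd].
  apply: hderM => //; first exact: hder_cst.
  by apply: hderM => //; [exact: hderX1|exact: (layer_der e0 t0)].
rewrite -/(error_energy n t).
have [Cb0 W0 Cd0] := bounds_ge0.
have y1 : 1 <= expR (8 * ((1 + t) * layer eps t)).
  have lay0 := ltW (layer_gt0 eps t); have tau0' := ltW tau0.
  rewrite -{1}expR0 ler_expR; apply: mulr_ge0 => //; exact: mulr_ge0.
have y8 : expR (8 * ((1 + t) * layer eps t)) <= e8.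
  rewrite ler_expR -[leRHS]mulr1 ler_wpM2l//.
  have := @layer_power_le _ _ e0 1 t t0; rewrite expr1; apply.
  by rewrite mul1r; exact: eps_le1.
have G0 : 0 <= parabolic_dissipation dot (B n) mu (P n (u t)) (1 + t).
  have tau0' := ltW tau0; have mu0' := ltW mu0.
  apply: addr_ge0; last by rewrite !mulr_ge0 ?exprn_ge0 ?(dot_ge0 hdot).
  apply: addr_ge0; last by rewrite mulr_ge0 ?exprn_ge0.
  by apply: addr_ge0; rewrite mulr_ge0 ?exprn_ge0 ?(dot_ge0 hdot).
have s0 := s_ge0 t0.
have di : 0 <= (c t)^-1 by rewrite invr_ge0 ltW.
have psi0 := layer_gt0 eps t.
have e8' := eps_le8.
have a0 := dot_ge0 hdot (r n t); have b0 := Bge0 n (rho n t).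
have n0 := dot_ge0 hdot (rho n t); have Lam0 := Lam_ge0.
move: dPle dUle ge y1 y8 G0; rewrite /= mul0r add0r !mul0r !add0r mul1r.
move: (expR _) e8 (error_energy n t) (parabolic_dissipation dot (B n) mu (P n (u t)) (1 + t))
  => y z Phi G dPle dUle ge y1 y8 G0.
have ie : 0 < eps^-1 by rewrite invr_gt0.
have ee : eps * eps^-1 = 1 by rewrite divff// gt_eqF.
have q0 : 0 <= (1 + t) ^+ 2 * (eps * ((c t)^-1 * dot (r n t) (r n t))).
  by rewrite !mulr_ge0 ?sqr_ge0// ltW.
move: (dot (r n t) (r n t)) (dot (B n (rho n t)) (rho n t)) (dot (rho n t) (rho n t))
  a0 b0 n0 dPle ge q0 => a b q a0 b0 nn0 dPle ge q0.
move: (s t) s0 dPle => st s0 dPle.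
move: (layer eps t) psi0 dPle => psi psi0 dPle.
move: (1 + t) tau1 tau0 dPle ge q0 => tau tau1 tau0 dPle ge q0.
move: ((c t)^-1) di dPle ge q0 => dd di dPle ge q0.
have -> : tau * - (psi / (eps * tau)) = - (psi * eps^-1).
  by field; rewrite !gt_eqF.
have -> : tau ^+ 3 * - (psi / (eps * tau)) = - (tau ^+ 2 * psi * eps^-1).
  by field; rewrite !gt_eqF.
rewrite -/(eps^-1) in dPle.
have j0 : 0 <= Cd * (st / tau ^+ 3).
  by rewrite mulr_ge0// divr_ge0// exprn_ge0// ltW.
move: (Cd * (st / tau ^+ 3)) j0 dPle => j j0 dPle.
set k := eps^-1 in ie ee dPle *.
have p1 : 0 <= psi * k by rewrite mulr_ge0 ?(ltW psi0)// ltW.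
have yy0 : 0 <= y by apply: le_trans y1.
have zy : 0 <= z - y by rewrite subr_ge0.
have z0 : 0 <= z by apply: le_trans y8.
have r1 : 0 <= y * (- (tau * b + dd / 2 * (tau * a)) + psi * k *
    (tau ^+ 2 * b + Lam / 2 * q) + (j + eps ^+ 2 * (Cb * G)
     + eps * psi * (tau ^+ 2 * Wbar)) - dP) by rewrite mulr_ge0// subr_ge0.
(* The factor 4 compares the coefficient Lam / 8 in the lower bound of [Phi] with Lam / 2 in the
   singular term. *)
have r2 : 0 <= y * (psi * k * (4 * Phi - (tau ^+ 2 * b + Lam / 2 * q))).
  rewrite mulr_ge0// mulr_ge0//.
  have : 0 <= tau ^+ 2 * b by rewrite mulr_ge0 ?sqr_ge0.
  lra.
have r3 : 0 <= z * (Cb / 2 * eps ^+ 2 * (- (2 * G) - dU)).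
  by rewrite mulr_ge0// mulr_ge0 ?subr_ge0// mulr_ge0 ?sqr_ge0// divr_ge0.
have W1 : 0 <= eps * psi * (tau ^+ 2 * Wbar).
  by rewrite !mulr_ge0 ?sqr_ge0// ltW.
have r4 : 0 <= (z - y) * (j + eps ^+ 2 * (Cb * G) + eps * psi * (tau ^+ 2 * Wbar)).
  by rewrite mulr_ge0// !addr_ge0// mulr_ge0 ?sqr_ge0// mulr_ge0.
(* The derivative of 2 Wbar eps^2 tau^3 psi is (6 eps - 2) eps Wbar tau^2 psi; for 6 eps <= 1 it
   outweighs the layer term. *)
have r5 : 0 <= z * (eps * psi * (tau ^+ 2 * Wbar)) * (1 - 6 * eps).
  by apply: mulr_ge0; [exact: mulr_ge0|lra].
have Q0 : 0 <= (y - 1) * (tau * b + dd / 2 * (tau * a)).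
  have tau0' := ltW tau0; rewrite mulr_ge0 ?subr_ge0// addr_ge0 ?mulr_ge0//.
have Phi0 : 0 <= Phi.
  have h1 : 0 <= tau ^+ 2 * b by rewrite mulr_ge0 ?sqr_ge0.
  have h2 : 0 <= Lam * q by rewrite mulr_ge0.
  lra.
have r6 : 0 <= y * Phi * psi * (k - 2).
  apply: mulr_ge0; first by apply: mulr_ge0; [exact: mulr_ge0|exact: ltW].
  have : 8 * (eps * k) <= k by rewrite mulrA [8 * _]mulrC ler_piMl// ltW.
  lra.
have r7 : eps ^+ 2 * k = eps by rewrite expr2 -mulrA ee mulr1.
have r8 : z * (2 * Wbar * eps ^+ 2 * (tau ^+ 2 * psi * k)) =
   2 * (z * (eps * psi * (tau ^+ 2 * Wbar))).
  by rewrite -[in RHS]r7; ring.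
lra.
Qed.

Lemma error_energy_ge0 n t : 0 <= t -> 0 <= error_energy n t.
Proof.
move=> t0; apply: le_trans (error_energy_ge n t0).
have Lam0 := Lam_ge0; have e0 := eps_gt0; have c0p := c_gt0 t0.
apply: addr_ge0; last by apply: mulr_ge0; [exact: divr_ge0|exact: dot_ge0].
rewrite mulr_ge0 ?invr_ge0// mulr_ge0 ?sqr_ge0// addr_ge0// mulr_ge0 ?(ltW e0)//.
by rewrite mulr_ge0 ?(dot_ge0 hdot)// invr_ge0 ltW.
Qed.

Lemma J_ge0 t : 0 <= t -> 0 <= J t.
Proof.
move=> t0; rewrite -oppr_le0 -oppr0 -J0.
apply: (@hder_nonincreasing R (fun t => - J t) (fun t => - (s t / (1 + t) ^+ 3))) => //.
  by move=> z /andP[z0 _]; apply: hderN => //; exact: Jd.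
move=> z /andP[z0 _]; rewrite oppr_le0 divr_ge0 ?s_ge0// exprn_ge0//.
exact: addr_ge0.
Qed.

Lemma e8_gt0 : 0 < e8.
Proof. exact: expR_gt0. Qed.

Lemma error_Lyapunov_ge n t : 0 <= t ->
  error_energy n t - e8 * (Cd * J t) <= error_Lyapunov n t.
Proof.
move=> t0; have [Cb0 W0 Cd0] := bounds_ge0; have E0 := error_energy_ge0 n t0.
have [U0 _ _] := parabolic_energy_ge n (P n (u t)) t0.
have lay0 := ltW (layer_gt0 eps t); have tau0 : 0 <= 1 + t by rewrite addr_ge0.
have y1 : 1 <= expR (8 * ((1 + t) * layer eps t)).
  by rewrite -{1}expR0 ler_expR; apply: mulr_ge0 => //; exact: mulr_ge0.
have h1 : 0 <= e8 * (Cb / 2 * eps ^+ 2 * parabolic_energy dot (B n) mu (P n (u t)) (1 + t)).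
  rewrite mulr_ge0 ?(ltW e8_gt0)//; apply: mulr_ge0 => //.
  by apply: mulr_ge0; [exact: divr_ge0|exact: sqr_ge0].
have h2 : 0 <= e8 * (2 * Wbar * eps ^+ 2 * ((1 + t) ^+ 3 * layer eps t)).
  rewrite mulr_ge0 ?(ltW e8_gt0)//; apply: mulr_ge0.
    by apply: mulr_ge0; [exact: mulr_ge0|exact: sqr_ge0].
  by apply: mulr_ge0 => //; exact: exprn_ge0.
have h3 : 0 <= (expR (8 * ((1 + t) * layer eps t)) - 1) * error_energy n t.
  by rewrite mulr_ge0// subr_ge0.
rewrite /error_Lyapunov; lra.
Qed.

Lemma error_Lyapunov0 n : error_Lyapunov n 0 <= e8 * (C0 * eps ^+ 2).
Proof.
have [Cb0 W0 Cd0] := bounds_ge0.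
rewrite /error_Lyapunov /error_energy rho0 r0 /weighted_energy.
rewrite (linear_map0 (Blin n)) !(dot0l, dot0r) !mulr0 !addr0 !mulr0 J0 mulr0 subr0.
rewrite addr0 mulr0 add0r layer0 expr1n !mulr1 ler_wpM2l ?(ltW e8_gt0)// /C0.
have := parabolic_energy_bound n (lexx 0); rewrite addr0 => h.
have h1 : 0 <= Cb / 2 * eps ^+ 2 * (Ubar - parabolic_energy dot (B n) mu (P n (u 0)) 1).
  apply: mulr_ge0; last by rewrite subr_ge0.
  by apply: mulr_ge0; [exact: divr_ge0|exact: sqr_ge0].
lra.
Qed.

Lemma error_Lyapunov_choice n : exists dX : R -> R, forall t, 0 <= t ->
  hder (V := R^o) (error_Lyapunov n) t (dX t) /\
  dX t <= - ((1 + t) * dot (B n (rho n t)) (rho n t) +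
             (c t)^-1 / 2 * ((1 + t) * dot (r n t) (r n t))).
Proof.
have /choice[dX hX] : forall t, exists d : R, 0 <= t ->
    hder (V := R^o) (error_Lyapunov n) t d /\
    d <= - ((1 + t) * dot (B n (rho n t)) (rho n t) +
             (c t)^-1 / 2 * ((1 + t) * dot (r n t) (r n t))).
  move=> t; have [t0|_] := boolP (0 <= t); last by exists 0.
  by have [d dd dle] := error_Lyapunov_der n t0; exists d.
by exists dX.
Qed.

Lemma dissipation_ge0 n t : 0 <= t ->
  0 <= (1 + t) * dot (B n (rho n t)) (rho n t) /\
  0 <= (c t)^-1 / 2 * ((1 + t) * dot (r n t) (r n t)).
Proof.
move=> t0; have tau0 : 0 <= 1 + t by rewrite addr_ge0.
have c0p := ltW (c_gt0 t0); split; first exact: mulr_ge0.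
by apply: mulr_ge0; [rewrite divr_ge0// invr_ge0|rewrite mulr_ge0// (dot_ge0 hdot)].
Qed.

Lemma error_Lyapunov_le n t : 0 <= t -> error_Lyapunov n t <= e8 * (C0 * eps ^+ 2).
Proof.
move=> t0; apply: le_trans (error_Lyapunov0 n).
have [dX hX] := error_Lyapunov_choice n.
apply: (@hder_nonincreasing R (error_Lyapunov n) dX) => // z /andP[z0 _].
  by have [] := hX z z0.
have [_ h] := hX z z0; have [h1 h2] := dissipation_ge0 n z0.
by apply: le_trans h _; rewrite oppr_le0 addr_ge0.
Qed.

Lemma error_energy_le n t : 0 <= t ->
  error_energy n t <= e8 * (C0 * eps ^+ 2 + Cd * J t).
Proof.
move=> t0; have h1 := error_Lyapunov_le n t0; have h2 := error_Lyapunov_ge n t0.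
lra.
Qed.

Lemma rho_cvg t : rho n t @[n --> \oo] --> v t - u t.
Proof. by apply: cvgB; exact: Pcvg. Qed.

Lemma form_rho_cvg t : 0 <= t ->
  dot (B n (rho n t)) (rho n t) @[n --> \oo] --> (s t : R^o).
Proof.
move=> t0; have [Dm _] := AB (Dv t0) (Du t0).
have -> : (fun n => dot (B n (rho n t)) (rho n t)) =
    (fun n => dot (B n (P n (v t - u t))) (P n (v t - u t))).
  by apply/funext => n; rewrite PB.
exact: form_P_cvg Dm.
Qed.

Definition residual t := v1 t + ((1 + t) * c0 t) *: A (u t) - layer eps t *: w0.

Lemma r_cvg t : 0 <= t -> r n t @[n --> \oo] --> residual t.
Proof.
move=> t0; have -> : (fun n => r n t) = (fun n => P n (residual t)).
  apply/funext => n; rewrite /residual PB PD !PZ PA//; exact: Du.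
exact: Pcvg.
Qed.

Lemma form_rho_le n t : 0 <= t ->
  (1 + t) ^+ 2 * dot (B n (rho n t)) (rho n t) <= 2 * error_energy n t.
Proof.
move=> t0; have ge := error_energy_ge n t0; have e0 := eps_gt0.
have Lam0 := Lam_ge0; have c0p := c_gt0 t0.
have h1 : 0 <= Lam / 8 * dot (rho n t) (rho n t).
  by apply: mulr_ge0; [exact: divr_ge0|exact: dot_ge0].
have h2 : 0 <= (1 + t) ^+ 2 * (eps * ((c t)^-1 * dot (r n t) (r n t))).
  rewrite mulr_ge0 ?sqr_ge0// mulr_ge0 ?(ltW e0)//.
  by rewrite mulr_ge0 ?(dot_ge0 hdot)// invr_ge0 ltW.
lra.
Qed.

Lemma s_le t : 0 <= t -> (1 + t) ^+ 2 * s t <= 2 * e8 * (C0 * eps ^+ 2 + Cd * J t).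
Proof.
move=> t0; have cv : (1 + t) ^+ 2 * dot (B n (rho n t)) (rho n t) @[n --> \oo]
    --> (1 + t) ^+ 2 * s t.
  by apply: cvgM; [exact: cvg_cst|exact: form_rho_cvg].
apply: (cvg_le_cst cv) => n; apply: le_trans (form_rho_le n t0) _.
by rewrite -mulrA ler_wpM2l// error_energy_le.
Qed.

Lemma error_data_bound_ge0 : 0 <= C0.
Proof.
have [Cb0 W0 Cd0] := bounds_ge0.
by rewrite addr_ge0// mulr_ge0 ?Ubar_ge0// divr_ge0.
Qed.

Let M := 2 * e8 * Cd.
Definition error_bound := e8 * (expR M * C0).
Local Notation Cs := error_bound.

Lemma error_bound_ge0 : 0 <= Cs.
Proof.
apply: mulr_ge0; first exact: ltW e8_gt0.
by apply: mulr_ge0; [exact: ltW (expR_gt0 _)|exact: error_data_bound_ge0].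
Qed.

(** By [s_le] the derivative of C0 eps^2 + Cd J is at most M / (1 + t)^2 times itself. The
    integrating factor exp (M / (1 + t)) decreases from exp M towards 1, whence the loss exp M. *)
Lemma Gronwall_J t : 0 <= t -> C0 * eps ^+ 2 + Cd * J t <= expR M * C0 * eps ^+ 2.
Proof.
move=> t0; have [Cb0 W0 Cd0] := bounds_ge0.
have M0 : 0 <= M by rewrite mulr_ge0// mulr_ge0 ?(ltW e8_gt0).
have tau0 (z : R) : 0 <= z -> 0 < 1 + z by move=> z0; rewrite ltr_wpDr.
have Ei (z : R) : 0 <= z -> 0 <= M / (1 + z).
  by move=> z0; rewrite divr_ge0// ltW// tau0.
have y0 z : 0 <= z -> 0 <= C0 * eps ^+ 2 + Cd * J z.
  move=> z0; apply: addr_ge0.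
    by apply: mulr_ge0; [exact: error_data_bound_ge0|exact: sqr_ge0].
  by apply: mulr_ge0 => //; exact: J_ge0.
apply: (@le_trans _ _ (expR (M / (1 + t)) * (C0 * eps ^+ 2 + Cd * J t))).
  by rewrite ler_peMl ?y0// -{1}expR0 ler_expR Ei.
rewrite [leRHS](_ : _ = expR (M / (1 + 0)) * (C0 * eps ^+ 2 + Cd * J 0)); last first.
  by rewrite addr0 divr1 J0 mulr0 addr0 mulrA.
apply: (@hder_nonincreasing R (fun t => expR (M / (1 + t)) * (C0 * eps ^+ 2 + Cd * J t))
  (fun t => expR (M / (1 + t)) * (Cd * (s t / (1 + t) ^+ 3)
    - M / (1 + t) ^+ 2 * (C0 * eps ^+ 2 + Cd * J t)))) => //.
  move=> z /andP[z0 _]; apply: hder_eq.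
    apply: hderM => //.
      apply: hder_expR => //.
      apply: hderM => //; first exact: hder_cst.
      by apply: hder_inv => //; exact: hder_1D.
    apply: hderD => //; first exact: hder_cst.
    by apply: hderM => //; [exact: hder_cst|exact: Jd].
  by rewrite mul0r !add0r mul0r add0r; ring.
move=> z /andP[z0 _]; apply: mulr_ge0_le0; first exact: ltW (expR_gt0 _).
rewrite subr_le0; have tz := tau0 z z0.
have h := s_le z0; have yz := y0 z z0.
have sz := s_ge0 z0; have t1 : 1 <= 1 + z by rewrite lerDl.
have key : s z / (1 + z) ^+ 3 <= 2 * e8 * (C0 * eps ^+ 2 + Cd * J z) / (1 + z) ^+ 2.
  rewrite ler_pdivrMr ?exprn_gt0//.
  rewrite [leRHS](_ : _ = (2 * e8 * (C0 * eps ^+ 2 + Cd * J z)) * (1 + z)); last first.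
    by field; rewrite gt_eqF.
  apply: (@le_trans _ _ ((1 + z) ^+ 2 * s z)); first by rewrite ler_peMl// exprn_ege1.
  apply: le_trans h _; rewrite ler_peMr//.
  by apply: mulr_ge0 => //; rewrite mulr_ge0// ltW// e8_gt0.
apply: le_trans (ler_wpM2l Cd0 key) _.
by rewrite le_eqVlt; apply/orP; left; apply/eqP; rewrite /M; ring.
Qed.

Lemma error_energy_bound n t : 0 <= t -> error_energy n t <= Cs * eps ^+ 2.
Proof.
move=> t0; apply: le_trans (error_energy_le n t0) _.
rewrite [leRHS](_ : _ = e8 * (expR M * C0 * eps ^+ 2)); last by rewrite /Cs; ring.
by apply: ler_wpM2l; [exact: ltW e8_gt0|exact: Gronwall_J].
Qed.

Lemma sqr_rho_le t : 0 <= t ->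
  dot (v t - u t) (v t - u t) <= 4 / 3 * mu * Cs * eps ^+ 2.
Proof.
move=> t0; have cv : dot (rho n t) (rho n t) @[n --> \oo] -->
    (dot (v t - u t) (v t - u t) : R^o).
  by apply: cvg_dot => //; exact: rho_cvg.
apply: (cvg_le_cst cv) => n.
have ge := error_energy_ge n t0; have le := error_energy_bound n t0.
have c0p := c_gt0 t0; have e0 := eps_gt0.
have h : 0 <= (1 + t) ^+ 2 * (eps * ((c t)^-1 * dot (r n t) (r n t)) +
     dot (B n (rho n t)) (rho n t)).
  rewrite mulr_ge0 ?sqr_ge0// addr_ge0// mulr_ge0 ?(ltW e0)//.
  by rewrite mulr_ge0 ?(dot_ge0 hdot)// invr_ge0 ltW.
have h2 : Lam / 8 * dot (rho n t) (rho n t) <= Cs * eps ^+ 2 by lra.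
(* [4 / 3 * mu] is 8 / Lam. *)
rewrite [leLHS](_ : _ = 4 / 3 * mu * (Lam / 8 * dot (rho n t) (rho n t))); last first.
  by rewrite /Lam; field; rewrite gt_eqF.
by rewrite -(mulrA _ Cs) ler_wpM2l// mulr_ge0// ltW.
Qed.

Lemma form_error_le t : 0 <= t -> (1 + t) ^+ 2 * s t <= 2 * Cs * eps ^+ 2.
Proof.
move=> t0; apply: le_trans (s_le t0) _.
rewrite -mulrA [leRHS](_ : _ = 2 * (e8 * (expR M * C0 * eps ^+ 2))); last by rewrite /Cs; ring.
apply: ler_wpM2l => //; apply: ler_wpM2l; [exact: ltW e8_gt0|exact: Gronwall_J].
Qed.

(** The energy controls only eps |r|^2, so its bound of order eps^2 leaves order eps for |r|^2: this
    is the origin of the square root of eps in the estimate of r'. *)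
Lemma sqr_residual_le t : 0 <= t ->
  (1 + t) ^+ 2 * dot (residual t) (residual t) <= 2 * L * Cs * eps.
Proof.
move=> t0; have cv : (1 + t) ^+ 2 * dot (r n t) (r n t) @[n --> \oo] -->
    (1 + t) ^+ 2 * dot (residual t) (residual t).
  apply: cvgM; first exact: cvg_cst.
  by apply: cvg_dot => //; exact: r_cvg.
apply: (cvg_le_cst cv) => n.
have ge := error_energy_ge n t0; have le := error_energy_bound n t0.
have c0p := c_gt0 t0; have e0 := eps_gt0; have Lam0 := Lam_ge0.
have [/andP[_ cL] _ _ _] := hyperbolic_bounds t0.
have h1 : 0 <= Lam / 8 * dot (rho n t) (rho n t).
  by apply: mulr_ge0; [exact: divr_ge0|exact: dot_ge0].
have h2 : 0 <= (1 + t) ^+ 2 * dot (B n (rho n t)) (rho n t).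
  by rewrite mulr_ge0// sqr_ge0.
have h3 : (1 + t) ^+ 2 * (eps * ((c t)^-1 * dot (r n t) (r n t))) <=
    2 * (Cs * eps ^+ 2) by lra.
have a0 : 0 <= (1 + t) ^+ 2 * dot (r n t) (r n t).
  by rewrite mulr_ge0 ?sqr_ge0// (dot_ge0 hdot).
have h4 : (1 + t) ^+ 2 * dot (r n t) (r n t) <= c t * (2 * (Cs * eps)).
  rewrite -ler_pdivrMl// -(ler_pM2l e0).
  rewrite [leLHS](_ : _ = (1 + t) ^+ 2 * (eps * ((c t)^-1 * dot (r n t) (r n t)))); last by ring.
  by rewrite [leRHS](_ : _ = 2 * (Cs * eps ^+ 2))//; ring.
apply: le_trans h4 _.
have Cs0 : 0 <= Cs * eps.
  by rewrite mulr_ge0 ?error_bound_ge0 ?(ltW e0).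
rewrite [leRHS](_ : _ = L * (2 * (Cs * eps))); last by ring.
by rewrite ler_wpM2r// mulr_ge0.
Qed.

(** The Lyapunov function may become negative, by at most e8 Cd J; the Gronwall bound covers this
    together with the initial value. *)
Lemma error_Lyapunov_drop n t : 0 <= t ->
  error_Lyapunov n 0 - error_Lyapunov n t <= Cs * eps ^+ 2.
Proof.
move=> t0; have h1 := error_Lyapunov0 n; have h2 := error_Lyapunov_ge n t0.
have h3 := error_energy_ge0 n t0.
have h4 := Gronwall_J t0.
have h5 : e8 * (C0 * eps ^+ 2 + Cd * J t) <= Cs * eps ^+ 2.
  rewrite [leRHS](_ : _ = e8 * (expR M * C0 * eps ^+ 2)); last by rewrite /Cs; ring.
  by apply: ler_wpM2l; [exact: ltW e8_gt0|exact: Gronwall_J].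
lra.
Qed.

Lemma r_cont n t : 0 <= t -> hcont (r n) t.
Proof.
move=> t0; have FF := half_nbhs_filter t0; have e0 := eps_gt0.
apply: cvgB.
  apply: cvgD; first exact: (hder_cont t0 (hder_P n t0 (v1d t0))).
  apply: cvgZ; last first.
    exact: (hder_cont t0 (hderB_op (Blin n) (Bbd n) t0 (u_truncated_der n t0))).
  by apply: cvgM; [exact: (hder_cont t0 (hder_1D t0))|exact: (hder_cont t0 (c0_der t0))].
by apply: cvgZ; [exact: (hder_cont t0 (layer_der e0 t0))|exact: cvg_cst].
Qed.

Lemma integral_form_error_le :
  (\int[lebesgue_measure]_(t in `[0%R, +oo[) ((1 + t) * s t)%:E
    <= (Cs * eps ^+ 2)%:E)%E.
Proof.
apply: (@integral_half_line_le R (fun n t => (1 + t) * dot (B n (rho n t)) (rho n t))).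
- move=> n t t0; have FF := half_nbhs_filter t0.
  apply: cvgM; first exact: (hder_cont t0 (hder_1D t0)).
  exact: (hder_cont t0 (hder_form hdot (Blin n) (Bbd n) (Bsym n) t0 (rho_der n t0))).
- by move=> n t t0; case: (dissipation_ge0 n t0).
- by move=> t t0; apply: cvgM; [exact: cvg_cst|exact: form_rho_cvg].
- move=> n T T0; have [dX hX] := error_Lyapunov_choice n.
  apply: (@integral_le_Lyapunov R _ (error_Lyapunov n) dX T _ T0) => [t t0|t t0|t t0|].
  + have FF := half_nbhs_filter t0.
    apply: cvgM; first exact: (hder_cont t0 (hder_1D t0)).
    exact: (hder_cont t0 (hder_form hdot (Blin n) (Bbd n) (Bsym n) t0 (rho_der n t0))).
  + by have [] := hX t t0.
  + have [_ h] := hX t t0; have [_ h2] := dissipation_ge0 n t0.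
    by apply: le_trans h _; rewrite opprD gerDl oppr_le0.
  + exact: error_Lyapunov_drop (ltW T0).
Qed.

(** Unlike the energy, the dissipation contains (1 + t) |r|^2 without a factor eps, so that the full
    order eps^2 is kept; 2 L undoes the factor 1 / (2 c). *)
Lemma integral_residual_le :
  (\int[lebesgue_measure]_(t in `[0%R, +oo[) ((1 + t) * dot (residual t) (residual t))%:E
    <= (2 * L * Cs * eps ^+ 2)%:E)%E.
Proof.
have cf n t : 0 <= t -> hcont (V := R^o) (fun t => (1 + t) * dot (r n t) (r n t)) t.
  move=> t0; have FF := half_nbhs_filter t0.
  apply: cvgM; first exact: (hder_cont t0 (hder_1D t0)).
  by apply: cvg_dot => //; exact: r_cont.
apply: (@integral_half_line_le R (fun n t => (1 + t) * dot (r n t) (r n t))) => //.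
- move=> n t t0; rewrite mulr_ge0 ?(dot_ge0 hdot)//; exact: addr_ge0.
- move=> t t0; apply: cvgM; first exact: cvg_cst.
  by apply: cvg_dot => //; exact: r_cvg.
- move=> n T T0; have [dX hX] := error_Lyapunov_choice n; have L0 := L_ge0.
  apply: (@integral_le_Lyapunov R _ (fun t => 2 * L * error_Lyapunov n t)
    (fun t => 2 * L * dX t) T _ T0) => [t t0|t t0|t t0|]; first exact: cf.
  + apply: hder_eq.
      by apply: hderM => //; [exact: hder_cst|exact: (hX t t0).1].
    by rewrite mul0r add0r.
  + have [_ h] := hX t t0; have [h1 _] := dissipation_ge0 n t0.
    have [/andP[_ cL] _ _ _] := hyperbolic_bounds t0; have c0p := c_gt0 t0.
    have a0 : 0 <= (1 + t) * dot (r n t) (r n t).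
      by rewrite mulr_ge0 ?(dot_ge0 hdot)//; exact: addr_ge0.
    have LL : 0 <= 2 * L by rewrite mulr_ge0.
    apply: le_trans (ler_wpM2l LL h) _; rewrite mulrN lerN2.
    apply: (@le_trans _ _ (2 * L * ((c t)^-1 / 2 * ((1 + t) * dot (r n t) (r n t))))).
      rewrite [leRHS](_ : _ = L / c t * ((1 + t) * dot (r n t) (r n t))).
        by rewrite ler_peMl// ler_pdivlMr// mul1r.
      by field; rewrite gt_eqF.
    by rewrite ler_wpM2l// lerDr.
  + rewrite -mulrBr -(mulrA _ Cs) ler_wpM2l ?mulr_ge0//.
    exact: error_Lyapunov_drop (ltW T0).
Qed.

Lemma error_estimates :
  [/\ forall t, 0 <= t ->
        dot (v t - u t) (v t - u t) <= 4 / 3 * mu * Cs * eps ^+ 2,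
      forall t, 0 <= t ->
        (1 + t) ^+ 2 * dot (A (v t - u t)) (v t - u t) <= 2 * Cs * eps ^+ 2,
      forall t, 0 <= t ->
        (1 + t) ^+ 2 * dot (residual t) (residual t) <= 2 * L * Cs * eps,
      (\int[lebesgue_measure]_(t in `[0%R, +oo[)
         ((1 + t) * dot (A (v t - u t)) (v t - u t))%:E
       <= (Cs * eps ^+ 2)%:E)%E &
      (\int[lebesgue_measure]_(t in `[0%R, +oo[)
         ((1 + t) * dot (residual t) (residual t))%:E
       <= (2 * L * Cs * eps ^+ 2)%:E)%E].
Proof.
split; [exact: sqr_rho_le|exact: form_error_le|exact: sqr_residual_le|
  exact: integral_form_error_le|exact: integral_residual_le].
Qed.

End Error.

End HyperbolicBounds.
End Kirchhoff.

(** * Choice of the constants and conclusion *)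

Lemma C_dom_hcont (R : realType) (H : completeNormedModType R) (A : operator H)
    (f : R -> H) (t : R) :
  (forall x y, dom A x -> dom A y -> A (x - y) = A x - A y) ->
  C_dom A 0 f -> 0 <= t -> hcont (fun s => A (f s)) t.
Proof.
move=> AB fc t0; have [ft h] := fc t t0; apply/cvgrPdist_lt => e e0.
move/cvgrPdist_lt : h => /(_ e e0) h; have ge0 := half_nbhs_ge0 t.
move: h ge0; rewrite /half_nbhs; apply: filterS2 => s h s0.
have [fs _] := fc s s0.
rewrite distrC -AB//; apply: le_lt_trans h.
rewrite sub0r normrN /graph_norm ger0_norm ?sqrtr_ge0//.
by rewrite -[leLHS]ger0_norm// -sqrtr_sqr ler_wsqrtr// lerDr sqr_ge0.
Qed.

Lemma small_mul_lt (R : realFieldType) (X b : R) : 0 < b ->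
  exists2 d, 0 < d & forall e, 0 < e < d -> e * X < b.
Proof.
move=> b0; have X1 : 0 < `|X| + 1 by rewrite ltr_wpDl.
exists (b / (`|X| + 1)) => [|e /andP[e0]]; first exact: divr_gt0.
rewrite ltr_pdivlMr//; apply: le_lt_trans.
by rewrite ler_pM2l// (le_trans (ler_norm _))// lerDl.
Qed.

Lemma norm_le_of_sqr (R : realType) (H : completeNormedModType R) (x : H)
    (tau q Q C : R) : 0 < tau -> 0 <= q -> 0 <= C -> Q <= C ^+ 2 ->
  tau ^+ 2 * `|x| ^+ 2 <= Q * q ^+ 2 -> `|x| <= C * (q / tau).
Proof.
move=> tau0 q0 C0 QC h; rewrite mulrA ler_pdivlMr//.
rewrite -(@ler_pXn2r _ 2) ?nnegrE ?mulr_ge0 ?(ltW tau0)//.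
rewrite !exprMn mulrC; apply: le_trans h _.
by rewrite ler_wpM2r// sqr_ge0.
Qed.

Theorem theorem2p2
    (R : realType) (H : completeNormedModType R)
    (dot : {dot H for (@idfun R)}) (hdot : induces_norm dot)
    (A : operator H) (hA : self_adjoint dot A)
    (hA0 : nonnegative_operator dot A)
    (m : R -> R)
    (hmC1 : half_line_C [set: R^o] (fun x : R^o => `|x|) 1 m)
    (hmpos : forall sigma, 0 <= sigma -> 0 < m sigma)
    (hminf : 0 < inf [set m sigma | sigma in `[0, +oo[])
    (u0 u1 : H)
    (hu0 : dom (operator_power dot A (3 / 2)) u0)
    (hu1 : dom (half_power dot A) u1)
    (u : R -> H) (hu : parabolic_solution dot A m u0 u) :
  exists eps0 C : R, [/\ 0 < eps0, 0 < C &
    forall eps : R, 0 < eps < eps0 ->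
    forall ueps theta : R -> H,
      hyperbolic_solution dot A m eps u0 u1 ueps ->
      corrector dot A m eps u0 u1 theta ->
      let Ah := half_power dot A in
      let rho := fun t : R => ueps t - u t in
      let r := fun t : R => ueps t - u t - theta t in
      [/\ forall t, 0 <= t -> `|rho t| <= C * eps,
          forall t, 0 <= t -> `|Ah (rho t)| <= C * (eps / (1 + t)),
          forall t, 0 <= t -> `|hderiv r t| <= C * (Num.sqrt eps / (1 + t)),
          (\int[lebesgue_measure]_(s in `[0%R, +oo[)
             ((1 + s) * `|Ah (rho s)| ^+ 2)%:E <= (C * eps ^+ 2)%:E)%E &
          (\int[lebesgue_measure]_(s in `[0%R, +oo[)
             ((1 + s) * `|hderiv r s| ^+ 2)%:E <= (C * eps ^+ 2)%:E)%E]].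
Proof.
have AD x y : dom A x -> dom A y -> dom A (x + y) /\ A (x + y) = A x + A y.
  by move=> Dx Dy; have [[_ h] _ _] := hA; have := h 1 x y Dx Dy; rewrite !scale1r.
have AB x y : dom A x -> dom A y -> dom A (x - y) /\ A (x - y) = A x - A y.
  move=> Dx Dy; have [[_ h] _ _] := hA; have := h (-1) y x Dy Dx.
  by rewrite !scaleN1r ![- _ + _]addrC.
have AB2 x y : dom A x -> dom A y -> A (x - y) = A x - A y.
  by move=> Dx Dy; exact: (AB x y Dx Dy).2.
have [[uC uD] ueq uu0] := hu.
have Du t : 0 <= t -> dom A (u t) by move=> t0; have [] := uD t t0.
have Du0 : dom A u0 by rewrite -uu0; exact: Du.
have Asym x y : dom A x -> dom A y -> dot (A x) y = dot x (A y).
  exact: (self_adjoint_sym hA).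
have [P [B [[Plin Ple] Pcvg [Blin Bbd] [Bsym Bge0] [PA Ahsq [C1 hC]]]]] :=
  spectral_truncation hdot hA hA0 hu0 hu1 Du0.
have hC1 n : dot (B n (P n u1)) (P n u1) <= C1 by have [] := hC n.
have hC3 n : dot (B n (P n (A u0))) (P n (A u0)) <= C1 by have [] := hC n.
pose mu := inf [set m sigma | sigma in `[0, +oo[].
have mge s : 0 <= s -> mu <= m s.
  move=> s0; apply: ge_inf; last by exists s => //=; rewrite in_itv/= s0.
  by exists 0 => _ [x /=] /[!in_itv]/= /[!andbT] x0 <-; exact: ltW (hmpos _ _).
have [hm1 hm2] := hmC1.
pose m1 := hderiv (V := R^o) m.
have md s : 0 <= s -> hder (V := R^o) m s (m1 s).
  by move=> s0; exact: half_differentiable_hder hm1.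
have m1c s : 0 <= s -> hcont (V := R^o) m1 s.
  by move=> s0; exact: half_continuous_hcont hm2.
(* [K] bounds both <A v, v> and <A u, u>, so that the same [L] and [L'] control [m] and [m1] along
   both solutions. *)
pose K := Num.max (dot u1 u1 / mu + `|A u0| * `|u0|)
  (parabolic_bound dot A mu u0 C1 / ((2 * (4 / mu) + 1) / mu)).
have hK : dot u1 u1 / mu + `|A u0| * `|u0| <= K by rewrite le_max lexx.
have hK' : parabolic_bound dot A mu u0 C1 / ((2 * (4 / mu) + 1) / mu) <= K.
  by rewrite le_max lexx orbT.
have [L hL1] : exists L, forall s, 0 <= s <= K -> `|m s| <= L.
  by apply: half_line_bounded => s s0; exact: hder_cont (md s s0).
have [L' hL2] : exists L, forall s, 0 <= s <= K -> `|m1 s| <= L.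
  exact: half_line_bounded.
have hL s : 0 <= s <= K -> m s <= L /\ `|m1 s| <= L'.
  by move=> sK; split; [exact: le_trans (ler_norm _) (hL1 s sK)|exact: hL2].
have L0 : 0 <= L.
  have K0 : 0 <= K.
    apply: le_trans hK; apply: addr_ge0; last exact: mulr_ge0.
    by apply: divr_ge0; [exact: dot_ge0|exact: ltW].
  by apply: le_trans (hL1 0 _) => //; rewrite lexx.
have coef (f : R -> H) t : dom A (f t) ->
    coefficient dot A m f t = m (`|half_power dot A (f t)| ^+ 2).
  by move=> ?; rewrite /coefficient Ahsq.
have ud t : 0 <= t -> hder u t (- ((1 + t) * coefficient dot A m u t) *: A (u t)).
  move=> t0; have [uC1 _] := uC.
  apply: hder_eq (half_differentiable_hder t0 uC1) _.
  have t1 : 1 + t != 0 by rewrite gt_eqF// ltr_wpDr.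
  have := ueq t t0; rewrite -coef; last exact: Du.
  move=> /eqP; rewrite addr_eq0 => /eqP h.
  by rewrite scaleNr -scalerA -scalerN -h scalerA divff// scale1r.
have Auc t : 0 <= t -> hcont (fun s => A (u s)) t by exact: C_dom_hcont.
(* No [eps] and no hyperbolic solution occurs in [Cs]. [C1] stands twice because the truncation
   gives one constant for both data. *)
pose Cs := error_bound dot A m mu u0 u1 C1 K L L' C1 u.
have Cs0 : 0 <= Cs.
  exact: (error_bound_ge0 hdot hA0 Plin Ple Blin Bbd Bsym Bge0 PA hminf mge
    Du0 hC1 hK hL hC3 Du ud uu0 hK').
have [d1 d10 hd1] := small_mul_lt (8 * (1 + 6 / mu * L)) (@ltr01 R).
have [d2 d20 hd2] := small_mul_lt
  `|m1 (dot (A u0) u0) * (2 * dot (A u0) u1)| hminf.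
have mu2 : 0 < mu ^+ 2 by rewrite exprn_gt0.
have [d3 d30 hd3] := small_mul_lt (8 * L' ^+ 2 * (C1 / mu + dot (A u0) (A u0)) *
      hyperbolic_weighted_bound dot mu u0 u1 K * L) mu2.
have a1 : 0 <= 4 / 3 * mu * Cs.
  apply: mulr_ge0 => //; apply: mulr_ge0; last exact: ltW.
  by rewrite divr_ge0.
have a2 : 0 <= 2 * L * Cs by apply: mulr_ge0 => //; exact: mulr_ge0.
(* The summand 1 gives C <= C^2, so that [C] dominates the coefficients of the squared estimates as
   well as their square roots. *)
pose C := 1 + (4 / 3 * mu * Cs + 2 * Cs + 2 * L * Cs).
have [C1' Ca Cb Cc] :
    [/\ 1 <= C, 4 / 3 * mu * Cs <= C, 2 * Cs <= C & 2 * L * Cs <= C].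
  have a3 : 0 <= 2 * Cs by exact: mulr_ge0.
  rewrite /C; move: a1 a2 a3; clear => a1 a2 a3; split; lra.
have C_ge0 : 0 <= C by apply: le_trans C1'.
have leC2 Q : Q <= C -> Q <= C ^+ 2.
  by move=> /le_trans; apply; rewrite expr2 ler_peMl.
exists (Num.min d1 (Num.min d2 d3)), C.
split; [by rewrite !lt_min d10 d20| exact: lt_le_trans ltr01 C1' |].
move=> eps /andP[e0]; rewrite !lt_min => /and3P[e1 e2 e3] v theta hv htheta.
move=> Ah rho r.
have heps : hyperbolic_smallness dot A m1 mu u0 u1 C1 K L L' eps.
  by split => //; [apply: ltW; apply: hd1|apply: hd2|apply: hd3]; rewrite e0.
have [[[vC1 [vC2 _]] _ vD] veq v0 v10] := hv.
have Dv t : 0 <= t -> dom A (v t) by move=> t0; have [] := vD t t0.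
have Avc t : 0 <= t -> hcont (fun s => A (v s)) t by exact: C_dom_hcont.
have vd t : 0 <= t -> hder v t (hderiv v t).
  by move=> t0; exact: half_differentiable_hder vC1.
have v1d t : 0 <= t -> hder (hderiv v) t (hderiv (hderiv v) t).
  by move=> t0; exact: half_differentiable_hder vC2.
have eqv t : 0 <= t -> eps *: hderiv (hderiv v) t + (1 + t)^-1 *: hderiv v t +
    coefficient dot A m v t *: A (v t) = 0.
  by move=> t0; rewrite coef; [exact: veq|exact: Dv].
(* The integrand of [J], with A (v - u) expanded because continuity is known for [A v] and [A u]
   separately. *)
have [F Fd] : exists F : R -> R, forall t : R, 0 <= t -> is_derive t 1 (F : R -> R^o)
    (dot (A (v t) - A (u t)) (v t - u t) / (1 + t) ^+ 3).
  apply: half_line_primitive => t t0; have FF := half_nbhs_filter t0.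
  apply: cvgM.
    apply: cvg_dot => //; first by apply: cvgB; [exact: Avc|exact: Auc].
    exact: hder_cont t0 (hderB t0 (vd t t0) (ud t t0)).
  apply: cvgV; first by rewrite gt_eqF// exprn_gt0// ltr_wpDr.
  exact: hder_cont t0 (hderX1 3 t0).
pose J t := F t - F 0.
have Jd t : 0 <= t ->
    hder (V := R^o) J t (dot (A (v t - u t)) (v t - u t) / (1 + t) ^+ 3).
  move=> t0; rewrite AB2; [|exact: Dv|exact: Du].
  apply: hder_eq (hderB t0 (is_derive_hder t0 (Fd t t0)) (hder_cst _ _)) _.
  by rewrite subr0.
have J0 : J 0 = 0 by rewrite /J subrr.
have [E1 E2 E3 E4 E5] := error_estimates hdot AD AB Asym hA0 Plin Ple Pcvg Blin
  Bbd Bsym Bge0 PA hminf mge md m1c Du0 hC1 hK hL heps Dv Avc vd v1d eqv v0 v10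
  hC3 Du Auc ud uu0 hK' Jd J0.
have Ahrho t : 0 <= t -> `|Ah (rho t)| ^+ 2 = dot (A (v t - u t)) (v t - u t).
  by move=> t0; apply: Ahsq; exact: (AB _ _ (Dv t t0) (Du t t0)).1.
have [[thC1 [thC2 _]] theq th0 th10] := htheta.
have thd t : 0 <= t -> hder theta t (hderiv theta t).
  by move=> t0; exact: half_differentiable_hder thC1.
have th1d t : 0 <= t -> hder (hderiv theta) t (hderiv (hderiv theta) t).
  by move=> t0; exact: half_differentiable_hder thC2.
(* u' is read off its equation, and theta' is the layer times its initial value by uniqueness. *)
have rd t : 0 <= t -> hderiv r t = residual dot A m u0 u1 eps (hderiv v) u t.
  move=> t0; rewrite (hder_hderiv t0 (hderB t0 (hderB t0 (vd t t0) (ud t t0)) (thd t t0))).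
  rewrite (layer_unique e0 hdot t0 th1d theq) th10 /residual scaleNr opprK.
  by rewrite /coefficient uu0 (Ahsq u0).
split.
- move=> t t0; rewrite -[eps]divr1.
  apply: (@norm_le_of_sqr _ _ _ _ _ (4 / 3 * mu * Cs)) => //; first exact: ltW.
    exact: leC2.
  by rewrite expr1n mul1r hdot; exact: E1.
- move=> t t0.
  apply: (@norm_le_of_sqr _ _ _ _ _ (2 * Cs)) => //; [by rewrite ltr_wpDr|exact: ltW| |].
    exact: leC2.
  by rewrite Ahrho//; exact: E2.
- move=> t t0.
  apply: (@norm_le_of_sqr _ _ _ _ _ (2 * L * Cs)) => //; first by rewrite ltr_wpDr.
    exact: leC2.
  by rewrite sqr_sqrtr ?(ltW e0)// rd// hdot; exact: E3.
- under eq_integral => s /set_mem /=.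
    rewrite in_itv/= andbT => s0; rewrite Ahrho//; over.
  apply: le_trans E4 _; rewrite lee_fin ler_wpM2r ?sqr_ge0//.
  by apply: le_trans Cb; rewrite -/Cs ler_peMl// ler1n.
- under eq_integral => s /set_mem /=.
    rewrite in_itv/= andbT => s0; rewrite rd// hdot; over.
  apply: le_trans E5 _; by rewrite lee_fin ler_wpM2r ?sqr_ge0.
Qed.
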